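(* Assume the Riemann hypothesis is true. Then for every integer $k \geq 3.900491 \times 10^{30}$, \[ \frac{N_k}{\varphi(N_k)} > e^{\gamma} \left( \log k + \log\log k + \frac{\log\log k -1}{\log k} - \frac{(\log\log k)^2 - 4\log\log k + 5}{2(\log k)^2}\right). \]
   Context: $\varphi$ is Euler's totient function and $\gamma$ is the Euler–Mascheroni constant. $N_k$ denotes the $k$th primorial, i.e. the product of the first $k$ prime numbers. *)

(* Defs.v *)
From mathcomp Require Import all_boot.

Lemma exists_prime_above (m : nat) : exists p, (m < p)%N && prime p.
Proof. case: (prime_above m) => p H1 H2; exists p; by rewrite H1 H2. Qed.

Definition next_prime (m : nat) : nat := ex_minn (exists_prime_above m).

(* nth_prime 0 = 2, nth_prime 1 = 3, ... : the (k+1)-th prime *)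
Fixpoint nth_prime (k : nat) : nat :=
  match k with
  | 0 => next_prime 1
  | k'.+1 => next_prime (nth_prime k')
  end.

Definition primorial (k : nat) : nat := (\prod_(i < k) nth_prime i)%N.

From Stdlib Require Import Reals.
From Coquelicot Require Import Coquelicot.

Open Scope R_scope.

Definition euler_gamma : R :=
  real (Lim_seq (fun n : nat =>
          sum_f_R0 (fun j => / INR (j + 1)) n - ln (INR (n + 1)))).

(* complex power n^(-s) = exp(-s ln n) for a positive real n *)
Definition cpow_neg (n : R) (s : C) : C :=
  (exp (- Re s * ln n) * cos (- Im s * ln n),
   exp (- Re s * ln n) * sin (- Im s * ln n)).

Definition eta_term (s : C) (n : nat) : C :=
  Cmult (RtoC ((-1) ^ n)) (cpow_neg (INR (n + 1)) s).

(* In the critical strip 0 < Re s < 1 the Riemann zeta function is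
   zeta(s) = eta(s) / (1 - 2^(1-s)), with 1 - 2^(1-s) <> 0 there, so the
   zeros of zeta in the strip are exactly the zeros of the (convergent)
   eta series.  RH: every zero of zeta in the critical strip has real
   part 1/2 (all nontrivial zeros lie in the strip). *)
Definition RiemannHypothesis : Prop :=
  forall s : C, 0 < Re s < 1 -> is_series (eta_term s) (RtoC 0) -> Re s = 1 / 2.

(* Main.v *)
(** By the 3-4-1 inequality and RH, [(s - 1) zeta s] has no zero with [Re s > 1/2],
    so Borel-Caratheodory bounds [zeta'/zeta + 1/(s - 1)] logarithmically on
    [Re s = 11/20].  Shifting Perron's integral with kernel [x^s / s^2] to that line
    and differencing in [ln x] gives [|psi x - x| <= 1400000 x^(3/5)] for [ln x >= 40].
    Let [N] be the [k]-th prime, [X = ln N] and [w = 1 / X].  Partial summation yields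
    both [k <= e^X (w + w^2 + 2 w^3 + 6 w^4 + 44 w^5)] and
    [N_k / phi N_k >= e^gamma (X - 28 w^4)]; the constant [e^gamma] comes from comparing
    [sum Lambda n / (n ln n)] with [ln zeta(1 + d)] as [d] tends to 0.
    Inverting the first estimate expands [X] in powers of [1 / L], where [L = ln k]:
    it exceeds the claimed bound by [(l^3/3 - 5 l^2/2 + 7 l - 47/6) / L^3] plus smaller
    terms, [l = ln L], and this is positive for [L >= 70]. *)
Require Import Defs.
From mathcomp Require Import all_boot zify_ssreflect.
From Stdlib Require Import Reals Lra Lia Psatz.
From Coquelicot Require Import Coquelicot.
Open Scope R_scope.

(** * Complex differentiation *)

(** The price is the constant 1400000: at ln x = 74, exp (2/5 ln x) exceeds the required multiple of
    (ln x)^4 by a factor below 3/2, while the threshold on k is about exp 70.44. Residues and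
    winding numbers never occur. Cauchy's theorem says here that the x-derivative of a vertical
    integral is the jump of Im f between its end points; the substitution z = s0 + exp w turns
    circles into vertical segments with equal end values. The pole of zeta is removed by working
    with (s - 1) zeta s, and its share in Perron's formula is recovered from a differential equation
    in ln x. Branches of the logarithm are avoided by using ln |f|. [RiemannHypothesis] speaks of
    eta in the open strip only, so zeros of the limit of Euler-Maclaurin sums are carried over to
    eta, and Re s = 1 and Re s > 1 get arguments of their own. *)

Definition ccont (f : C -> C) (s : C) : Prop :=
  forall eps, 0 < eps -> exists d, 0 < d /\
    forall z : C, Cmod (z - s) < d -> Cmod (f z - f s) < eps.

(* Caratheodory's form of the derivative makes the product, inverse and chain rules algebraic. *)
Definition cderiv (f : C -> C) (s l : C) : Prop :=
  exists (q : C -> C) (d : R), 0 < d /\ ccont q s /\ q s = l /\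
    forall z : C, Cmod (z - s) < d -> f z = (f s + (z - s) * q z)%C.

Definition copen (D : C -> Prop) : Prop :=
  forall s, D s -> exists d, 0 < d /\ forall z : C, Cmod (z - s) < d -> D z.

Definition hol (D : C -> Prop) (f f' : C -> C) : Prop :=
  forall s, D s -> cderiv f s (f' s) /\ ccont f' s.

Lemma Cmod_minus_sym (a b : C) : Cmod (a - b) = Cmod (b - a).
Proof. by rewrite -Cmod_opp; congr Cmod; ring. Qed.

Lemma Cminus_diag (s : C) : (s - s = 0)%C.
Proof. ring. Qed.

Lemma Cmod_minus_diag (s : C) : Cmod (s - s) = 0.
Proof. by rewrite Cminus_diag Cmod_0. Qed.

Lemma Cmod_triangle_inv (a b : C) : Cmod a - Cmod b <= Cmod (a - b).
Proof.
have := Cmod_triangle (a - b) b.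
have -> : (a - b + b = a)%C by ring.
lra.
Qed.

Lemma Cmod_triangle_minus (a b : C) : Cmod (a - b) <= Cmod a + Cmod b.
Proof. by have := Cmod_triangle a (- b); rewrite Cmod_opp. Qed.

Lemma im_le_Cmod (c : C) : Rabs (Im c) <= Cmod c.
Proof. by apply: Rle_trans (Rmax_Cmod c); apply: Rmax_r. Qed.

Lemma Cmod_le_re_im (c : C) : Cmod c <= Rabs (Re c) + Rabs (Im c).
Proof.
have {1}-> : c = (RtoC (Re c) + Ci * RtoC (Im c))%C.
  by case: c => a b; rewrite /RtoC /Ci /Cplus /Cmult /=; f_equal; ring.
have := Cmod_triangle (RtoC (Re c)) (Ci * RtoC (Im c)).
by rewrite Cmod_mult Cmod_Ci !Cmod_R Rmult_1_l.
Qed.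

Lemma ccont_ext_loc f g s d : 0 < d -> (forall z, Cmod (z - s) < d -> f z = g z) ->
  ccont f s -> ccont g s.
Proof.
move=> Hd E cf e He; have [d1 [Hd1 H1]] := cf e He.
exists (Rmin d d1); split; first by apply: Rmin_glb_lt.
move=> z Hz.
rewrite -E; last by apply: Rlt_le_trans Hz (Rmin_l _ _).
rewrite -E; last by rewrite Cmod_minus_diag.
by apply: H1; apply: Rlt_le_trans Hz (Rmin_r _ _).
Qed.

Lemma ccont_const k s : ccont (fun _ => k) s.
Proof. move=> e He; exists 1; split; first lra. by move=> z _; rewrite Cmod_minus_diag. Qed.

Lemma ccont_id s : ccont (fun z => z) s.
Proof. by move=> e He; exists e; split. Qed.

Lemma ccont_plus f g s : ccont f s -> ccont g s -> ccont (fun z => f z + g z)%C s.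
Proof.
move=> cf cg e He.
have [d1 [Hd1 H1]] := cf (e/2) ltac:(lra).
have [d2 [Hd2 H2]] := cg (e/2) ltac:(lra).
exists (Rmin d1 d2); split; first by apply: Rmin_glb_lt.
move=> z Hz.
have := H1 z (Rlt_le_trans _ _ _ Hz (Rmin_l _ _)).
have := H2 z (Rlt_le_trans _ _ _ Hz (Rmin_r _ _)).
have -> : (f z + g z - (f s + g s) = (f z - f s) + (g z - g s))%C by ring.
have := Cmod_triangle (f z - f s) (g z - g s).
lra.
Qed.

Lemma ccont_mult f g s : ccont f s -> ccont g s -> ccont (fun z => f z * g z)%C s.
Proof.
move=> cf cg e He.
have Hf := Cmod_ge_0 (f s); have Hg := Cmod_ge_0 (g s).
set M := Cmod (f s) + Cmod (g s) + 1.
have HM : 1 <= M by rewrite /M; lra.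
have E3 : e / (3 * M) * M = e / 3 by field; lra.
have k0 : 0 < e / (3 * M) by apply: Rdiv_lt_0_compat; lra.
move: E3 k0; set k := e / (3 * M) => E3 k0.
have Hk : 0 < Rmin 1 k by apply: Rmin_glb_lt; lra.
have [d1 [Hd1 H1]] := cf _ Hk.
have [d2 [Hd2 H2]] := cg _ Hk.
exists (Rmin d1 d2); split; first by apply: Rmin_glb_lt.
move=> z Hz.
have := H1 z (Rlt_le_trans _ _ _ Hz (Rmin_l _ _)).
have := H2 z (Rlt_le_trans _ _ _ Hz (Rmin_r _ _)).
have -> : (f z * g z - f s * g s =
   (f z - f s) * (g z - g s) + (f z - f s) * g s + f s * (g z - g s))%C by ring.
set a := (f z - f s)%C; set b := (g z - g s)%C => Hb Ha.
have La := Cmod_ge_0 a; have Lb := Cmod_ge_0 b.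
have K1 := Rmin_l 1 k; have K2 := Rmin_r 1 k.
have A1 : Cmod (a * b + a * g s + f s * b) <= Cmod a * Cmod b + Cmod a * Cmod (g s) + Cmod (f s) * Cmod b.
  apply: Rle_trans (Cmod_triangle _ _) _; rewrite -!Cmod_mult.
  have := Cmod_triangle (a * b) (a * g s); lra.
have A2 : Cmod a * Cmod b <= k * 1.
  apply: Rmult_le_compat; lra.
have A3 : Cmod a * Cmod (g s) <= k * Cmod (g s) by apply: Rmult_le_compat_r; lra.
have A4 : Cmod (f s) * Cmod b <= Cmod (f s) * k by apply: Rmult_le_compat_l; lra.
have : k * M = k * Cmod (f s) + k * Cmod (g s) + k by rewrite /M; ring.
lra.
Qed.

Lemma ccont_comp f g s : ccont g s -> ccont f (g s) -> ccont (fun z => f (g z)) s.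
Proof.
move=> cg cf e He; have [d1 [Hd1 H1]] := cf e He.
have [d2 [Hd2 H2]] := cg d1 Hd1.
by exists d2; split => // z Hz; apply: H1; apply: H2.
Qed.

Lemma ccont_Cinv (s : C) : s <> 0%C -> ccont Cinv s.
Proof.
move=> Hs e He.
have Hm := proj1 (Cmod_gt_0 s) Hs.
exists (Rmin (Cmod s / 2) (e * Cmod s ^ 2 / 2)); split.
  apply: Rmin_glb_lt; first lra.
  apply: Rdiv_lt_0_compat; last lra. apply: Rmult_lt_0_compat => //; apply: pow_lt; lra.
move=> z Hz.
have Hz1 := Rlt_le_trans _ _ _ Hz (Rmin_l _ _).
have Hz2 := Rlt_le_trans _ _ _ Hz (Rmin_r _ _).
have Lz : Cmod s / 2 < Cmod z.
  have := Cmod_triangle_inv s z; rewrite Cmod_minus_sym; lra.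
have Nz : z <> 0%C by apply/Cmod_gt_0; lra.
have -> : (/ z - / s = - ((z - s) / (z * s)))%C by field.
rewrite Cmod_opp Cmod_div; last by apply: Cmult_neq_0.
rewrite Cmod_mult.
apply/Rlt_div_l; first by apply: Rmult_lt_0_compat; lra.
have : e * (Cmod s / 2 * Cmod s) <= e * (Cmod z * Cmod s).
  apply: Rmult_le_compat_l; first lra. apply: Rmult_le_compat_r; lra.
have : e * (Cmod s / 2 * Cmod s) = e * Cmod s ^ 2 / 2 by field.
lra.
Qed.

Lemma ccont_inv (f : C -> C) (s : C) : f s <> 0%C -> ccont f s -> ccont (fun z => / f z)%C s.
Proof. move=> H cf; apply: (ccont_comp Cinv) => //; exact: ccont_Cinv. Qed.

Lemma ccont_neq0 (f : C -> C) (s : C) : ccont f s -> f s <> 0%C ->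
  exists d, 0 < d /\ forall z, Cmod (z - s) < d -> f z <> 0%C.
Proof.
move=> cf H.
have Hm := proj1 (Cmod_gt_0 _) H.
have [d [Hd H1]] := cf _ Hm.
exists d; split=> // z Hz E.
have := H1 z Hz; rewrite E.
have -> : (0 - f s = - f s)%C by ring.
rewrite Cmod_opp; lra.
Qed.

Lemma cderiv_ccont f s l : cderiv f s l -> ccont f s.
Proof.
move=> [q [d [Hd [cq [_ E]]]]].
apply: (ccont_ext_loc (fun z => f s + (z - s) * q z)%C f s d Hd).
  by move=> z Hz; rewrite (E z Hz).
apply: ccont_plus; first exact: ccont_const.
apply: ccont_mult => //; apply: ccont_plus; [exact: ccont_id|exact: ccont_const].
Qed.

Lemma cderiv_ext_loc f g s l d : 0 < d -> (forall z, Cmod (z - s) < d -> f z = g z) ->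
  cderiv f s l -> cderiv g s l.
Proof.
move=> Hd E [q [d1 [Hd1 [cq [Eq H]]]]].
exists q, (Rmin d d1); split; first by apply: Rmin_glb_lt.
do 2 split => //.
move=> z Hz.
rewrite -E; last by apply: Rlt_le_trans Hz (Rmin_l _ _).
rewrite -E; last by rewrite Cmod_minus_diag.
by apply: H; apply: Rlt_le_trans Hz (Rmin_r _ _).
Qed.

Lemma cderiv_eq f s l l' : cderiv f s l -> l = l' -> cderiv f s l'.
Proof. by move=> H <-. Qed.

Lemma cderiv_const k s : cderiv (fun _ => k) s 0.
Proof.
exists (fun _ => 0%C), 1; split; first lra; split; first exact: ccont_const.
by split=> // z _; ring.
Qed.

Lemma cderiv_id s : cderiv (fun z => z) s 1.
Proof.
exists (fun _ => 1%C), 1; split; first lra; split; first exact: ccont_const.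
by split=> // z _; ring.
Qed.

Lemma cderiv_plus f g s a b : cderiv f s a -> cderiv g s b ->
  cderiv (fun z => f z + g z)%C s (a + b)%C.
Proof.
move=> [q [d [Hd [cq [Eq H]]]]] [q' [d' [Hd' [cq' [Eq' H']]]]].
exists (fun z => q z + q' z)%C, (Rmin d d'); split; first by apply: Rmin_glb_lt.
split; first exact: ccont_plus.
split; first by rewrite Eq Eq'.
move=> z Hz.
rewrite H; last by apply: Rlt_le_trans Hz (Rmin_l _ _).
rewrite H'; last by apply: Rlt_le_trans Hz (Rmin_r _ _).
ring.
Qed.

Lemma cderiv_mult f g s a b : cderiv f s a -> cderiv g s b ->
  cderiv (fun z => f z * g z)%C s (a * g s + f s * b)%C.
Proof.
move=> Df Dg; have cg := cderiv_ccont _ _ _ Dg.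
move: Df Dg => [q [d [Hd [cq [Eq H]]]]] [q' [d' [Hd' [cq' [Eq' H']]]]].
exists (fun z => q z * g z + f s * q' z)%C, (Rmin d d'); split; first by apply: Rmin_glb_lt.
split.
  apply: ccont_plus; apply: ccont_mult => //; exact: ccont_const.
split; first by rewrite Eq Eq'.
move=> z Hz.
rewrite H; last by apply: Rlt_le_trans Hz (Rmin_l _ _).
have E := H' z (Rlt_le_trans _ _ _ Hz (Rmin_r _ _)).
have -> : (f s * g s = f s * (g z - (z - s) * q' z))%C by rewrite E; ring.
ring.
Qed.

Lemma cderiv_comp f g s a b : cderiv g s a -> cderiv f (g s) b ->
  cderiv (fun z => f (g z)) s (a * b)%C.
Proof.
move=> Dg Df; have cg := cderiv_ccont _ _ _ Dg.
move: Df Dg => [q [d [Hd [cq [Eq H]]]]] [q' [d' [Hd' [cq' [Eq' H']]]]].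
have [d2 [Hd2 H2]] := cg d Hd.
exists (fun z => q' z * q (g z))%C, (Rmin d' d2); split; first by apply: Rmin_glb_lt.
split.
  apply: ccont_mult => //; exact: ccont_comp.
split; first by rewrite Eq Eq'.
move=> z Hz.
rewrite H; last by apply: H2; apply: Rlt_le_trans Hz (Rmin_r _ _).
rewrite {1}(H' z (Rlt_le_trans _ _ _ Hz (Rmin_l _ _))).
ring.
Qed.

Lemma cderiv_Cinv (s : C) : s <> 0%C -> cderiv Cinv s (- (/ (s * s)))%C.
Proof.
move=> Hs.
have [d [Hd H]] := ccont_neq0 _ _ (ccont_id s) Hs.
exists (fun z => - (/ (z * s)))%C, d; split => //; split.
  apply: (ccont_ext_loc (fun z => (- (1)) * / (z * s))%C _ s d) => //.
    by move=> z Hz; ring.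
  apply: ccont_mult; first exact: ccont_const.
  apply: ccont_inv; first exact: Cmult_neq_0.
  apply: ccont_mult; [exact: ccont_id | exact: ccont_const].
split => // z Hz; field; split => //; exact: H.
Qed.

Lemma cderiv_inv (f : C -> C) (s : C) a : f s <> 0%C -> cderiv f s a ->
  cderiv (fun z => / f z)%C s (- a / (f s * f s))%C.
Proof.
move=> H Df.
apply: cderiv_eq (cderiv_comp _ _ _ _ _ Df (cderiv_Cinv _ H)) _.
by rewrite /Cdiv; ring.
Qed.

Lemma cderiv_scal k f s a : cderiv f s a -> cderiv (fun z => k * f z)%C s (k * a)%C.
Proof.
move=> Df; apply: cderiv_eq (cderiv_mult _ _ _ _ _ (cderiv_const k s) Df) _; ring.
Qed.

(** The difference quotient, given the value l at s, serves as the Caratheodory factor q. This is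
    the way in for functions known by estimates: the exponential and locally uniform limits. *)
Lemma cderiv_intro (f : C -> C) (s l : C) :
  (forall eps, 0 < eps -> exists d, 0 < d /\ forall z, Cmod (z - s) < d ->
     Cmod (f z - f s - (z - s) * l) <= eps * Cmod (z - s)) -> cderiv f s l.
Proof.
move=> H.
exists (fun z => if Req_EM_T (Cmod (z - s)) 0 then l else ((f z - f s) / (z - s))%C), 1.
split; first lra.
have E0 : (if Req_EM_T (Cmod (s - s)) 0 then l else ((f s - f s) / (s - s))%C) = l.
  by case: Req_EM_T => // N; case: N; rewrite Cmod_minus_diag.
split; last first.
  split; first exact: E0.
  move=> z _; case: Req_EM_T => [E|N] /=.
    have -> : z = s by apply/Ceq_minus; apply: Cmod_eq_0.
    ring.
  have Nz : (z - s)%C <> 0%C by move=> E; apply: N; rewrite E Cmod_0.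
  by field.
move=> e He; have [d [Hd Hz]] := H (e/2) ltac:(lra).
exists d; split=> // z Hzd; rewrite E0.
case: Req_EM_T => [E|N]; first by rewrite Cmod_minus_diag.
have Nz : (z - s)%C <> 0%C by move=> E; apply: N; rewrite E Cmod_0.
have P := proj1 (Cmod_gt_0 _) Nz.
have -> : ((f z - f s) / (z - s) - l = (f z - f s - (z - s) * l) / (z - s))%C by field.
rewrite Cmod_div //.
apply: (Rle_lt_trans _ (e/2)); last lra.
apply/Rle_div_l => //; exact: Hz.
Qed.

(** The bridge to real calculus. The directions v = 1 and v = i give the Cauchy-Riemann equations in
    the form of [is_derive_re] and [is_derive_im]. *)
Lemma is_derive_line (f : C -> C) (s v l : C) (x : R) : cderiv f (s + RtoC x * v)%C l ->
  is_derive (fun y : R => Re (f (s + RtoC y * v)%C)) x (Re (l * v)) /\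
  is_derive (fun y : R => Im (f (s + RtoC y * v)%C)) x (Im (l * v)).
Proof.
move=> [q [d [Hd [cq [Eq H]]]]].
have cq2 : ccont (fun y : C => q (s + y * v) * v)%C (RtoC x).
  apply: ccont_mult; last exact: ccont_const.
  apply: (ccont_comp q) => //.
  apply: ccont_plus; first exact: ccont_const.
  apply: ccont_mult; [exact: ccont_id | exact: ccont_const].
have cl : ccont (fun y : C => s + y * v)%C (RtoC x).
  apply: ccont_plus; first exact: ccont_const.
  apply: ccont_mult; [exact: ccont_id | exact: ccont_const].
have [d1 [Hd1 H1]] := cl d Hd.
have key : forall e, 0 < e -> exists d2 : posreal, forall h : R, h <> 0 -> Rabs h < d2 ->
  Cmod ((f (s + RtoC (x + h) * v) - f (s + RtoC x * v)) / RtoC h - l * v)%C < e.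
  move=> e He; have [d2 [Hd2 H2]] := cq2 e He.
  have Hm : 0 < Rmin d1 d2 by apply: Rmin_glb_lt.
  exists (mkposreal _ Hm) => h Hh /= Hl.
  have M : Cmod (RtoC (x + h) - RtoC x) = Rabs h.
    have -> : (RtoC (x + h) - RtoC x = RtoC h)%C by rewrite RtoC_plus; ring.
    by rewrite Cmod_R.
  have harmonic : RtoC h <> 0%C by move=> [] ?.
  have Z1 : Cmod (s + RtoC (x + h) * v - (s + RtoC x * v)) < d.
    apply: H1; rewrite M; apply: Rlt_le_trans Hl (Rmin_l _ _).
  rewrite (H _ Z1).
  have -> : ((f (s + x * v) + (s + (x + h)%R * v - (s + x * v)) * q (s + (x + h)%R * v) - f (s + x * v)) / h - l * v
     = q (s + (x + h)%R * v) * v - q (s + x * v) * v)%C.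
    rewrite Eq RtoC_plus; field => //.
  apply: H2; rewrite M; apply: Rlt_le_trans Hl (Rmin_r _ _).
have RD : forall (a b : C) (h : R), h <> 0 -> (a / RtoC h - b)%C = (Re a / h - Re b, Im a / h - Im b).
  move=> [a1 a2] [b1 b2] h Hh; rewrite /Cdiv /Cinv /Cmult /Cminus /Cplus /Copp /RtoC /=.
  f_equal; field; nra.
split; apply/is_derive_Reals => e He; have [d2 H2] := key e He; exists d2 => h Hh Hl;
  apply: Rle_lt_trans (H2 h Hh Hl).
- rewrite RD //; apply: Rle_trans (re_le_Cmod _); rewrite /=; apply: Req_le; do 2 f_equal.
- rewrite RD //; apply: Rle_trans (im_le_Cmod _); rewrite /=; apply: Req_le; do 2 f_equal.
Qed.

Lemma is_derive_re (f : C -> C) (x t : R) (l : C) : cderiv f (x, t) l ->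
  is_derive (fun y => Re (f (y, t))) x (Re l) /\ is_derive (fun y => Im (f (y, t))) x (Im l).
Proof.
move=> H.
have E : forall y : R, (RtoC 0 + RtoC y * 1 + RtoC t * Ci)%C = (y, t).
  by move=> y; rewrite /RtoC /Ci /Cplus /Cmult /=; f_equal; ring.
have E' : forall y : R, (RtoC t * Ci + RtoC y * 1)%C = (y, t).
  by move=> y; rewrite -E; ring.
have H' : cderiv f (RtoC t * Ci + RtoC x * 1)%C l by rewrite E'.
have [A B] := is_derive_line _ _ _ _ _ H'.
have E2 : (l * 1 = l)%C by ring.
rewrite E2 in A B; split.
- by apply: is_derive_ext A => y; rewrite E'.
- by apply: is_derive_ext B => y; rewrite E'.
Qed.

Lemma is_derive_im (f : C -> C) (x t : R) (l : C) : cderiv f (x, t) l ->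
  is_derive (fun y => Re (f (x, y))) t (- Im l) /\ is_derive (fun y => Im (f (x, y))) t (Re l).
Proof.
move=> H.
have E' : forall y : R, (RtoC x + RtoC y * Ci)%C = (x, y).
  by move=> y; rewrite /RtoC /Ci /Cplus /Cmult /=; f_equal; ring.
have H' : cderiv f (RtoC x + RtoC t * Ci)%C l by rewrite E'.
have [A B] := is_derive_line _ _ _ _ _ H'.
have E1 : Re (l * Ci) = - Im l by case: l {H H' A B} => a b; rewrite /=; ring.
have E2 : Im (l * Ci) = Re l by case: l {H H' A B E1} => a b; rewrite /=; ring.
rewrite E1 in A; rewrite E2 in B; split.
- by apply: is_derive_ext A => y; rewrite E'.
- by apply: is_derive_ext B => y; rewrite E'.
Qed.

Lemma Cmod_pair_lt (a b : R) (d : R) : Rabs a < d / 2 -> Rabs b < d / 2 -> Cmod (a, b) < d.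
Proof. by move=> A B; have := Cmod_le_re_im (a, b); rewrite /=; lra. Qed.

Lemma ccont_2d (f : C -> C) (x t : R) : ccont f (x, t) ->
  continuity_2d_pt (fun u v => Re (f (u, v))) x t /\ continuity_2d_pt (fun u v => Im (f (u, v))) x t.
Proof.
move=> cf; split => e; have [d [Hd H]] := cf e (cond_pos e);
  have Hd2 : 0 < d / 2 by lra.
- exists (mkposreal _ Hd2) => u v /= Hu Hv.
  apply: Rle_lt_trans (H (u, v) _); last exact: Cmod_pair_lt.
  exact: (re_le_Cmod (f (u, v) - f (x, t))).
- exists (mkposreal _ Hd2) => u v /= Hu Hv.
  apply: Rle_lt_trans (H (u, v) _); last exact: Cmod_pair_lt.
  exact: (im_le_Cmod (f (u, v) - f (x, t))).
Qed.

Lemma ccont_cont_v (f : C -> C) (x t : R) : ccont f (x, t) ->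
  continuous (fun y => Re (f (x, y))) t /\ continuous (fun y => Im (f (x, y))) t.
Proof.
move=> cf; split; apply/continuity_pt_filterlim => e He; have [d [Hd H]] := cf e He;
 exists d; split => // y [_ Hy].
- apply: Rle_lt_trans (H (x, y) _); first exact: (re_le_Cmod (f (x, y) - f (x, t))).
  have -> : ((x, y) - (x, t))%C = (0, y - t) by rewrite /Cminus /Cplus /Copp /=; f_equal; ring.
  apply: Rle_lt_trans Hy; rewrite /dist /= /R_dist.
  by apply: Rle_trans (Cmod_le_re_im _) _; rewrite /= Rabs_R0 Rplus_0_l; apply: Rle_refl.
- apply: Rle_lt_trans (H (x, y) _); first exact: (im_le_Cmod (f (x, y) - f (x, t))).
  have -> : ((x, y) - (x, t))%C = (0, y - t) by rewrite /Cminus /Cplus /Copp /=; f_equal; ring.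
  apply: Rle_lt_trans Hy; rewrite /dist /= /R_dist.
  by apply: Rle_trans (Cmod_le_re_im _) _; rewrite /= Rabs_R0 Rplus_0_l; apply: Rle_refl.
Qed.

Lemma ex_RInt_ccont (f : C -> C) (x t1 t2 : R) :
  (forall t, Rmin t1 t2 <= t <= Rmax t1 t2 -> ccont f (x, t)) ->
  ex_RInt (fun t => Re (f (x, t))) t1 t2.
Proof. by move=> H; apply: ex_RInt_continuous => t Ht; case: (ccont_cont_v _ _ _ (H t Ht)). Qed.

Definition strip (a b : R) : C -> Prop := fun s => a < Re s < b.

(* Cauchy's theorem for thin rectangles, in differential form. *)
Lemma vertical_integral_derive (f f' : C -> C) (a b x t1 t2 : R) :
  hol (strip a b) f f' -> a < x < b ->
  is_derive (fun y => RInt (fun t => Re (f (y, t))) t1 t2) x (Im (f (x, t2)) - Im (f (x, t1))).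
Proof.
move=> Hf Hx.
have D1 : forall y t, a < y < b -> is_derive (fun z => Re (f (z, t))) y (Re (f' (y, t))).
  by move=> y t Hy; case: (is_derive_re _ _ _ _ (proj1 (Hf (y, t) Hy))).
have nb : 0 < Rmin (x - a) (b - x) by apply: Rmin_glb_lt; lra.
have nbP : forall y, Rabs (y - x) < Rmin (x - a) (b - x) -> a < y < b.
  move=> y /Rabs_def2 [A B]; have := Rmin_l (x - a) (b - x); have := Rmin_r (x - a) (b - x); lra.
have K : is_derive (fun y => RInt (fun t => Re (f (y, t))) t1 t2) x
   (RInt (fun t => Derive (fun y => Re (f (y, t))) x) t1 t2).
  apply: (is_derive_RInt_param (fun y t => Re (f (y, t)))).
  - exists (mkposreal _ nb) => y By t _; exists (Re (f' (y, t))); apply: D1; exact: nbP.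
  - move=> t _.
    apply: (continuity_2d_pt_ext_loc (fun u v => Re (f' (u, v)))).
      exists (mkposreal _ nb) => u v /= Hu _; symmetry; apply: is_derive_unique; apply: D1; exact: nbP.
    by case: (ccont_2d _ _ _ (proj2 (Hf (x, t) Hx))).
  - exists (mkposreal _ nb) => y By; apply: ex_RInt_ccont => t _.
    apply: cderiv_ccont (proj1 (Hf (y, t) _)); exact: nbP.
(* By Cauchy-Riemann, Re f' is the t-derivative of Im f, so the integral reduces to the end
   points. *)
have E : RInt (fun t => Derive (fun y => Re (f (y, t))) x) t1 t2 = Im (f (x, t2)) - Im (f (x, t1)).
  rewrite (RInt_ext _ (fun t => Re (f' (x, t)))); last first.
    by move=> t _; apply: is_derive_unique; apply: D1.
  apply: is_RInt_unique.
  apply: (is_RInt_derive (V := R_CompleteNormedModule) (fun t => Im (f (x, t)))).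
    by move=> t _; case: (is_derive_im _ _ _ _ (proj1 (Hf (x, t) Hx))).
  by move=> t _; case: (ccont_cont_v _ _ _ (proj2 (Hf (x, t) Hx))).
by rewrite E in K.
Qed.

(** By the mean value theorem in x and [vertical_integral_derive], moving the line costs only the
    values of f on the two horizontal edges. *)
Lemma vertical_shift_bound (f f' : C -> C) (a b x1 x2 t1 t2 M : R) :
  hol (strip a b) f f' -> a < x1 -> x1 <= x2 -> x2 < b ->
  (forall x, x1 <= x <= x2 -> Rabs (Im (f (x, t2)) - Im (f (x, t1))) <= M) ->
  Rabs (RInt (fun t => Re (f (x2, t))) t1 t2 - RInt (fun t => Re (f (x1, t))) t1 t2) <= M * (x2 - x1).
Proof.
move=> Hf H1 H12 H2 HM.
have D : forall x, x1 <= x <= x2 -> is_derive (fun y => RInt (fun t => Re (f (y, t))) t1 t2) x (Im (f (x, t2)) - Im (f (x, t1))).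
  by move=> x Hx; apply: (vertical_integral_derive _ _ _ _ _ _ _ Hf); lra.
have [c [Hc ->]] : exists c, x1 <= c <= x2 /\ RInt (fun t => Re (f (x2, t))) t1 t2 - RInt (fun t => Re (f (x1, t))) t1 t2 = (Im (f (c, t2)) - Im (f (c, t1))) * (x2 - x1).
  have := MVT_gen (fun y => RInt (fun t => Re (f (y, t))) t1 t2) x1 x2 (fun x => Im (f (x, t2)) - Im (f (x, t1))).
  rewrite /= Rmin_left // Rmax_right //; apply.
    by move=> x Hx; apply: D; lra.
  move=> x Hx.
  apply: derivable_continuous_pt; eexists; apply/is_derive_Reals; exact: D.
rewrite Rabs_mult (Rabs_pos_eq (x2 - x1)); last lra.
apply: Rmult_le_compat_r; [lra | exact: HM].
Qed.

(** * Mean value inequalities *)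

Lemma deriv_bound (f df : R -> R) (a b M : R) : a <= b ->
  (forall x, a <= x <= b -> is_derive f x (df x)) -> (forall x, a <= x <= b -> Rabs (df x) <= M) ->
  Rabs (f b - f a) <= M * (b - a).
Proof.
move=> Hab Hd HM.
have := MVT_gen f a b df.
rewrite /= Rmin_left // Rmax_right // => /(_ (fun x Hx => Hd x (conj (Rlt_le _ _ (proj1 Hx)) (Rlt_le _ _ (proj2 Hx))))).
case.
  move=> x Hx; apply: derivable_continuous_pt; eexists; apply/is_derive_Reals; exact: Hd.
move=> c [Hc ->]; rewrite Rabs_mult (Rabs_pos_eq (b - a)); last lra.
by apply: Rmult_le_compat_r; [lra | exact: HM].
Qed.

Lemma deriv_nonneg (f df : R -> R) (a b : R) : a <= b ->
  (forall x, a <= x <= b -> is_derive f x (df x)) -> (forall x, a <= x <= b -> 0 <= df x) ->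
  f a <= f b.
Proof.
move=> Hab Hd HM.
have := MVT_gen f a b df.
rewrite /= Rmin_left // Rmax_right // => /(_ (fun x Hx => Hd x (conj (Rlt_le _ _ (proj1 Hx)) (Rlt_le _ _ (proj2 Hx))))).
case.
  move=> x Hx; apply: derivable_continuous_pt; eexists; apply/is_derive_Reals; exact: Hd.
move=> c [Hc E]; have := HM c Hc => H.
have : 0 <= df c * (b - a) by apply: Rmult_le_pos => //; lra.
lra.
Qed.

(* A complex mean value inequality, with the harmless factor 2 coming from separating real and imaginary parts. *)
Lemma segment_bound (f f' : C -> C) (s z l : C) (M : R) :
  (forall x : R, 0 <= x <= 1 -> cderiv f (s + RtoC x * (z - s))%C (f' (s + RtoC x * (z - s))%C) /\
     Cmod (f' (s + RtoC x * (z - s)) - l)%C <= M) ->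
  Cmod (f z - f s - (z - s) * l)%C <= 2 * M * Cmod (z - s).
Proof.
move=> H.
set g := fun w => (f w + - l * w)%C.
have Dg : forall x : R, 0 <= x <= 1 -> cderiv g (s + RtoC x * (z - s))%C (f' (s + RtoC x * (z - s)) - l)%C.
  move=> x Hx; apply: cderiv_eq; first apply: (cderiv_plus f (fun w => - l * w)%C).
  - exact: (proj1 (H x Hx)).
  - apply: cderiv_scal; exact: cderiv_id.
  by ring.
have key : forall x : R, 0 <= x <= 1 -> Cmod ((f' (s + RtoC x * (z - s)) - l) * (z - s))%C <= M * Cmod (z - s).
  move=> x Hx; rewrite Cmod_mult; apply: Rmult_le_compat_r; first exact: Cmod_ge_0.
  exact: (proj2 (H x Hx)).
have G1 : (s + RtoC 1 * (z - s) = z)%C by ring.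
have G0 : (s + RtoC 0 * (z - s) = s)%C by ring.
have A : Rabs (Re (g (s + RtoC 1 * (z - s))%C) - Re (g (s + RtoC 0 * (z - s))%C)) <= M * Cmod (z - s) * (1 - 0).
  apply: (deriv_bound (fun x => Re (g (s + RtoC x * (z - s))%C))); first lra.
    by move=> x Hx; exact: (proj1 (is_derive_line _ _ _ _ _ (Dg x Hx))).
  move=> x Hx; apply: Rle_trans (key x Hx); exact: re_le_Cmod.
have B : Rabs (Im (g (s + RtoC 1 * (z - s))%C) - Im (g (s + RtoC 0 * (z - s))%C)) <= M * Cmod (z - s) * (1 - 0).
  apply: (deriv_bound (fun x => Im (g (s + RtoC x * (z - s))%C))); first lra.
    by move=> x Hx; exact: (proj2 (is_derive_line _ _ _ _ _ (Dg x Hx))).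
  move=> x Hx; apply: Rle_trans (key x Hx); exact: im_le_Cmod.
rewrite G1 G0 in A B.
have -> : (f z - f s - (z - s) * l = g z - g s)%C by rewrite /g; ring.
apply: Rle_trans (Cmod_le_re_im _) _.
have E1 : Re (g z - g s) = Re (g z) - Re (g s) by rewrite /=; ring.
have E2 : Im (g z - g s) = Im (g z) - Im (g s) by rewrite /=; ring.
rewrite E1 E2; lra.
Qed.

(** * Elementary bounds for sine, cosine and the exponential *)

Lemma Rabs_sin_le x : Rabs (sin x) <= Rabs x.
Proof.
have K : forall x, 0 <= x -> Rabs (sin x) <= x.
  move=> y Hy.
  have := deriv_bound sin cos 0 y 1 Hy (fun x _ => is_derive_sin x).
  rewrite sin_0 !Rminus_0_r Rmult_1_l; apply=> z _.
  by apply: Rabs_le; case: (COS_bound z).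
case: (Rle_dec 0 x) => H; first by rewrite (Rabs_pos_eq x) //; exact: K.
have := K (- x); rewrite sin_neg Rabs_Ropp (Rabs_left1 x); last lra.
by apply; lra.
Qed.

Lemma Rabs_cos_minus_1 x : Rabs (cos x - 1) <= x ^ 2 / 2.
Proof.
have -> : cos x = 1 - 2 * sin (x / 2) * sin (x / 2) by rewrite -cos_2a_sin; congr cos; field.
have A := Rabs_sin_le (x / 2).
have B : (sin (x/2)) ^ 2 <= (x/2) ^ 2.
  rewrite -(pow2_abs (sin _)) -(pow2_abs (x/2)); apply: pow_incr; split => //; exact: Rabs_pos.
have C0 : 0 <= (sin (x/2)) ^ 2 by apply: pow2_ge_0.
rewrite Rabs_left1; nra.
Qed.

Lemma Rabs_sin_minus x : Rabs (sin x - x) <= Rabs x ^ 3.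
Proof.
have K : forall x, 0 <= x -> Rabs (sin x - x) <= x ^ 3.
  move=> y Hy.
  have := deriv_bound (fun x => sin x - x) (fun x => cos x - 1) 0 y (y ^ 2) Hy.
  rewrite sin_0 !Rminus_0_r; move=> H.
  have -> : y ^ 3 = y ^ 2 * y by ring.
  apply: H.
    move=> z _; auto_derive => //; ring.
  move=> z Hz; apply: Rle_trans (Rabs_cos_minus_1 z) _; nra.
case: (Rle_dec 0 x) => H; first by rewrite (Rabs_pos_eq x) //; exact: K.
have := K (- x); rewrite sin_neg (Rabs_left1 x); last lra.
have -> : - sin x - - x = - (sin x - x) by ring.
by rewrite Rabs_Ropp; apply; lra.
Qed.

Lemma exp_mono a b : a <= b -> exp a <= exp b.
Proof. by case=> [H|->]; [apply: Rlt_le; exact: exp_increasing | exact: Rle_refl]. Qed.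

(** The upper half follows from exp a <= 1 / (1 - a), that is from 1 - a <= exp (- a) and exp a *
    exp (- a) = 1. *)
Lemma exp_taylor1 a : Rabs a <= / 2 -> 0 <= exp a - 1 - a <= 2 * a ^ 2.
Proof.
move=> /Rabs_le_between [A B].
have E1 := exp_ineq1_le a; have E2 := exp_ineq1_le (- a).
split; first lra.
have P := exp_pos a.
have Q : exp a * exp (- a) = 1 by rewrite -exp_plus Rplus_opp_r exp_0.
have : exp a * (1 - a) <= 1 by nra.
nra.
Qed.

(** * The complex exponential *)

Definition cexp (z : C) : C := (exp (Re z) * cos (Im z), exp (Re z) * sin (Im z)).

Lemma cexp_plus a b : cexp (a + b) = (cexp a * cexp b)%C.
Proof.
case: a => a1 a2; case: b => b1 b2; rewrite /cexp /Cmult /Cplus /= exp_plus cos_plus sin_plus; f_equal; ring.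
Qed.

Lemma cexp_0 : cexp 0 = 1%C.
Proof. by rewrite /cexp /= exp_0 cos_0 sin_0 /RtoC; f_equal; ring. Qed.

Lemma Cmod_cexp z : Cmod (cexp z) = exp (Re z).
Proof.
rewrite /Cmod /cexp /=.
have -> : exp (Re z) * cos (Im z) * (exp (Re z) * cos (Im z) * 1) +
  exp (Re z) * sin (Im z) * (exp (Re z) * sin (Im z) * 1) = (exp (Re z)) ^ 2.
  have := sin2_cos2 (Im z); rewrite /Rsqr => H.
  have -> : (exp (Re z)) ^ 2 = exp (Re z) ^ 2 * (sin (Im z) * sin (Im z) + cos (Im z) * cos (Im z)) by rewrite H; ring.
  ring.
by rewrite sqrt_pow2 //; apply: Rlt_le; apply: exp_pos.
Qed.

Lemma cexp_neq0 z : cexp z <> 0%C.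
Proof. by apply/Cmod_gt_0; rewrite Cmod_cexp; apply: exp_pos. Qed.

Lemma cexp_RtoC x : cexp (RtoC x) = RtoC (exp x).
Proof. by rewrite /cexp /= cos_0 sin_0 /RtoC; f_equal; ring. Qed.

Lemma cexp_opp z : cexp (- z) = (/ cexp z)%C.
Proof.
have N := cexp_neq0 z.
have E : (cexp z * cexp (- z) = 1)%C by rewrite -cexp_plus Cplus_opp_r cexp_0.
have -> : (cexp (- z) = / cexp z * (cexp z * cexp (- z)))%C by field.
rewrite E; ring.
Qed.

Lemma cexp_taylor1 z : Cmod z <= / 2 -> Cmod (cexp z - 1 - z)%C <= 10 * Cmod z ^ 2.
Proof.
move=> Hz.
have A := re_le_Cmod z; have B := im_le_Cmod z; have P := Cmod_ge_0 z.
case: z Hz A B P => a b Hz /= A B P; set r := Cmod _ in Hz A B P *.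
apply: Rle_trans (Cmod_le_re_im _) _; rewrite /=.
have E1 := exp_taylor1 a ltac:(lra).
have Ha : a ^ 2 <= r ^ 2 by rewrite -(pow2_abs a); apply: pow_incr; split => //; exact: Rabs_pos.
have Hb : b ^ 2 <= r ^ 2 by rewrite -(pow2_abs b); apply: pow_incr; split => //; exact: Rabs_pos.
have C1 := Rabs_cos_minus_1 b; have S1 := Rabs_sin_minus b; have S2 := Rabs_sin_le b.
have Ab := Rabs_pos b; have Aa := Rabs_pos a.
have ea : exp a <= 2 by move: A => /Rabs_le_between; nra.
have epos := exp_pos a.
have E2 : Rabs (exp a - 1) <= 2 * Rabs a.
  apply: Rabs_le; split; move: (Rle_abs a) (Rle_abs (-a)); rewrite ?Rabs_Ropp; first lra.
  have : a ^ 2 = Rabs a * Rabs a by rewrite -(pow2_abs a); ring.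
  nra.
have T1 : Rabs (exp a * cos b + - (1) + - a) <= 2 * r ^ 2 + 2 * (r ^ 2 / 2).
  have -> : exp a * cos b + - (1) + - a = (exp a - 1 - a) + exp a * (cos b - 1) by ring.
  apply: Rle_trans (Rabs_triang _ _) _; rewrite Rabs_mult.
  rewrite (Rabs_pos_eq (exp a - _ - _)); last lra. rewrite (Rabs_pos_eq (exp a)); last lra.
  apply: Rplus_le_compat; first lra.
  apply: Rmult_le_compat; [lra | exact: Rabs_pos | lra | lra].
have T2 : Rabs (exp a * sin b + - 0 + - b) <= 2 * r * r + r ^ 2.
  have -> : exp a * sin b + - 0 + - b = (exp a - 1) * sin b + (sin b - b) by ring.
  apply: Rle_trans (Rabs_triang _ _) _; rewrite Rabs_mult.
  apply: Rplus_le_compat.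
    apply: Rmult_le_compat; [exact: Rabs_pos | exact: Rabs_pos | lra | lra].
  apply: Rle_trans S1 _.
  have : Rabs b ^ 3 <= r ^ 3 by apply: pow_incr.
  nra.
nra.
Qed.

Lemma cderiv_cexp s : cderiv cexp s (cexp s).
Proof.
apply: cderiv_intro => e He.
set K := 10 * exp (Re s).
have HK : 0 < K by rewrite /K; have := exp_pos (Re s); lra.
exists (Rmin (/2) (e / K)); split.
  by apply: Rmin_glb_lt; [lra | exact: Rdiv_lt_0_compat].
move=> z Hz.
have Hz1 := Rlt_le_trans _ _ _ Hz (Rmin_l _ _).
have Hz2 := Rlt_le_trans _ _ _ Hz (Rmin_r _ _).
have -> : (cexp z - cexp s - (z - s) * cexp s = cexp s * (cexp (z - s) - 1 - (z - s)))%C.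
  have {1}-> : z = (s + (z - s))%C by ring.
  rewrite cexp_plus; ring.
rewrite Cmod_mult Cmod_cexp.
have T := cexp_taylor1 (z - s) ltac:(lra).
have P := Cmod_ge_0 (z - s).
have : exp (Re s) * Cmod (cexp (z - s) - 1 - (z - s))%C <= exp (Re s) * (10 * Cmod (z - s) ^ 2).
  by apply: Rmult_le_compat_l T; apply: Rlt_le; apply: exp_pos.
have : Cmod (z - s) * K <= e by apply: Rlt_le; apply/Rlt_div_r.
rewrite /K; nra.
Qed.

Lemma ccont_cexp s : ccont cexp s.
Proof. exact: cderiv_ccont (cderiv_cexp s). Qed.

Lemma cderiv_cexp_lin (k s : C) : cderiv (fun z => cexp (z * k))%C s (k * cexp (s * k))%C.
Proof.
apply: cderiv_eq; first apply: (cderiv_comp cexp (fun z => z * k)%C).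
- apply: cderiv_mult; [exact: cderiv_id | exact: cderiv_const].
- exact: cderiv_cexp.
cbv beta; ring.
Qed.

(** The radial part exp a - 1 and the angular part exp (i b) - 1 are bounded separately by multiples
    of |a| and |b|; 3/2 stands for the square root of 2 in |a| + |b| <= sqrt 2 |z|. *)
Lemma Cmod_cexp_minus_1 z : Cmod (cexp z - 1)%C <= 3 / 2 * exp (Rabs (Re z)) * Cmod z.
Proof.
have A := re_le_Cmod z; have B := im_le_Cmod z; have P := Cmod_ge_0 z.
case: z A B P => a b /= A B P.
have E0 : forall y : R, cexp (0, y) = (cos y, sin y) by move=> y; rewrite /cexp /= exp_0 !Rmult_1_l.
have -> : (cexp (a, b) - 1 = (exp a - 1)%R * cexp (0%R, b) + (cexp (0%R, b) - 1))%C.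
  by rewrite E0; apply: injective_projections; rewrite /=; ring.
have M1 : Cmod ((exp a - 1)%R * cexp (0%R, b))%C <= Rabs a * exp (Rabs a).
  rewrite Cmod_mult Cmod_cexp Cmod_R /= exp_0 Rmult_1_r.
  have E1 := exp_ineq1_le a; have E2 := exp_ineq1_le (- a); have P1 := exp_pos a.
  have Q : exp a * exp (- a) = 1 by rewrite -exp_plus Rplus_opp_r exp_0.
  case: (Rle_dec 0 a) => H.
    rewrite (Rabs_pos_eq a) // Rabs_pos_eq; last lra. nra.
  rewrite (Rabs_left1 a); last lra.
  have E4 : exp a <= 1 by rewrite -exp_0; apply: exp_mono; lra.
  have : 1 <= exp (- a) by rewrite -exp_0; apply: exp_mono; lra.
  rewrite Rabs_left1; nra.
have M2 : Cmod (cexp (0%R, b) - 1)%C <= Rabs b.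
  (* A chord of the unit circle has length 2 |sin (b / 2)|. *)
  have -> : (cexp (0%R, b) - 1 = RtoC (2 * sin (b/2)) * (Ci * cexp (0%R, (b/2)%R)))%C.
    have Eb : b = 2 * (b/2) by field.
    rewrite !E0 {1 2}Eb cos_2a_sin sin_2a; apply: injective_projections; rewrite /=; ring.
  rewrite !Cmod_mult Cmod_R Cmod_Ci Cmod_cexp /= exp_0 !Rmult_1_r Rabs_mult (Rabs_pos_eq 2); last lra.
  have := Rabs_sin_le (b/2); rewrite /Rdiv Rabs_mult (Rabs_pos_eq (/2)); lra.
apply: Rle_trans (Cmod_triangle _ _) _.
have Q : (Rabs a + Rabs b) <= 3 / 2 * Cmod (a, b).
  have E : Cmod (a, b) ^ 2 = Rabs a ^ 2 + Rabs b ^ 2 by rewrite Cmod2_alt !pow2_abs.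
  have := Rabs_pos a; have := Rabs_pos b => Hb Ha.
  have : (Rabs a + Rabs b) ^ 2 <= (3 / 2 * Cmod (a, b)) ^ 2.
    have -> : (3 / 2 * Cmod (a, b)) ^ 2 = 9 / 4 * Cmod (a, b) ^ 2 by field.
    rewrite E; have := pow2_ge_0 (Rabs a - Rabs b); nra.
  move=> H; apply: Rsqr_incr_0_var; last lra.
  by rewrite !Rsqr_pow2.
have E1 : 1 <= exp (Rabs a) by rewrite -exp_0; apply: exp_mono; exact: Rabs_pos.
have := Rabs_pos b; have := Rabs_pos a; nra.
Qed.

(** * Cauchy's estimate *)

Lemma hol_sub (D E : C -> Prop) f f' : (forall s, E s -> D s) -> hol D f f' -> hol E f f'.
Proof. by move=> H Hf s Hs; apply: Hf; apply: H. Qed.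

Lemma hol_const D k : hol D (fun _ => k) (fun _ => 0%C).
Proof. by move=> s _; split; [exact: cderiv_const | exact: ccont_const]. Qed.

Lemma hol_plus D f f' g g' : hol D f f' -> hol D g g' ->
  hol D (fun z => f z + g z)%C (fun z => f' z + g' z)%C.
Proof.
move=> Hf Hg s Hs; have [A B] := Hf s Hs; have [A' B'] := Hg s Hs.
by split; [exact: cderiv_plus | exact: ccont_plus].
Qed.

Lemma hol_mult D f f' g g' : hol D f f' -> hol D g g' ->
  hol D (fun z => f z * g z)%C (fun z => f' z * g z + f z * g' z)%C.
Proof.
move=> Hf Hg s Hs; have [A B] := Hf s Hs; have [A' B'] := Hg s Hs.
split; first exact: cderiv_mult.
by apply: ccont_plus; apply: ccont_mult => //; apply: cderiv_ccont; eassumption.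
Qed.

Lemma hol_scal D k f f' : hol D f f' -> hol D (fun z => k * f z)%C (fun z => k * f' z)%C.
Proof.
move=> Hf s Hs; have [A B] := Hf s Hs.
split; first exact: cderiv_scal.
by apply: ccont_mult => //; exact: ccont_const.
Qed.

Lemma hol_cexp_lin D k : hol D (fun z => cexp (z * k))%C (fun z => k * cexp (z * k))%C.
Proof.
move=> s _; split; first exact: cderiv_cexp_lin.
apply: ccont_mult; [exact: ccont_const | apply: (cderiv_ccont _ _ _ (cderiv_cexp_lin k s))].
Qed.

Lemma hol_inv (D : C -> Prop) (f f' : C -> C) : (forall s, D s -> f s <> 0%C) -> hol D f f' ->
  hol D (fun z => / f z)%C (fun z => - f' z / (f z * f z))%C.
Proof.
move=> N Hf s Hs; have [A B] := Hf s Hs; have cf := cderiv_ccont _ _ _ A.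
split; first by apply: cderiv_inv => //; exact: N.
apply: ccont_mult.
  apply: (ccont_ext_loc (fun z => (- (1)) * f' z)%C _ s 1); first lra.
    by move=> z _; ring.
  by apply: ccont_mult => //; exact: ccont_const.
apply: (ccont_inv (fun z => f z * f z)%C); first by apply: Cmult_neq_0; apply: N.
exact: ccont_mult.
Qed.

Lemma hol_ext_deriv (D : C -> Prop) f g f' g' : copen D -> (forall s, D s -> f s = g s) ->
  (forall s, D s -> f' s = g' s) -> hol D f f' -> hol D g g'.
Proof.
move=> OD E E' Hf s Hs; have [A B] := Hf s Hs; have [d [Hd H]] := OD s Hs.
split.
  rewrite -E' //; apply: (cderiv_ext_loc f g s _ d) => // z Hz; apply: E; exact: H.
apply: (ccont_ext_loc f' g' s d) => // z Hz; apply: E'; exact: H.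
Qed.

Lemma RInt_Rminus (f g : R -> R) a b : ex_RInt f a b -> ex_RInt g a b ->
  RInt f a b - RInt g a b = RInt (fun t => f t - g t) a b.
Proof. by move=> Hf Hg; symmetry; exact: (RInt_minus f g a b Hf Hg). Qed.

Lemma RInt_Rplus (f g : R -> R) a b : ex_RInt f a b -> ex_RInt g a b ->
  RInt f a b + RInt g a b = RInt (fun t => f t + g t) a b.
Proof. by move=> Hf Hg; symmetry; exact: (RInt_plus f g a b Hf Hg). Qed.

Lemma ex_RInt_Rminus (f g : R -> R) a b : ex_RInt f a b -> ex_RInt g a b ->
  ex_RInt (fun t => f t - g t) a b.
Proof. by move=> Hf Hg; exact: (ex_RInt_minus f g a b Hf Hg). Qed.

Lemma ex_RInt_Rplus (f g : R -> R) a b : ex_RInt f a b -> ex_RInt g a b ->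
  ex_RInt (fun t => f t + g t) a b.
Proof. by move=> Hf Hg; exact: (ex_RInt_plus f g a b Hf Hg). Qed.

Lemma RInt_Rscal (f : R -> R) k a b : ex_RInt f a b ->
  RInt (fun t => k * f t) a b = k * RInt f a b.
Proof. by move=> Hf; exact: (RInt_scal f a b k Hf). Qed.

Lemma ex_RInt_Rscal (f : R -> R) k a b : ex_RInt f a b -> ex_RInt (fun t => k * f t) a b.
Proof. by move=> Hf; exact: (ex_RInt_scal f a b k Hf). Qed.

(* Mean value property in the variable w, for z = s0 + exp w. *)
Lemma periodic_mean (g g' : C -> C) (b x : R) (l : C) :
  hol (fun w => Re w < b) g g' -> (forall y, g (y, 2 * PI) = g (y, 0)) ->
  (forall e, 0 < e -> exists y0, forall w, Re w < y0 -> Cmod (g w - l) < e) ->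
  x < b -> RInt (fun t => Re (g (x, t))) 0 (2 * PI) = 2 * PI * Re l.
Proof.
move=> Hg Hp Hl Hx.
have P0 := PI_RGT_0.
have ex : forall y, y < b -> ex_RInt (fun t => Re (g (y, t))) 0 (2 * PI).
  by move=> y Hy; apply: ex_RInt_ccont => t _; apply: cderiv_ccont (proj1 (Hg (y, t) Hy)).
have key : forall e, 0 < e -> Rabs (RInt (fun t => Re (g (x, t))) 0 (2 * PI) - 2 * PI * Re l) <= 2 * PI * e.
  move=> e He; have [y0 Hy0] := Hl e He.
  set y := Rmin x y0 - 1.
  have [Y1 Y2] : y < x /\ y < y0.
    by rewrite /y; have := Rmin_l x y0; have := Rmin_r x y0; lra.
  (* Periodicity cancels the two horizontal edges, so the integral does not depend on x; far to the
     left it is close to the integral of the limit. *)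
  have K : Rabs (RInt (fun t => Re (g (x, t))) 0 (2 * PI) - RInt (fun t => Re (g (y, t))) 0 (2 * PI)) <= 0 * (x - y).
    apply: (vertical_shift_bound g g' (y - 1) b).
    - by apply: hol_sub Hg => s [].
    - lra. - lra. - done.
    - by move=> z Hz; rewrite Hp Rminus_diag Rabs_R0; apply: Rle_refl.
  have -> : RInt (fun t => Re (g (x, t))) 0 (2 * PI) = RInt (fun t => Re (g (y, t))) 0 (2 * PI).
    move: K; rewrite Rmult_0_l => K; have := Rabs_pos (RInt (fun t => Re (g (x, t))) 0 (2 * PI) - RInt (fun t => Re (g (y, t))) 0 (2 * PI)).
    move=> K2; apply: Rminus_diag_uniq; apply: Rabs_eq_0; lra.
  have E : 2 * PI * Re l = RInt (fun t => Re l) 0 (2 * PI).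
    by rewrite RInt_const /scal /= /mult /=; ring.
  rewrite E RInt_Rminus; [| by apply: ex; lra | exact: ex_RInt_const].
  have -> : 2 * PI * e = (2 * PI - 0) * e by ring.
  apply: abs_RInt_le_const; first lra.
    by apply: ex_RInt_Rminus; [apply: ex; lra | exact: ex_RInt_const].
  move=> t Ht; apply: Rlt_le; apply: Rle_lt_trans (Hy0 (y, t) _); last by [].
  exact: (re_le_Cmod (g (y, t) - l)).
apply: Rminus_diag_uniq; apply: Rabs_eq_0.
apply: Rle_antisym; last exact: Rabs_pos.
apply: le_epsilon => e He; rewrite Rplus_0_l.
apply: Rle_trans (key (e / (2 * PI)) _) _; first by apply: Rdiv_lt_0_compat; lra.
by apply: Req_le; field; lra.
Qed.

Lemma cexp_period y : cexp (y, 2 * PI) = cexp (y, 0).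
Proof. by rewrite /cexp /= cos_2PI sin_2PI cos_0 sin_0. Qed.

Lemma hol_circle (f f' : C -> C) (s0 : C) (r : R) : 0 < r ->
  hol (fun z => Cmod (z - s0) < r) f f' ->
  hol (fun w => Re w < ln r) (fun w => f (s0 + cexp w))%C (fun w => cexp w * f' (s0 + cexp w))%C.
Proof.
move=> Hr Hf w Hw.
have Hd : Cmod (s0 + cexp w - s0) < r.
  have -> : (s0 + cexp w - s0 = cexp w)%C by ring.
  rewrite Cmod_cexp -(exp_ln r) //; exact: exp_increasing.
have [A B] := Hf _ Hd.
have D : cderiv (fun w => s0 + cexp w)%C w (cexp w).
  apply: cderiv_eq (cderiv_plus _ _ _ _ _ (cderiv_const s0 w) (cderiv_cexp w)) _; ring.
split; first exact: (cderiv_comp f).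
apply: ccont_mult; first exact: ccont_cexp.
apply: (ccont_comp f') => //; exact: cderiv_ccont D.
Qed.

(** With z = s0 + exp w, the function k (f z - f s0) / (z - s0) is periodic in Im w and tends to k
    f' s0, so [periodic_mean] applies. On the circle of radius r / 2 it is at most 4 M / r; taking k
    among 1, -1, i, -i bounds both parts of f' s0, whence 8. *)
Lemma cauchy_estimate (f f' : C -> C) (s0 : C) (r M : R) : 0 < r ->
  hol (fun z => Cmod (z - s0) < r) f f' -> (forall z, Cmod (z - s0) < r -> Cmod (f z) <= M) ->
  Cmod (f' s0) <= 8 * M / r.
Proof.
move=> Hr Hf HM.
have P0 := PI_RGT_0.
have S0 : Cmod (s0 - s0) < r by rewrite Cmod_minus_diag.
have key : forall k : C, Cmod k <= 1 -> Re (k * f' s0)%C <= 4 * M / r.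
  move=> k Hk.
  set g := fun w : C => (k * ((f (s0 + cexp w) + - f s0) * cexp (w * - (1))))%C.
  have Hg : exists g', hol (fun w => Re w < ln r) g g'.
    eexists; apply: hol_scal; apply: hol_mult; last exact: hol_cexp_lin.
    apply: hol_plus; last exact: hol_const.
    exact: hol_circle Hf.
  case: Hg => g' Hg.
  have Mn : 0 <= M by apply: Rle_trans (Cmod_ge_0 _) (HM _ S0).
  have ck : forall w, Re w < ln r -> Cmod (g w) <= 2 * M * exp (- Re w).
    move=> w Hw.
    rewrite /g !Cmod_mult Cmod_cexp.
    have -> : Re (w * - (1)) = - Re w by case: (w) => a b /=; ring.
    have Hd : Cmod (s0 + cexp w - s0) < r.
      have -> : (s0 + cexp w - s0 = cexp w)%C by ring.
      rewrite Cmod_cexp -(exp_ln r) //; exact: exp_increasing.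
    have T := Cmod_triangle_minus (f (s0 + cexp w)%C) (f s0).
    have T1 := HM _ Hd; have T2 := HM _ S0.
    have P := exp_pos (- Re w); have P3 := Cmod_ge_0 (f (s0 + cexp w) - f s0)%C.
    have P2 := Cmod_ge_0 k.
    have : Cmod (f (s0 + cexp w) - f s0)%C * exp (- Re w) <= 2 * M * exp (- Re w).
      by apply: Rmult_le_compat_r; lra.
    have : 0 <= Cmod (f (s0 + cexp w) - f s0)%C * exp (- Re w) by apply: Rmult_le_pos; lra.
    rewrite /Cminus; nra.
  have E := periodic_mean g g' (ln r) (ln (r / 2)) (k * f' s0)%C Hg.
  have Hx : ln (r / 2) < ln r by apply: ln_increasing; lra.
  have E2 : RInt (fun t => Re (g (ln (r/2), t))) 0 (2 * PI) = 2 * PI * Re (k * f' s0)%C.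
    apply: E => //.
      move=> y; rewrite /g.
      have Q : forall y t : R, (((y, t) : C) * - (1))%C = (- y, - t).
        by move=> y1 t1; rewrite /Cmult /Copp /=; f_equal; ring.
      rewrite cexp_period !Q /cexp /= !cos_neg !sin_neg cos_2PI sin_2PI cos_0 sin_0 //.
    move=> e He.
    have [[q [d [Hd [cq [Eq H]]]]] _] := Hf s0 S0.
    have [d1 [Hd1 H1]] := cq e He.
    have Hm : 0 < Rmin d d1 by apply: Rmin_glb_lt.
    exists (ln (Rmin d d1)) => w Hw.
    have Hc : Cmod (s0 + cexp w - s0) < Rmin d d1.
      have -> : (s0 + cexp w - s0 = cexp w)%C by ring.
      rewrite Cmod_cexp -(exp_ln (Rmin d d1)) //; exact: exp_increasing.
    have -> : (g w - k * f' s0 = k * (q (s0 + cexp w) - q s0))%C.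
      rewrite /g (H _ (Rlt_le_trans _ _ _ Hc (Rmin_l _ _))) Eq.
      have -> : (w * - (1) = - w)%C by ring.
      rewrite cexp_opp; field; exact: cexp_neq0.
    rewrite Cmod_mult.
    have := H1 _ (Rlt_le_trans _ _ _ Hc (Rmin_r _ _)).
    have := Cmod_ge_0 k; have := Cmod_ge_0 (q (s0 + cexp w) - q s0)%C; nra.
  have B : Rabs (RInt (fun t => Re (g (ln (r/2), t))) 0 (2 * PI)) <= (2 * PI - 0) * (2 * M * exp (- ln (r/2))).
    apply: abs_RInt_le_const; first lra.
      apply: ex_RInt_ccont => t _; apply: cderiv_ccont (proj1 (Hg (ln (r/2), t) _)); exact: Hx.
    move=> t Ht; apply: Rle_trans (re_le_Cmod _) _.
    exact: (ck (ln (r/2), t)).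
  rewrite E2 exp_Ropp exp_ln in B; last lra.
  have := Rle_trans _ _ _ (Rle_abs _) B => B2.
  have B3 : 2 * PI * Re (k * f' s0)%C <= 2 * PI * (4 * M / r).
    apply: Rle_trans B2 _; apply: Req_le; field; lra.
  by apply: Rmult_le_reg_l B3; lra.
apply: Rle_trans (Cmod_le_re_im _) _.
have A1 : Rabs (Re (f' s0)) <= 4 * M / r.
  apply: Rabs_le; split.
    have := key (- (1))%C.
    have -> : Re (- (1) * f' s0)%C = - Re (f' s0) by case: (f' s0) => a b /=; ring.
    by rewrite Cmod_opp Cmod_1 => /(_ (Rle_refl _)); lra.
  have := key 1%C.
  have -> : (1 * f' s0 = f' s0)%C by ring.
  by rewrite Cmod_1 => /(_ (Rle_refl _)); lra.
have A2 : Rabs (Im (f' s0)) <= 4 * M / r.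
  apply: Rabs_le; split.
    have := key Ci.
    have -> : Re (Ci * f' s0)%C = - Im (f' s0) by case: (f' s0) => a b /=; ring.
    by rewrite Cmod_Ci => /(_ (Rle_refl _)); lra.
  have := key (- Ci)%C.
  have -> : Re (- Ci * f' s0)%C = Im (f' s0) by case: (f' s0) => a b /=; ring.
  by rewrite Cmod_opp Cmod_Ci => /(_ (Rle_refl _)); lra.
lra.
Qed.

(** * Locally uniform limits *)

Definition ccv (u : nat -> C) (l : C) : Prop :=
  forall e, 0 < e -> exists N, forall n, (N <= n)%nat -> Cmod (u n - l) < e.

Definition ccauchy (u : nat -> C) : Prop :=
  forall e, 0 < e -> exists N, forall n m, (N <= n)%nat -> (N <= m)%nat -> Cmod (u n - u m) < e.

(** Total because [Lim_seq] is; its value is meaningful where [ccauchy_ccv] or [ccv_clim]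
    applies. *)
Definition clim (u : nat -> C) : C :=
  (real (Lim_seq (fun n => Re (u n))), real (Lim_seq (fun n => Im (u n)))).

Lemma ccv_re_im u l : ccv u l <-> is_lim_seq (fun n => Re (u n)) (Re l) /\ is_lim_seq (fun n => Im (u n)) (Im l).
Proof.
split=> [H|[/is_lim_seq_spec A /is_lim_seq_spec B]].
  split; apply/is_lim_seq_spec => e; have [N HN] := H e (cond_pos e); exists N => n /leP harmonic;
    apply: Rle_lt_trans (HN n harmonic).
  - exact: (re_le_Cmod (u n - l)).
  - exact: (im_le_Cmod (u n - l)).
move=> e He; have He2 : 0 < e / 2 by lra.
have [N1 H1] := A (mkposreal _ He2); have [N2 H2] := B (mkposreal _ He2).
exists (maxn N1 N2) => n harmonic.
apply: Rle_lt_trans (Cmod_le_re_im _) _.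
have := H1 n ltac:(lia); have := H2 n ltac:(lia); rewrite /=.
rewrite /Rminus /Re /Im /=; lra.
Qed.

Lemma ccauchy_ccv u : ccauchy u -> ccv u (clim u).
Proof.
move=> H; apply/ccv_re_im; split; apply: Lim_seq_correct'; apply/ex_lim_seq_cauchy_corr => e;
  have [N HN] := H e (cond_pos e); exists N => n m /leP harmonic /leP Hm; apply: Rle_lt_trans (HN n m harmonic Hm).
- exact: (re_le_Cmod (u n - u m)).
- exact: (im_le_Cmod (u n - u m)).
Qed.

Lemma ccv_clim u l : ccv u l -> clim u = l.
Proof.
move=> /ccv_re_im [A B]; rewrite /clim (is_lim_seq_unique _ _ A) (is_lim_seq_unique _ _ B) /=.
by case: l {A B}.
Qed.

Lemma ccv_bound u l (k : C) (M : R) N : ccv u l -> (forall n, (N <= n)%nat -> Cmod (u n - k) <= M) ->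
  Cmod (l - k) <= M.
Proof.
move=> H HM; apply: le_epsilon => e He; have [N1 H1] := H e He.
have := HM (maxn N N1) ltac:(lia); have := H1 (maxn N N1) ltac:(lia).
have := Cmod_triangle (u (maxn N N1) - k) (l - u (maxn N N1)).
have -> : (u (maxn N N1) - k + (l - u (maxn N N1)) = l - k)%C by ring.
rewrite (Cmod_minus_sym l (u _)); lra.
Qed.

Lemma ccv_ext u v l : (forall n, u n = v n) -> ccv u l -> ccv v l.
Proof. by move=> E H e He; have [N HN] := H e He; exists N => n harmonic; rewrite -E; apply: HN. Qed.

Lemma ccv_const k : ccv (fun _ => k) k.
Proof. by move=> e He; exists 0%nat => n _; rewrite Cmod_minus_diag. Qed.

Lemma ccv_plus u v a b : ccv u a -> ccv v b -> ccv (fun n => u n + v n)%C (a + b)%C.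
Proof.
move=> /ccv_re_im [A B] /ccv_re_im [A' B']; apply/ccv_re_im.
by split; apply: is_lim_seq_plus'.
Qed.

Lemma ccv_mult u v a b : ccv u a -> ccv v b -> ccv (fun n => u n * v n)%C (a * b)%C.
Proof.
move=> /ccv_re_im [A B] /ccv_re_im [A' B']; apply/ccv_re_im; split.
- by apply: is_lim_seq_minus'; apply: is_lim_seq_mult'.
- by apply: is_lim_seq_plus'; apply: is_lim_seq_mult'.
Qed.

(* Locally uniformly Cauchy. *)
Definition luc (D : C -> Prop) (f : nat -> C -> C) : Prop :=
  forall s, D s -> exists r, 0 < r /\ (forall z, Cmod (z - s) < r -> D z) /\
    forall e, 0 < e -> exists N, forall n m z, (N <= n)%nat -> (N <= m)%nat -> Cmod (z - s) < r ->
      Cmod (f n z - f m z) < e.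

(** Cauchy's estimate for f n - f m on discs of radius r / 2 around the points of the disc of radius
    r / 2, all of which stay inside the disc of radius r. *)
Lemma luc_deriv D f f' : (forall n, hol D (f n) (f' n)) -> luc D f -> luc D f'.
Proof.
move=> Hf Hu s Hs; have [r [Hr [HD H]]] := Hu s Hs.
exists (r/2); split; first lra.
split; first by move=> z Hz; apply: HD; lra.
move=> e He; have [N HN] := H (e * r / 32) ltac:(nra).
exists N => n m z harmonic Hm Hz.
have In : forall w, Cmod (w - z) < r / 2 -> Cmod (w - s) < r.
  move=> w Hw; have := Cmod_triangle (w - z) (z - s).
  have -> : (w - z + (z - s) = w - s)%C by ring.
  lra.
have := cauchy_estimate (fun w => f n w + - (1) * f m w)%C (fun w => f' n w + - (1) * f' m w)%C z (r/2) (e * r / 32).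
have -> : (f' n z + - (1) * f' m z = f' n z - f' m z)%C by ring.
move=> K; apply: Rle_lt_trans (K _ _ _) _.
- lra.
- apply: hol_sub (hol_plus _ _ _ _ _ (Hf n) (hol_scal _ _ _ _ (Hf m))) => w Hw; apply: HD; exact: In.
- move=> w Hw; have -> : (f n w + - (1) * f m w = f n w - f m w)%C by ring.
  apply: Rlt_le; apply: HN => //; exact: In.
have -> : 8 * (e * r / 32) / (r / 2) = e / 2 by field; lra.
lra.
Qed.

Lemma luc_ccauchy D f s : luc D f -> D s -> ccauchy (fun n => f n s).
Proof.
move=> Hu Hs e He; have [r [Hr [_ H]]] := Hu s Hs; have [N HN] := H e He.
by exists N => n m harmonic Hm; apply: HN => //; rewrite Cmod_minus_diag.
Qed.

Lemma luc_ccont (D : C -> Prop) f s : luc D f -> D s -> (forall n z, D z -> ccont (f n) z) ->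
  ccont (fun z => clim (fun n => f n z)) s.
Proof.
move=> Hu Hs Hc e He; have [r [Hr [HD H]]] := Hu s Hs; have [N HN] := H (e/8) ltac:(lra).
have [d [Hd H1]] := Hc N s Hs (e/8) ltac:(lra).
exists (Rmin r d); split; first by apply: Rmin_glb_lt.
move=> z Hz.
have Z1 := Rlt_le_trans _ _ _ Hz (Rmin_l _ _); have Z2 := Rlt_le_trans _ _ _ Hz (Rmin_r _ _).
have L : forall w, Cmod (w - s) < r -> Cmod (clim (fun n => f n w) - f N w) <= e / 8.
  move=> w Hw; apply: (ccv_bound (fun n => f n w) _ _ _ N).
    apply: ccauchy_ccv; apply: (luc_ccauchy D) => //; exact: HD.
  by move=> n harmonic; apply: Rlt_le; apply: HN.
have A := L z Z1; have B := L s ltac:(by rewrite Cmod_minus_diag); have E := H1 z Z2.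
have -> : (clim (fun n => f n z) - clim (fun n => f n s) =
  (clim (fun n => f n z) - f N z) + (f N z - f N s) - (clim (fun n => f n s) - f N s))%C by ring.
apply: Rle_lt_trans (Cmod_triangle_minus _ _) _.
have := Cmod_triangle (clim (fun n => f n z) - f N z) (f N z - f N s).
lra.
Qed.

(** Weierstrass's theorem. The first-order remainder of f n at s, formed with the limit of the
    derivatives at s, is small uniformly in n, so the estimate passes to the limit. *)
Lemma luc_hol D f f' : (forall n, hol D (f n) (f' n)) -> luc D f ->
  hol D (fun s => clim (fun n => f n s)) (fun s => clim (fun n => f' n s)).
Proof.
move=> Hf Hu s Hs.
have Hu' := luc_deriv _ _ _ Hf Hu.
have cc : ccont (fun z => clim (fun n => f' n z)) s.
  by apply: (luc_ccont D) => // n z Hz; case: (Hf n z Hz).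
split => //.
apply: cderiv_intro => e He.
have [d [Hd Hdc]] := cc (e/8) ltac:(lra).
have [r [Hr [HD H]]] := Hu' s Hs; have [N HN] := H (e/8) ltac:(lra).
exists (Rmin d r); split; first by apply: Rmin_glb_lt.
move=> z Hz.
have Z1 := Rlt_le_trans _ _ _ Hz (Rmin_l _ _); have Z2 := Rlt_le_trans _ _ _ Hz (Rmin_r _ _).
set F' := fun s => clim (fun n => f' n s).
have L : forall w n, (N <= n)%nat -> Cmod (w - s) < r -> Cmod (F' w - f' n w) <= e / 8.
  move=> w n harmonic Hw; apply: (ccv_bound (fun n => f' n w) _ _ _ N).
    apply: ccauchy_ccv; apply: (luc_ccauchy D) => //; exact: HD.
  by move=> m Hm; apply: Rlt_le; apply: HN.
have key : forall n, (N <= n)%nat -> Cmod (f n z - f n s - (z - s) * F' s)%C <= 2 * (e / 2) * Cmod (z - s).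
  move=> n harmonic; apply: (segment_bound (f n) (f' n)) => x Hx.
  set w := (s + RtoC x * (z - s))%C.
  have Hw : Cmod (w - s) <= Cmod (z - s).
    have -> : (w - s = RtoC x * (z - s))%C by rewrite /w; ring.
    rewrite Cmod_mult Cmod_R Rabs_pos_eq; last lra.
    have := Cmod_ge_0 (z - s); nra.
  split; first by apply: (proj1 (Hf n w _)); apply: HD; lra.
  have A := L w n harmonic ltac:(lra); have B := Hdc w ltac:(lra).
  have -> : (f' n w - F' s = (F' w - F' s) - (F' w - f' n w))%C by ring.
  apply: Rle_trans (Cmod_triangle_minus _ _) _.
  rewrite /F' in A B *; lra.
have cz : ccv (fun n => f n z) (clim (fun n => f n z)).
  by apply: ccauchy_ccv; apply: (luc_ccauchy D) => //; exact: HD.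
have cs : ccv (fun n => f n s) (clim (fun n => f n s)).
  by apply: ccauchy_ccv; apply: (luc_ccauchy D).
have cd : ccv (fun n => f n z + - (1) * f n s)%C (clim (fun n => f n z) + - (1) * clim (fun n => f n s))%C.
  apply: ccv_plus => //; apply: ccv_mult => //; exact: ccv_const.
have := ccv_bound _ _ ((z - s) * F' s)%C (e * Cmod (z - s)) N cd.
have -> : (clim (fun n => f n z) + - (1) * clim (fun n => f n s) - (z - s) * F' s =
  clim (fun n => f n z) - clim (fun n => f n s) - (z - s) * F' s)%C by ring.
apply=> n harmonic; have -> : (f n z + - (1) * f n s - (z - s) * F' s = f n z - f n s - (z - s) * F' s)%C by ring.
have := key n harmonic; lra.
Qed.

(** * The function (s - 1) zeta s *)

Fixpoint csum (f : nat -> C) (N : nat) : C :=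
  match N with 0%nat => 0%C | S n => (csum f n + f (S n))%C end.

(* As for [csum], the index runs over [1..N]. *)
Fixpoint rsum (f : nat -> R) (N : nat) : R :=
  match N with 0%nat => 0 | S n => rsum f n + f (S n) end.

Lemma Re_plus a b : Re (a + b)%C = Re a + Re b.
Proof. by []. Qed.

Lemma Re_opp a : Re (- a)%C = - Re a.
Proof. by []. Qed.

Lemma Re_minus a b : Re (a - b)%C = Re a - Re b.
Proof. by []. Qed.

Lemma Re_scal x c : Re (RtoC x * c)%C = x * Re c.
Proof. by case: c => a b /=; ring. Qed.

(** This is n^(-s), and [rpow c x] is x^(-c): the minus sign belongs to both notions, so larger
    exponents give smaller values. *)
Definition npow (n : nat) (s : C) : C := cexp (s * RtoC (- ln (INR n))).

Definition rpow (c x : R) : R := exp (- c * ln x).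

Lemma rpow_pos c x : 0 < rpow c x.
Proof. exact: exp_pos. Qed.

Lemma Cmod_npow n s : Cmod (npow n s) = rpow (Re s) (INR n).
Proof. by rewrite /npow Cmod_cexp /rpow; congr exp; case: s => a b /=; ring. Qed.

Lemma ln_INR_ge0 n : 0 <= ln (INR n).
Proof.
case: n => [|n]; first by rewrite /= /ln; case: Rlt_dec => // H; [case: (Rlt_irrefl _ H) | lra].
rewrite -ln_1; apply: ln_le; first lra. rewrite S_INR; have := pos_INR n; lra.
Qed.

Lemma rpow_le c d n : c <= d -> rpow d (INR n) <= rpow c (INR n).
Proof. by move=> H; apply: exp_mono; have := ln_INR_ge0 n; nra. Qed.

Lemma Cmod_unit_rotation (w : C) : exists k : C, Cmod k <= 1 /\ Re (k * w)%C = Cmod w.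
Proof.
case: (Req_dec (Cmod w) 0) => [E|N].
  exists 0%C; rewrite Cmod_0; split; first lra. by rewrite E; case: (w) => a b /=; ring.
have P : 0 < Cmod w by have := Cmod_ge_0 w; lra.
exists (Cconj w * RtoC (/ Cmod w))%C; split.
  rewrite Cmod_mult Cmod_conj Cmod_R Rabs_pos_eq; last by apply: Rlt_le; apply: Rinv_0_lt_compat.
  by apply: Req_le; field.
have -> : (Cconj w * RtoC (/ Cmod w) * w = RtoC (/ Cmod w) * (w * Cconj w))%C by ring.
rewrite -Cmod2_conj -RtoC_mult /=; field; lra.
Qed.

(** Rotating the increment onto the positive real axis reduces the claim to the real mean value
    inequality with no loss in the constant, unlike [segment_bound]. *)
Lemma curve_bound (g g' : R -> C) (a b M : R) : a <= b ->
  (forall y, a <= y <= b -> forall k : C, is_derive (fun y => Re (k * g y)%C) y (Re (k * g' y)%C)) ->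
  (forall y, a <= y <= b -> Cmod (g' y) <= M) -> Cmod (g b - g a) <= M * (b - a).
Proof.
move=> Hab Hd HM.
have [k [Hk <-]] := Cmod_unit_rotation (g b - g a).
have -> : Re (k * (g b - g a))%C = Re (k * g b)%C - Re (k * g a)%C.
  by case: k {Hk} => k1 k2; case: (g a) => ? ?; case: (g b) => ? ? /=; ring.
apply: Rle_trans (Rle_abs _) _.
apply: (deriv_bound (fun y => Re (k * g y)%C) (fun y => Re (k * g' y)%C)) => //.
  by move=> y Hy; apply: Hd.
move=> y Hy; apply: Rle_trans (re_le_Cmod _) _; rewrite Cmod_mult.
have := HM y Hy; have := Cmod_ge_0 (g' y); have := Cmod_ge_0 k; nra.
Qed.

Lemma is_derive_cexp_ln (k c a : C) (y : R) : 0 < y ->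
  is_derive (fun y => Re (k * (c * cexp (a * RtoC (ln y))))%C) y
    (Re (k * (c * a * cexp ((a - 1) * RtoC (ln y))))%C).
Proof.
move=> Hy.
have D : cderiv (fun z => k * (c * cexp (z * a)))%C (0 + RtoC (ln y) * 1)%C
  (k * (c * (a * cexp ((0 + RtoC (ln y) * 1) * a))))%C.
  do 2 apply: cderiv_scal; exact: cderiv_cexp_lin.
have [K _] := is_derive_line _ _ _ _ _ D.
have := is_derive_comp _ _ _ _ _ K (is_derive_ln y Hy).
move=> K2.
have E : scal (/ y) (Re (k * (c * (a * cexp ((0 + RtoC (ln y) * 1) * a))) * 1)%C) =
  Re (k * (c * a * cexp ((a - 1) * RtoC (ln y))))%C.
  have -> : ((a - 1) * RtoC (ln y) = RtoC (ln y) * a + RtoC (- ln y))%C by rewrite RtoC_opp; ring.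
  rewrite cexp_plus cexp_RtoC exp_Ropp exp_ln //.
  have -> : ((0 + RtoC (ln y) * 1) * a = RtoC (ln y) * a)%C by ring.
  have -> : (k * (c * a * (cexp (RtoC (ln y) * a) * RtoC (/ y))) = RtoC (/ y) * (k * (c * (a * cexp (RtoC (ln y) * a))) * 1))%C by ring.
  rewrite /scal /= /mult /=; ring.
rewrite E in K2.
apply: is_derive_ext K2 => z; cbv beta.
have -> : ((0 + RtoC (ln z) * 1) * a = a * RtoC (ln z))%C by ring.
done.
Qed.

(** The k-th derivative in s of the N-th partial sum of the zeta series. *)
Definition Fz (k N : nat) (s : C) : C := csum (fun n => RtoC ((- ln (INR n)) ^ k) * npow n s)%C N.

(* Euler-Maclaurin at order zero: [Zn N s] tends to [(s - 1) zeta s] for [0 < Re s]. *)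
Definition Zn (N : nat) (s : C) : C := ((s - 1) * Fz 0 N s + INR N * npow N s)%C.
Definition Zn1 (N : nat) (s : C) : C :=
  (Fz 0 N s + (s - 1) * Fz 1 N s + RtoC (- INR N * ln (INR N)) * npow N s)%C.
Definition Zn2 (N : nat) (s : C) : C :=
  (2 * Fz 1 N s + (s - 1) * Fz 2 N s + RtoC (INR N * ln (INR N) ^ 2) * npow N s)%C.

Lemma hol_csum D (f f' : nat -> C -> C) N : (forall n, hol D (f n) (f' n)) ->
  hol D (fun s => csum (fun n => f n s) N) (fun s => csum (fun n => f' n s) N).
Proof. by move=> H; elim: N => [|N IH] /=; [exact: hol_const | exact: hol_plus]. Qed.

Lemma csum_ext f g N : (forall n, (0 < n <= N)%nat -> f n = g n) -> csum f N = csum g N.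
Proof.
elim: N => [//|N IH] H /=; rewrite IH ?H //; first by lia.
by move=> n harmonic; apply: H; lia.
Qed.

Lemma copen_full : copen (fun _ => True).
Proof. by move=> s _; exists 1; split; first lra. Qed.

Lemma hol_npow D n : hol D (npow n) (fun s => RtoC (- ln (INR n)) * npow n s)%C.
Proof. exact: hol_cexp_lin. Qed.

Lemma hol_Fz k N : hol (fun _ => True) (Fz k N) (Fz k.+1 N).
Proof.
apply: (hol_ext_deriv _ _ _ _ _ copen_full _ _ (hol_csum _ _ _ N (fun n => hol_scal _ (RtoC ((- ln (INR n)) ^ k)) _ _ (hol_npow _ n)))) => //.
by move=> s _; apply: csum_ext => n _; rewrite /= RtoC_mult; ring.
Qed.

Lemma hol_id D : hol D (fun z => z) (fun _ => 1%C).
Proof. by move=> s _; split; [exact: cderiv_id | exact: ccont_const]. Qed.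

Lemma hol_Zn N : hol (fun _ => True) (Zn N) (Zn1 N).
Proof.
apply: (hol_ext_deriv _ _ _ _ _ copen_full _ _ (hol_plus _ _ _ _ _ (hol_mult _ _ _ _ _ (hol_plus _ _ _ _ _ (hol_id _) (hol_const _ (- (1))%C)) (hol_Fz 0 N)) (hol_scal _ (INR N) _ _ (hol_npow _ N)))) => //.
move=> s _; rewrite /Zn1 (RtoC_mult (- INR N)) !RtoC_opp; ring.
Qed.

Lemma hol_Zn1 N : hol (fun _ => True) (Zn1 N) (Zn2 N).
Proof.
apply: (hol_ext_deriv _ _ _ _ _ copen_full _ _ (hol_plus _ _ _ _ _ (hol_plus _ _ _ _ _ (hol_Fz 0 N) (hol_mult _ _ _ _ _ (hol_plus _ _ _ _ _ (hol_id _) (hol_const _ (- (1))%C)) (hol_Fz 1 N))) (hol_scal _ (RtoC (- INR N * ln (INR N))) _ _ (hol_npow _ N)))) => //.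
move=> s _; rewrite /Zn2 (RtoC_mult (- INR N)) !RtoC_opp.
have -> : RtoC (INR N * ln (INR N) ^ 2) = (RtoC (INR N) * (RtoC (ln (INR N)) * RtoC (ln (INR N))))%C.
  by rewrite -!RtoC_mult; congr RtoC; ring.
ring.
Qed.

Lemma INR_npow N s : (0 < N)%nat -> (RtoC (INR N) * npow N s)%C = cexp ((1 - s) * RtoC (ln (INR N))).
Proof.
move=> HN; have P : 0 < INR N by apply: lt_0_INR; lia.
rewrite -{1}(exp_ln (INR N)) // -cexp_RtoC -cexp_plus; congr cexp; rewrite RtoC_opp; ring.
Qed.

Lemma npow_alt N s : npow N s = cexp (- s * RtoC (ln (INR N))).
Proof. by rewrite /npow; congr cexp; rewrite RtoC_opp; ring. Qed.

(* The increments are first-order Taylor remainders of y ^ (1 - s). *)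
Lemma Zn_incr N s : (0 < N)%nat -> 0 < Re s ->
  Cmod (Zn N.+1 s - Zn N s) <= Cmod s * Cmod (s - 1)%C * rpow (1 + Re s) (INR N).
Proof.
move=> HN Hs; have P : 0 < INR N by apply: lt_0_INR; lia.
have EN : INR N.+1 = INR N + 1 by rewrite S_INR.
set g' := fun y : R => ((1 - s) * cexp (- s * RtoC (ln y)))%C.
have M2 : forall y, INR N <= y -> Cmod ((1 - s) * - s * cexp ((- s - 1) * RtoC (ln y)))%C <= Cmod s * Cmod (s - 1)%C * rpow (1 + Re s) (INR N).
  move=> y Hy; rewrite !Cmod_mult Cmod_opp (Cmod_minus_sym 1 s) Cmod_cexp (Rmult_comm (Cmod (s - 1)%C)).
  apply: Rmult_le_compat_l; first by apply: Rmult_le_pos; apply: Cmod_ge_0.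
  apply: exp_mono.
  have -> : Re ((- s - 1) * RtoC (ln y))%C = - (1 + Re s) * ln y by case: (s) => ? ? /=; ring.
  have := ln_le _ _ P Hy; nra.
have B1 : forall y, INR N <= y <= INR N + 1 -> Cmod (g' y - g' (INR N + 1)%R) <= Cmod s * Cmod (s - 1)%C * rpow (1 + Re s) (INR N).
  move=> y Hy; rewrite Cmod_minus_sym.
  have := curve_bound g' (fun y => (1 - s) * - s * cexp ((- s - 1) * RtoC (ln y)))%C y (INR N + 1) _ (proj2 Hy).
  move=> /(_ (Cmod s * Cmod (s - 1)%C * rpow (1 + Re s) (INR N))) K.
  apply: Rle_trans (K _ _) _.
  - move=> z Hz k; apply: is_derive_cexp_ln; lra.
  - move=> z Hz; apply: M2; lra.
  have : 0 <= Cmod s * Cmod (s - 1)%C * rpow (1 + Re s) (INR N).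
    apply: Rmult_le_pos; last by apply: Rlt_le; exact: rpow_pos. by apply: Rmult_le_pos; apply: Cmod_ge_0.
  nra.
(* y^(1 - s) minus its linear part. The slope is taken at N + 1, not at N, because there it equals
   (1 - s) times the term that the sum gains. *)
set g := fun y : R => (cexp ((1 - s) * RtoC (ln y)) + - RtoC y * g' (INR N + 1)%R)%C.
have E : (Zn N.+1 s - Zn N s = g (INR N + 1)%R - g (INR N))%C.
  have F : Fz 0 N.+1 s = (Fz 0 N s + npow N.+1 s)%C by rewrite /Fz /=; ring.
  rewrite /Zn F !INR_npow // /g /g' -EN (npow_alt N.+1) EN RtoC_plus; ring.
rewrite E.
have := curve_bound g (fun y => g' y - g' (INR N + 1)%R)%C (INR N) (INR N + 1) _ ltac:(lra).
move=> /(_ (Cmod s * Cmod (s - 1)%C * rpow (1 + Re s) (INR N))) K.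
apply: Rle_trans (K _ _) _ => //; last lra.
move=> y Hy k.
have D1 := is_derive_cexp_ln k 1 (1 - s) y ltac:(lra).
have D2 : is_derive (fun y => Re (k * (- RtoC y * g' (INR N + 1)%R))%C) y (Re (k * - g' (INR N + 1)%R)%C).
  have Eq : forall y : R, Re (k * (- RtoC y * g' (INR N + 1)%R))%C = - y * Re (k * g' (INR N + 1)%R)%C.
    by move=> z; clear; move: (g' (INR N + 1)%R) => [? ?]; case: (k) => ? ? /=; ring.
  apply: (is_derive_ext (fun y => - y * Re (k * g' (INR N + 1)%R)%C)).
    by move=> z; rewrite Eq.
  have -> : Re (k * - g' (INR N + 1)%R)%C = - Re (k * g' (INR N + 1)%R)%C.
    by clear; move: (g' (INR N + 1)%R) => [? ?]; case: (k) => ? ? /=; ring.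
  by move: (Re _) => c; auto_derive => //; ring.
have := is_derive_plus _ _ _ _ _ D1 D2.
have -> : plus (Re (k * (1 * (1 - s) * cexp ((1 - s - 1) * RtoC (ln y))))%C) (Re (k * - g' (INR N + 1)%R)%C)
  = Re (k * (g' y - g' (INR N + 1)%R))%C.
  rewrite -[LHS]/(Re _ + Re _) -Re_plus; congr Re; rewrite /g'.
  have -> : ((1 - s - 1) = - s)%C by ring.
  ring.
apply: is_derive_ext => z.
rewrite -[LHS]/(Re _ + Re _) -Re_plus; congr Re; rewrite /g; ring.
Qed.

(** x^(-1 - c) is 1/c times the derivative of - x^(-c); on [N, N + 1] it drops at most by the factor
    2^(1 + c) <= 4. Sums of such terms then telescope. *)
Lemma rpow_tele c (N : nat) : 0 < c <= 1 -> (0 < N)%nat ->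
  rpow (1 + c) (INR N) <= 4 / c * (rpow c (INR N) - rpow c (INR N.+1)).
Proof.
move=> Hc HN; have P : 0 < INR N by apply: lt_0_INR; lia.
have P1 : 1 <= INR N by rewrite -[1]/(INR 1); apply: le_INR; lia.
have EN : INR N.+1 = INR N + 1 by rewrite S_INR.
set K := rpow (1 + c) (INR N).
have H : forall x, INR N <= x <= INR N + 1 -> K / 4 <= rpow (1 + c) x.
  move=> x Hx.
  have -> : K / 4 = exp (- ln 4 + - (1 + c) * ln (INR N)).
    rewrite exp_plus exp_Ropp exp_ln; last lra. by rewrite /K /rpow; field.
  apply: exp_mono.
  have L : ln x <= ln 2 + ln (INR N) by rewrite -ln_mult; [apply: ln_le; lra | lra | lra].
  have -> : ln 4 = 2 * ln 2 by have -> : 4 = 2 * 2 by [ring]; rewrite ln_mult; lra.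
  have L2 : 0 < ln 2 by rewrite -ln_1; apply: ln_increasing; lra.
  nra.
have D := deriv_nonneg (fun x => - rpow c x - c * (K / 4) * x) (fun x => c * rpow (1 + c) x - c * (K / 4)) (INR N) (INR N + 1) ltac:(lra).
have E : - rpow c (INR N) - c * (K / 4) * (INR N) <= - rpow c (INR N + 1) - c * (K / 4) * (INR N + 1).
  apply: D.
  - move=> x Hx.
    have Px : 0 < x by lra.
    move: (c * (K / 4)) => k; rewrite /rpow; auto_derive => //.
    have -> : - (1 + c) * ln x = - c * ln x + - ln x by ring.
    rewrite exp_plus exp_Ropp exp_ln //; field; lra.
  - move=> x Hx; have := H x Hx; nra.
rewrite EN.
have : c * (K / 4) <= rpow c (INR N) - rpow c (INR N + 1) by lra.
move=> Q.
have -> : K = 4 / c * (c * (K / 4)) by field; lra.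
apply: Rmult_le_compat_l => //; apply: Rlt_le; apply: Rdiv_lt_0_compat; lra.
Qed.

Lemma rpow_lim c e : 0 < c -> 0 < e -> exists N, forall n, (N <= n)%nat -> rpow c (INR n) < e.
Proof.
move=> Hc He.
have [N HN] := INR_unbounded (exp (- ln e / c)).
exists N => n harmonic.
have H : exp (- ln e / c) < INR n by apply: Rlt_le_trans HN _; apply: le_INR; lia.
have L : - ln e / c < ln (INR n).
  by rewrite -(ln_exp (- ln e / c)); apply: ln_increasing => //; exact: exp_pos.
rewrite -(exp_ln e) // /rpow; apply: exp_increasing.
move: L => /Rlt_div_l L.
have := L Hc; lra.
Qed.

Lemma Zn_cauchy_bound c s m n : 0 < c <= 1 -> c <= Re s -> (0 < m <= n)%nat ->
  Cmod (Zn n s - Zn m s) <= Cmod s * Cmod (s - 1)%C * (4 / c * (rpow c (INR m) - rpow c (INR n))).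
Proof.
move=> Hc Hs /andP [Hm]; elim: n => [|n IH]; first by lia.
rewrite leq_eqVlt => /orP [/eqP <-|harmonic].
  by rewrite Cmod_minus_diag Rminus_diag !Rmult_0_r; apply: Rle_refl.
have -> : (Zn n.+1 s - Zn m s = (Zn n.+1 s - Zn n s) + (Zn n s - Zn m s))%C by ring.
apply: Rle_trans (Cmod_triangle _ _) _.
have A := IH ltac:(lia).
have B := Zn_incr n s ltac:(lia) ltac:(lra).
have T := rpow_tele c n Hc ltac:(lia).
have T2 : rpow (1 + Re s) (INR n) <= rpow (1 + c) (INR n) by apply: rpow_le; lra.
have P : 0 <= Cmod s * Cmod (s - 1)%C by apply: Rmult_le_pos; apply: Cmod_ge_0.
have : Cmod s * Cmod (s - 1)%C * rpow (1 + Re s) (INR n) <= Cmod s * Cmod (s - 1)%C * (4 / c * (rpow c (INR n) - rpow c (INR n.+1))).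
  by apply: Rmult_le_compat_l; lra.
lra.
Qed.

Lemma Zn_cauchy_bound2 c s m n : 0 < c <= 1 -> c <= Re s -> (0 < m <= n)%nat ->
  Cmod (Zn n s - Zn m s) <= Cmod s * Cmod (s - 1)%C * (4 / c * rpow c (INR m)).
Proof.
move=> Hc Hs Hm; apply: Rle_trans (Zn_cauchy_bound c s m n Hc Hs Hm) _.
apply: Rmult_le_compat_l; first by apply: Rmult_le_pos; apply: Cmod_ge_0.
apply: Rmult_le_compat_l; first by apply: Rlt_le; apply: Rdiv_lt_0_compat; lra.
have := rpow_pos c (INR n); lra.
Qed.

(** Any abscissa in (0, 1/2) would serve: the half plane must contain Re s > 1/2, where RH is
    applied, and stay away from Re s = 0, where the bounds on [Zn] degenerate. *)
Definition Dz : C -> Prop := fun s => / 4 < Re s.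

Lemma luc_Zn : luc Dz Zn.
Proof.
move=> s Hs; rewrite /Dz in Hs.
exists (Re s - / 4); split; first lra.
have K : forall z, Cmod (z - s) < Re s - / 4 -> / 4 < Re z.
  move=> z Hz; have := re_le_Cmod (z - s); rewrite Re_minus => H.
  have := Rle_abs (- (Re z - Re s)); rewrite Rabs_Ropp; lra.
split => // e He.
set B := (Cmod s + Re s) * (Cmod s + Re s + 1).
have Ps := Cmod_ge_0 s.
have PB : 0 < B by rewrite /B; apply: Rmult_lt_0_compat; lra.
have [N HN] := rpow_lim (/4) (e / (16 * B)) ltac:(lra) ltac:(apply: Rdiv_lt_0_compat; lra).
exists (maxn N 1).
have main : forall n m z, (maxn N 1 <= m)%nat -> (m <= n)%nat -> Cmod (z - s) < Re s - / 4 -> Cmod (Zn n z - Zn m z) < e.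
  move=> n m z Hm harmonic Hz.
  have Rz := K z Hz.
  apply: Rle_lt_trans (Zn_cauchy_bound2 (/4) z m n _ _ _) _; [lra | lra | lia |].
  have M1 : Cmod z <= Cmod s + Re s.
    have := Cmod_triangle (z - s) s.
    have -> : (z - s + s = z)%C by ring.
    lra.
  have M2 : Cmod (z - 1)%C <= Cmod s + Re s + 1.
    by have := Cmod_triangle_minus z 1; rewrite Cmod_1; lra.
  have M3 : Cmod z * Cmod (z - 1)%C <= B.
    by apply: Rmult_le_compat => //; apply: Cmod_ge_0.
  have R := HN m ltac:(lia); have RP := rpow_pos (/4) (INR m).
  have -> : 4 / / 4 * rpow (/ 4) (INR m) = 16 * rpow (/ 4) (INR m) by field.
  apply: (Rle_lt_trans _ (B * (16 * rpow (/ 4) (INR m)))).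
    by apply: Rmult_le_compat_r; lra.
  have : rpow (/ 4) (INR m) * (16 * B) < e by apply/Rlt_div_r; lra.
  lra.
move=> n m z harmonic Hm Hz; case: (leqP m n) => H.
  exact: main.
by rewrite Cmod_minus_sym; apply: main => //; lia.
Qed.

Definition Zs (s : C) : C := clim (fun n => Zn n s).
Definition Zs1 (s : C) : C := clim (fun n => Zn1 n s).
Definition Zs2 (s : C) : C := clim (fun n => Zn2 n s).

Lemma hol_Zs : hol Dz Zs Zs1.
Proof. by apply: luc_hol luc_Zn => n; apply: hol_sub (hol_Zn n). Qed.

Lemma luc_Zn1 : luc Dz Zn1.
Proof. by apply: luc_deriv luc_Zn => n; apply: hol_sub (hol_Zn n). Qed.

Lemma hol_Zs1 : hol Dz Zs1 Zs2.
Proof. by apply: luc_hol luc_Zn1 => n; apply: hol_sub (hol_Zn1 n). Qed.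

Lemma Zn_cv s : / 4 < Re s -> ccv (fun n => Zn n s) (Zs s).
Proof. by move=> Hs; apply: ccauchy_ccv; apply: (luc_ccauchy Dz) => //; exact: luc_Zn. Qed.

Lemma Zs_err c s m : 0 < c <= 1 -> c <= Re s -> / 4 < Re s -> (0 < m)%nat ->
  Cmod (Zs s - Zn m s) <= Cmod s * Cmod (s - 1)%C * (4 / c * rpow c (INR m)).
Proof.
move=> Hc Hs Hs4 Hm; apply: (ccv_bound _ _ _ _ m (Zn_cv s Hs4)) => n harmonic.
by apply: Zn_cauchy_bound2 => //; lia.
Qed.

Lemma npow_1 s : npow 1 s = 1%C.
Proof. by rewrite /npow /= ln_1 Ropp_0 Cmult_0_r cexp_0. Qed.

(** Comparison with [Zn 1 s], which is s. The quadratic growth in |s| is what makes the later bound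
    on the logarithmic derivative logarithmic in the height. *)
Lemma Zs_bound s : / 2 <= Re s -> Cmod (Zs s) <= Cmod s + 8 * (Cmod s * Cmod (s - 1)%C).
Proof.
move=> Hs; have := Zs_err (/2) s 1 ltac:(lra) Hs ltac:(lra) erefl.
have -> : Zn 1 s = s by rewrite /Zn /Fz /= npow_1; ring.
have -> : rpow (/ 2) (INR 1) = 1 by rewrite /rpow /= ln_1 Rmult_0_r exp_0.
have := Cmod_triangle (Zs s - s) s.
have -> : (Zs s - s + s = Zs s)%C by ring.
have -> : 4 / / 2 * 1 = 8 by field.
lra.
Qed.

Lemma Zs_1 : Zs 1 = 1%C.
Proof.
apply: ccv_clim => e He; exists 1%nat => n harmonic.
have -> : Zn n 1 = 1%C; last by rewrite Cmod_minus_diag.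
rewrite /Zn INR_npow //.
have -> : ((1 - 1) * RtoC (ln (INR n)) = 0)%C by ring.
rewrite cexp_0; ring.
Qed.

Lemma npow_mult m n s : (0 < m)%nat -> (0 < n)%nat -> npow (m * n)%nat s = (npow m s * npow n s)%C.
Proof.
move=> Hm harmonic; rewrite /npow -cexp_plus; congr cexp.
rewrite mult_INR ln_mult; [|by apply: lt_0_INR; lia|by apply: lt_0_INR; lia].
by rewrite !RtoC_opp RtoC_plus; ring.
Qed.

(** * Zeros of the limit function are zeros of eta *)

Lemma eta_term_npow s n : eta_term s n = (RtoC ((-1) ^ n) * npow n.+1 s)%C.
Proof.
rewrite /eta_term; congr Cmult.
rewrite /cpow_neg /npow /cexp addn1; case: s => a b.
by apply: injective_projections; rewrite /=; congr (exp _ * _); try congr cos; try congr sin; ring.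
Qed.

Lemma Fz0_S N s : Fz 0 N.+1 s = (Fz 0 N s + npow N.+1 s)%C.
Proof. by rewrite /Fz /=; ring. Qed.

(** The alternating sum is the full sum minus twice its even terms, and these are 2^(-s) times the
    sum of half the length. The index 2N + 1 means 2N + 2 terms, since [eta_term] starts at 0. *)
Lemma eta_even_sum s N :
  sum_n (eta_term s) (N.*2.+1) = (Fz 0 N.+1.*2 s - 2 * npow 2 s * Fz 0 N.+1 s)%C.
Proof.
have Sg : forall k : nat, (-1) ^ k.*2 = 1.
  by elim=> [|k IH] //=; rewrite IH; ring.
elim: N => [|N IH].
  rewrite sum_Sn sum_O !eta_term_npow /= !Fz0_S /Fz /= npow_1 /plus /=.
  have -> : -1 * 1 = - (1) by ring.
  rewrite RtoC_opp; change (0.*2.+2)%nat with 2%nat; ring.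
have E : N.+1.*2.+1 = N.*2.+1.+2 by lia.
rewrite E 2!sum_Sn IH !eta_term_npow.
have E2 : N.+2.*2 = N.*2.+4 by lia.
have E3 : N.+1.*2 = N.*2.+2 by lia.
rewrite E2 ?E3 !Fz0_S ?E3 ?Fz0_S.
have -> : npow N.*2.+4 s = (npow 2 s * npow N.+2 s)%C.
  by rewrite -npow_mult //; congr npow; lia.
have -> : (-1) ^ N.*2.+2 = 1 by rewrite -E3 Sg.
have -> : (-1) ^ N.*2.+3 = - (1) by rewrite -E3 /= Sg; ring.
rewrite /plus /= RtoC_opp; ring.
Qed.

Lemma Fz0_Zn N (s : C) : s <> 1%C -> Fz 0 N s = ((Zn N s - INR N * npow N s) / (s - 1))%C.
Proof. by move=> Hs; have N1 := Cminus_eq_contra _ _ Hs; rewrite /Zn; field. Qed.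

(** In [eta_even_sum] the main terms of the two zeta sums cancel, because (2M)^(1 - s) = 2 * 2^(-s)
    * M^(1 - s). What remains is a combination of [Zn] at 2M and at M, both tending to [Zs s], which
    is 0. *)
Lemma zero_eta_series (s : C) : / 4 < Re s -> s <> 1%C -> Zs s = 0%C -> is_series (eta_term s) (RtoC 0).
Proof.
move=> Hs H1 H0.
have Hd : 0 < Cmod (s - 1)%C by apply/Cmod_gt_0; apply: Cminus_eq_contra.
have cz := Zn_cv s Hs; rewrite H0 in cz.
have even : forall e, 0 < e -> exists N, forall M, (N <= M)%nat -> Cmod (sum_n (eta_term s) (M.*2.+1)) < e.
  move=> e He; have [N HN] := cz (e * Cmod (s - 1)%C / 3) ltac:(nra).
  exists N => M HM; rewrite eta_even_sum !Fz0_Zn //.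
  have E : (RtoC (INR M.+1.*2) * npow M.+1.*2 s = 2 * npow 2 s * (RtoC (INR M.+1) * npow M.+1 s))%C.
    rewrite -muln2 npow_mult // mult_INR RtoC_mult /=.
    by have -> : RtoC (1 + 1) = RtoC 2 by []; ring.
  have -> : ((Zn M.+1.*2 s - INR M.+1.*2 * npow M.+1.*2 s) / (s - 1) -
   2 * npow 2 s * ((Zn M.+1 s - INR M.+1 * npow M.+1 s) / (s - 1)) =
   ((Zn M.+1.*2 s - 0) - 2 * npow 2 s * (Zn M.+1 s - 0)) / (s - 1))%C.
    by rewrite E; field; apply: Cminus_eq_contra.
  rewrite Cmod_div; last by apply: Cminus_eq_contra.
  apply/Rlt_div_l => //.
  apply: Rle_lt_trans (Cmod_triangle_minus _ _) _.
  rewrite !Cmod_mult Cmod_R Rabs_pos_eq; last lra.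
  have P2 : Cmod (npow 2 s) <= 1.
    rewrite Cmod_npow -exp_0 /rpow; apply: exp_mono.
    have := ln_INR_ge0 2; nra.
  have A1 := HN (M.+1.*2) ltac:(lia); have A2 := HN M.+1 ltac:(lia).
  have P := Cmod_ge_0 (Zn M.+1 s - 0); have Q := Cmod_ge_0 (npow 2 s).
  have : Cmod (npow 2 s) * Cmod (Zn M.+1 s - 0) <= 1 * Cmod (Zn M.+1 s - 0) by apply: Rmult_le_compat_r.
  lra.
apply/filterlim_locally => eps.
have He : 0 < eps / 2 by have := cond_pos eps; lra.
have [N1 H1'] := even _ He; have [N2 HN2] := rpow_lim (Re s) _ ltac:(lra) He.
exists (N1.*2 + N2 + 2)%nat => n /leP harmonic.
apply: C_NormedModule_mixin_compat1.
have -> : minus (sum_n (eta_term s) n) (RtoC 0) = sum_n (eta_term s) n.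
  by rewrite /minus /plus /opp /=; ring.
have [k [Ek|Ek]] : exists k, n = k.*2.+1 \/ n = k.*2.+2.
  exists (n.-1)./2; lia.
- by rewrite Ek; have := H1' k ltac:(lia); lra.
(* An odd number of terms differs from an even one by a single term, whose modulus tends to 0. *)
rewrite Ek sum_Sn.
have A := H1' k ltac:(lia).
apply: Rle_lt_trans (Cmod_triangle _ _) _.
have : Cmod (eta_term s k.*2.+2) < eps / 2.
  rewrite eta_term_npow Cmod_mult Cmod_npow Cmod_R pow_1_abs Rmult_1_l; apply: HN2; lia.
lra.
Qed.

Lemma Zs_neq0_strip (RH : RiemannHypothesis) (s : C) : / 2 < Re s < 1 -> Zs s <> 0%C.
Proof.
move=> Hs H0.
have := RH s ltac:(lra) (zero_eta_series s ltac:(lra) _ H0).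
have N : s <> 1%C by move=> E; rewrite E /= in Hs; lra.
move=> /(_ N); lra.
Qed.

(** * The von Mangoldt function *)

Lemma rsum_ext f g N : (forall n, (0 < n <= N)%nat -> f n = g n) -> rsum f N = rsum g N.
Proof.
elim: N => [//|N IH] H /=; rewrite IH ?H //; first by lia.
by move=> n harmonic; apply: H; lia.
Qed.

Lemma rsum_le f g N : (forall n, (0 < n <= N)%nat -> f n <= g n) -> rsum f N <= rsum g N.
Proof.
elim: N => [|N IH] H /=; first by apply: Rle_refl.
apply: Rplus_le_compat; last by apply: H; lia.
by apply: IH => n harmonic; apply: H; lia.
Qed.

Lemma rsum_0 N : rsum (fun _ => 0) N = 0.
Proof. by elim: N => [//|N IH] /=; rewrite IH Rplus_0_l. Qed.

Lemma rsum_eq0 f N : (forall n, (0 < n <= N)%nat -> f n = 0) -> rsum f N = 0.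
Proof. by move=> H; rewrite (rsum_ext _ (fun _ => 0) N H) rsum_0. Qed.

Lemma rsum_ge0 f N : (forall n, (0 < n <= N)%nat -> 0 <= f n) -> 0 <= rsum f N.
Proof. by move=> H; rewrite -(rsum_0 N); apply: rsum_le. Qed.

Lemma rsum_plus f g N : rsum (fun n => f n + g n) N = rsum f N + rsum g N.
Proof. by elim: N => [|N IH] /=; [ring | rewrite IH; ring]. Qed.

Lemma rsum_scal k f N : rsum (fun n => k * f n) N = k * rsum f N.
Proof. by elim: N => [|N IH] /=; [ring | rewrite IH; ring]. Qed.

Lemma rsum_exchange (f : nat -> nat -> R) N M :
  rsum (fun n => rsum (fun m => f n m) M) N = rsum (fun m => rsum (fun n => f n m) N) M.
Proof. by elim: N => [|N IH] /=; [rewrite rsum_0 | rewrite IH -rsum_plus]. Qed.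

Lemma rsum_extend f n M : (n <= M)%nat -> (forall i, (n < i <= M)%nat -> f i = 0) -> rsum f M = rsum f n.
Proof.
move=> harmonic; elim: M harmonic => [|M IH]; first by case: n.
rewrite leq_eqVlt => /orP [/eqP -> //|harmonic] H /=.
have -> : f M.+1 = 0 by apply: H; lia.
rewrite Rplus_0_r; apply: IH; first by lia.
by move=> i Hi; apply: H; lia.
Qed.

Lemma rsum_delta (x : R) m N :
  rsum (fun n => if n == m then x else 0) N = if (0 < m <= N)%nat then x else 0.
Proof.
elim: N => [|N IH] /=; first by case: m.
rewrite IH; case: (eqVneq N.+1 m) => [<-|Hm] /=.
  by rewrite ltnn leqnn /= Rplus_0_l.
rewrite Rplus_0_r; have -> // : (0 < m <= N)%nat = (0 < m <= N.+1)%nat.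
by apply/idP/idP => /andP [A B]; apply/andP; split => //; move/eqP: Hm; lia.
Qed.

Lemma Re_csum f N : Re (csum f N) = rsum (fun n => Re (f n)) N.
Proof. by elim: N => [//|N IH] /=; rewrite -IH. Qed.

Lemma Im_csum f N : Im (csum f N) = rsum (fun n => Im (f n)) N.
Proof. by elim: N => [//|N IH] /=; rewrite -IH. Qed.

Lemma Cmod_csum f N : Cmod (csum f N) <= rsum (fun n => Cmod (f n)) N.
Proof.
elim: N => [|N IH] /=; first by rewrite Cmod_0; apply: Rle_refl.
by apply: Rle_trans (Cmod_triangle _ _) _; lra.
Qed.

(* [w p j] if [n = p ^ j] with [p] prime, and 0 if [n] is no prime power, as soon as [n <= M]. *)
Definition ppsum (w : nat -> nat -> R) (M n : nat) : R :=
  rsum (fun p => rsum (fun j => if prime p && (n == expn p j) then w p j else 0) M) M.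

Lemma prime_power_bounds p j n : prime p -> n = expn p j -> (0 < j)%nat -> (p <= n)%nat /\ (j <= n)%nat.
Proof.
move=> Hp -> Hj; have p1 := prime_gt1 Hp; split.
  by have := leq_exp2l 1 j p1; rewrite expn1 => ->.
by apply: ltnW; apply: ltn_expl.
Qed.

Lemma ppsum_stable w M n : (n <= M)%nat -> ppsum w M n = ppsum w n n.
Proof.
move=> harmonic; rewrite /ppsum.
rewrite (rsum_extend _ n M) //; last first.
  move=> p Hp; apply: rsum_eq0 => j Hj; case: ifP => // /andP [Pp /eqP E].
  by have [] := prime_power_bounds p j n Pp E ltac:(lia); lia.
apply: rsum_ext => p Hp; apply: rsum_extend => // j Hj; case: ifP => // /andP [Pp /eqP E].
by have [] := prime_power_bounds p j n Pp E ltac:(lia); lia.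
Qed.

Definition mangoldt (n : nat) : R := ppsum (fun p _ => ln (INR p)) n n.
(** The Dirichlet coefficients of ln zeta: Lambda n / ln n, written without a division so that n = 1
    needs no exception. *)
Definition mangoldt_log (n : nat) : R := ppsum (fun _ j => / INR j) n n.

Lemma ppsum_ge0 w M n : (forall p j, (0 < j)%nat -> 0 <= w p j) -> 0 <= ppsum w M n.
Proof.
move=> H; apply: rsum_ge0 => p _; apply: rsum_ge0 => j Hj; case: ifP => _; [apply: H; lia | lra].
Qed.

Lemma mangoldt_ge0 n : 0 <= mangoldt n.
Proof. by apply: ppsum_ge0 => p j _; exact: ln_INR_ge0. Qed.

Lemma mangoldt_log_ge0 n : 0 <= mangoldt_log n.
Proof.
apply: ppsum_ge0 => p j Hj; apply: Rlt_le; apply: Rinv_0_lt_compat; apply: lt_0_INR; lia.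
Qed.

Lemma INR_expn p j : INR (expn p j) = INR p ^ j.
Proof. by elim: j => [|j IH] //=; rewrite expnS mult_INR IH. Qed.

Lemma mangoldt_logE n : mangoldt n = mangoldt_log n * ln (INR n).
Proof.
rewrite /mangoldt /mangoldt_log /ppsum Rmult_comm -rsum_scal; apply: rsum_ext => p _.
rewrite -rsum_scal; apply: rsum_ext => j Hj; case: ifP => [/andP [Pp /eqP E]|_]; last by ring.
have Hp : 0 < INR p by apply: lt_0_INR; have := prime_gt0 Pp; lia.
have Hj2 : INR j <> 0 by apply: not_0_INR; lia.
by rewrite [in RHS]E INR_expn ln_pow //; field.
Qed.

Lemma rsum_leq_count m N : (m <= N)%nat -> rsum (fun j => if (j <= m)%nat then 1 else 0) N = INR m.
Proof.
move=> Hm; rewrite (rsum_extend _ m N) //; last by move=> i Hi; case: ifP => //; lia.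
rewrite (rsum_ext _ (fun _ => 1)); last by move=> j Hj; case: ifP => //; lia.
by elim: m {Hm} => [//|m IH]; rewrite S_INR -IH.
Qed.

Lemma ln_factorization n : (0 < n)%nat -> ln (INR n) = rsum (fun p => INR (logn p n) * ln (INR p)) n.
Proof.
move=> harmonic.
have E : n = (\prod_(0 <= p < n.+1) expn p (logn p n))%nat.
  by rewrite -{1}(partnT harmonic) /partn; apply: eq_big_nat.
have K : forall M, (0 < \prod_(0 <= p < M.+1) expn p (logn p n))%nat /\
  ln (INR (\prod_(0 <= p < M.+1) expn p (logn p n))%nat) = rsum (fun p => INR (logn p n) * ln (INR p)) M.
  elim=> [|M [IH1 IH2]].
    by rewrite big_nat1 lognE /=; split=> //; rewrite ?expn0 /= ln_1.
  rewrite big_nat_recr //=.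
  have P : (0 < expn M.+1 (logn M.+1 n))%nat by rewrite expn_gt0.
  split; first by rewrite muln_gt0 IH1 P.
  rewrite mult_INR ln_mult; [|by apply: lt_0_INR; lia|by apply: lt_0_INR; lia].
  rewrite IH2; congr (_ + _); rewrite INR_expn ln_pow //; apply: lt_0_INR; lia.
by rewrite {1}E; case: (K n).
Qed.

(** After the exchange of sums, each prime p contributes ln p once for every j >= 1 with p^j
    dividing n, which is [logn p n] times. *)
Lemma mangoldt_divisor_sum n : (0 < n)%nat -> rsum (fun d => if (d %| n)%nat then mangoldt d else 0) n = ln (INR n).
Proof.
move=> harmonic; rewrite ln_factorization //.
transitivity (rsum (fun d => rsum (fun p => rsum (fun j =>
   if d == expn p j then (if prime p && (expn p j %| n)%nat then ln (INR p) else 0) else 0) n) n) n).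
  apply: rsum_ext => d Hd.
  rewrite /mangoldt -(ppsum_stable _ n); last by lia.
  rewrite /ppsum; case: ifP => Hdn.
    apply: rsum_ext => p _; apply: rsum_ext => j _.
    by case: eqP => [<-|_]; rewrite ?andbF // Hdn andbT.
  symmetry; apply: rsum_eq0 => p _; apply: rsum_eq0 => j _.
  by case: eqP => // <-; rewrite Hdn andbF.
rewrite rsum_exchange; apply: rsum_ext => p Hp.
rewrite rsum_exchange.
case Pp: (prime p); last first.
  rewrite lognE Pp /= Rmult_0_l; apply: rsum_eq0 => j _; apply: rsum_eq0 => d _; by case: ifP.
rewrite -(rsum_leq_count (logn p n) n); last by apply: ltnW; apply: ltn_logl.
rewrite Rmult_comm -rsum_scal; apply: rsum_ext => j Hj.
rewrite rsum_delta pfactor_dvdn //=.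
have Pe : (0 < expn p j)%nat by rewrite expn_gt0 prime_gt0.
rewrite Pe /=; case: (leqP j (logn p n)) => Hl.
  rewrite ifT; first by ring.
  by apply: dvdn_leq => //; rewrite pfactor_dvdn.
by case: ifP => _; ring.
Qed.

Lemma mangoldt_le_ln n : mangoldt n <= ln (INR n).
Proof.
case: n => [|n]; first by rewrite /mangoldt /ppsum /=; exact: (ln_INR_ge0 0).
rewrite -mangoldt_divisor_sum // /= dvdnn.
have : 0 <= rsum (fun d => if (d %| n.+1)%nat then mangoldt d else 0) n.
  by apply: rsum_ge0 => d _; case: ifP => _; [exact: mangoldt_ge0 | lra].
lra.
Qed.

Lemma mangoldt_log_1 : mangoldt_log 1 = 0.
Proof. by rewrite /mangoldt_log /ppsum /=; ring. Qed.

Lemma ln_INR_gt0 n : (1 < n)%nat -> 0 < ln (INR n).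
Proof. by move=> H; rewrite -ln_1; apply: ln_increasing; [lra | rewrite -[1]/(INR 1); apply: lt_INR; lia]. Qed.

Lemma mangoldt_log_le1 n : mangoldt_log n <= 1.
Proof.
case: n => [|[|n]]; first by rewrite /mangoldt_log /ppsum /=; lra.
  by rewrite mangoldt_log_1; lra.
have := mangoldt_le_ln n.+2; rewrite mangoldt_logE => H.
have P := ln_INR_gt0 n.+2 erefl.
nra.
Qed.

Lemma rsum_multiples (f : nat -> R) d N : (0 < d)%nat ->
  rsum (fun n => if (d %| n)%nat then f n else 0) N = rsum (fun m => f (d * m)%nat) (N %/ d)%nat.
Proof.
move=> Hd; elim: N => [|N IH] /=; first by rewrite div0n.
rewrite IH divnS //; case: ifP => H /=; last by rewrite Rplus_0_r.
congr (_ + f _).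
have -> : (N %/ d).+1 = (N.+1 %/ d)%nat by rewrite divnS // H.
by rewrite mulnC divnK.
Qed.

(** The finite form of - zeta' = zeta * (sum of Lambda n / n^s), for arbitrary weights f in place of
    n^(-s). *)
Lemma rsum_ln_convolution (f : nat -> R) N :
  rsum (fun n => ln (INR n) * f n) N =
  rsum (fun d => mangoldt d * rsum (fun m => f (d * m)%nat) (N %/ d)%nat) N.
Proof.
transitivity (rsum (fun n => rsum (fun d => mangoldt d * (if (d %| n)%nat then f n else 0)) N) N).
  apply: rsum_ext => n harmonic.
  rewrite -mangoldt_divisor_sum; last by lia.
  rewrite (rsum_extend _ n N); [|lia|]; last first.
    move=> d Hd; rewrite ifF; first by ring.
    by apply/negP => /dvdn_leq H; have := H ltac:(lia); lia.
  rewrite Rmult_comm -rsum_scal; apply: rsum_ext => d _; case: ifP => _; ring.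
rewrite rsum_exchange; apply: rsum_ext => d Hd.
by rewrite rsum_scal rsum_multiples //; lia.
Qed.

Lemma csum_ln_convolution (g : nat -> C) N :
  csum (fun n => RtoC (ln (INR n)) * g n)%C N =
  csum (fun d => RtoC (mangoldt d) * csum (fun m => g (d * m)%nat) (N %/ d)%nat)%C N.
Proof.
have Im_scal : forall x c, Im (RtoC x * c)%C = x * Im c by move=> x [a b] /=; ring.
apply: injective_projections.
  rewrite -/(Re _) -/(Re (csum _ _)) !Re_csum.
  rewrite (rsum_ext _ (fun n => ln (INR n) * Re (g n))); last by move=> n _; rewrite Re_scal.
  rewrite rsum_ln_convolution; apply: rsum_ext => d _; by rewrite Re_scal Re_csum.
rewrite -/(Im _) -/(Im (csum _ _)) !Im_csum.
rewrite (rsum_ext _ (fun n => ln (INR n) * Im (g n))); last by move=> n _; rewrite Im_scal.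
rewrite rsum_ln_convolution; apply: rsum_ext => d _; by rewrite Im_scal Im_csum.
Qed.

Lemma rsum_S f N : rsum f N.+1 = rsum f N + f N.+1.
Proof. by []. Qed.

Lemma csum_S f N : csum f N.+1 = (csum f N + f N.+1)%C.
Proof. by []. Qed.

(** Since h ln n <= n^h, the von Mangoldt weight costs only an arbitrarily small part of the
    exponent. *)
Lemma mangoldt_rpow_bound h c n : 0 < h -> mangoldt n * rpow (c + h) (INR n) <= / h * rpow c (INR n).
Proof.
move=> Hh.
have -> : rpow (c + h) (INR n) = rpow h (INR n) * rpow c (INR n).
  by rewrite /rpow -exp_plus; congr exp; ring.
rewrite -Rmult_assoc; apply: Rmult_le_compat_r; first by apply: Rlt_le; exact: rpow_pos.
have A := mangoldt_le_ln n; have B := mangoldt_ge0 n; have R := rpow_pos h (INR n).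
have E : exp (h * ln (INR n)) * rpow h (INR n) = 1 by rewrite /rpow -exp_plus -exp_0; congr exp; ring.
have := exp_ineq1_le (h * ln (INR n)) => X.
have : h * mangoldt n * rpow h (INR n) <= 1.
  rewrite -E; apply: Rmult_le_compat_r; first lra. nra.
move=> Y; have -> : mangoldt n * rpow h (INR n) = / h * (h * mangoldt n * rpow h (INR n)) by field; lra.
rewrite -{2}(Rmult_1_r (/ h)); apply: Rmult_le_compat_l => //.
by apply: Rlt_le; apply: Rinv_0_lt_compat.
Qed.

Lemma mangoldt_rpow_tele h c n : 0 < h <= 1 -> 1 + 2 * h <= c -> (0 < n)%nat ->
  mangoldt n * rpow c (INR n) <= 4 / h ^ 2 * (rpow h (INR n) - rpow h (INR n.+1)).
Proof.
move=> Hh Hc harmonic.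
have A : mangoldt n * rpow c (INR n) <= mangoldt n * rpow (1 + h + h) (INR n).
  by apply: Rmult_le_compat_l; [exact: mangoldt_ge0 | apply: rpow_le; lra].
have B := mangoldt_rpow_bound h (1 + h) n ltac:(lra).
have T := rpow_tele h n Hh harmonic.
have I : 0 < / h by apply: Rinv_0_lt_compat; lra.
have : / h * rpow (1 + h) (INR n) <= / h * (4 / h * (rpow h (INR n) - rpow h (INR n.+1))).
  by apply: Rmult_le_compat_l; lra.
have -> : / h * (4 / h * (rpow h (INR n) - rpow h (INR n.+1))) = 4 / h ^ 2 * (rpow h (INR n) - rpow h (INR n.+1)).
  by field; lra.
lra.
Qed.

Lemma mangoldt_rpow_sum h c N : 0 < h <= 1 -> 1 + 2 * h <= c ->
  rsum (fun n => mangoldt n * rpow c (INR n)) N <= 4 / h ^ 2.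
Proof.
move=> Hh Hc.
have K : 0 < 4 / h ^ 2 by apply: Rdiv_lt_0_compat; nra.
suff H : rsum (fun n => mangoldt n * rpow c (INR n)) N <= 4 / h ^ 2 * (1 - rpow h (INR N.+1)).
  by have := rpow_pos h (INR N.+1); nra.
elim: N => [|N IH].
  rewrite /rsum /rpow [INR 1]/= ln_1 Rmult_0_r exp_0; lra.
rewrite rsum_S.
have := mangoldt_rpow_tele h c N.+1 Hh Hc erefl; lra.
Qed.

(** * The Dirichlet series of the von Mangoldt function *)

Definition Lpart (N : nat) (s : C) : C := csum (fun d => RtoC (mangoldt d) * npow d s)%C N.
Definition Ls (s : C) : C := clim (fun N => Lpart N s).

Lemma Lpart_cauchy_bound h s m n : 0 < h <= 1 -> 1 + 2 * h <= Re s -> (m <= n)%nat ->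
  Cmod (Lpart n s - Lpart m s) <= 4 / h ^ 2 * (rpow h (INR m.+1) - rpow h (INR n.+1)).
Proof.
move=> Hh Hs; elim: n => [|n IH].
  by rewrite leqn0 => /eqP ->; rewrite Cmod_minus_diag Rminus_diag Rmult_0_r; apply: Rle_refl.
rewrite leq_eqVlt => /orP [/eqP ->|harmonic].
  by rewrite Cmod_minus_diag Rminus_diag Rmult_0_r; apply: Rle_refl.
have -> : (Lpart n.+1 s - Lpart m s = (Lpart n s - Lpart m s) + RtoC (mangoldt n.+1) * npow n.+1 s)%C.
  by rewrite /Lpart csum_S; ring.
apply: Rle_trans (Cmod_triangle _ _) _.
rewrite Cmod_mult Cmod_npow Cmod_R Rabs_pos_eq; last exact: mangoldt_ge0.
have := mangoldt_rpow_tele h (Re s) n.+1 Hh Hs erefl; have := IH ltac:(lia); lra.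
Qed.

Lemma Lpart_cauchy_bound2 h s m n : 0 < h <= 1 -> 1 + 2 * h <= Re s -> (m <= n)%nat ->
  Cmod (Lpart n s - Lpart m s) <= 4 / h ^ 2 * rpow h (INR m.+1).
Proof.
move=> Hh Hs Hm; apply: Rle_trans (Lpart_cauchy_bound h s m n Hh Hs Hm) _.
have : 0 < 4 / h ^ 2 by apply: Rdiv_lt_0_compat; nra.
have := rpow_pos h (INR n.+1); nra.
Qed.

(** Three gaps fit between 1 and x: [mangoldt_rpow_sum] consumes two, and [Fz1_cv] spends the third
    on the factor d^h. *)
Definition hgap (x : R) : R := Rmin 1 ((x - 1) / 3).

Lemma hgap_spec x : 1 < x -> 0 < hgap x <= 1 /\ 1 + 3 * hgap x <= x.
Proof.
move=> Hx; rewrite /hgap; have A := Rmin_l 1 ((x - 1) / 3); have B := Rmin_r 1 ((x - 1) / 3).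
have : 0 < Rmin 1 ((x - 1) / 3) by apply: Rmin_glb_lt; lra.
lra.
Qed.

Lemma Lpart_cv s : 1 < Re s -> ccv (fun n => Lpart n s) (Ls s).
Proof.
move=> Hs; have [Hh Hc] := hgap_spec _ Hs; set h := hgap (Re s) in Hh Hc.
have K : 0 < 4 / h ^ 2 by apply: Rdiv_lt_0_compat; nra.
apply: ccauchy_ccv => e He.
have [N HN] := rpow_lim h (e / (4 / h ^ 2)) ltac:(lra) ltac:(exact: Rdiv_lt_0_compat).
have main : forall n m, (N <= m)%nat -> (m <= n)%nat -> Cmod (Lpart n s - Lpart m s) < e.
  move=> n m Hm harmonic; apply: Rle_lt_trans (Lpart_cauchy_bound2 h s m n Hh ltac:(lra) harmonic) _.
  have := HN m.+1 ltac:(lia) => /Rlt_div_r => /(_ K); lra.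
exists N => n m harmonic Hm; case: (leqP m n) => H; first exact: main.
by rewrite Cmod_minus_sym; apply: main => //; lia.
Qed.

Lemma Ls_err h s m : 0 < h <= 1 -> 1 + 2 * h <= Re s ->
  Cmod (Ls s - Lpart m s) <= 4 / h ^ 2 * rpow h (INR m.+1).
Proof.
move=> Hh Hs; apply: (ccv_bound _ _ _ _ m (Lpart_cv s ltac:(lra))) => n harmonic.
exact: Lpart_cauchy_bound2.
Qed.

Lemma csum_minus f g N : csum (fun n => f n - g n)%C N = (csum f N - csum g N)%C.
Proof. by elim: N => [|N IH] /=; [ring | rewrite IH; ring]. Qed.

Lemma csum_scal k f N : csum (fun n => k * f n)%C N = (k * csum f N)%C.
Proof. by elim: N => [|N IH] /=; [ring | rewrite IH; ring]. Qed.

Lemma csum_scalr k f N : csum (fun n => f n * k)%C N = (csum f N * k)%C.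
Proof. by elim: N => [|N IH] /=; [ring | rewrite IH; ring]. Qed.

Lemma Fz0_err (s : C) m h : 0 < h <= 1 -> 1 + h <= Re s -> (0 < m)%nat ->
  Cmod (Fz 0 m s - Zs s / (s - 1))%C <= (4 * Cmod s + / Cmod (s - 1)%C) * rpow h (INR m).
Proof.
move=> Hh Hs Hm.
have H1 : s <> 1%C by move=> E; rewrite E /= in Hs; lra.
have H2 := Cminus_eq_contra _ _ H1.
have P := proj1 (Cmod_gt_0 _) H2.
rewrite Fz0_Zn //.
have -> : ((Zn m s - INR m * npow m s) / (s - 1) - Zs s / (s - 1) = ((Zn m s - Zs s) - INR m * npow m s) / (s - 1))%C.
  by field.
rewrite Cmod_div // ; apply/Rle_div_l => //.
apply: Rle_trans (Cmod_triangle_minus _ _) _.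
have A := Zs_err 1 s m ltac:(lra) ltac:(lra) ltac:(lra) Hm.
rewrite Cmod_minus_sym in A.
have B : Cmod (INR m * npow m s)%C <= rpow h (INR m).
  rewrite INR_npow // Cmod_cexp; apply: exp_mono.
  have -> : Re ((1 - s) * RtoC (ln (INR m))) = (1 - Re s) * ln (INR m) by case: (s) => ? ? /=; ring.
  have := ln_INR_ge0 m; nra.
have C0 : rpow 1 (INR m) <= rpow h (INR m) by apply: rpow_le; lra.
have -> : (4 * Cmod s + / Cmod (s - 1)%C) * rpow h (INR m) * Cmod (s - 1)%C =
   Cmod s * Cmod (s - 1)%C * (4 / 1 * rpow h (INR m)) + rpow h (INR m) by field; lra.
apply: Rplus_le_compat => //; apply: Rle_trans A _.
apply: Rmult_le_compat_l; first by apply: Rmult_le_pos; apply: Cmod_ge_0.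
lra.
Qed.

Lemma ccv_intro_rpow u l K h : 0 < h -> 0 < K -> (forall n, (0 < n)%nat -> Cmod (u n - l) <= K * rpow h (INR n)) ->
  ccv u l.
Proof.
move=> Hh HK H e He.
have [N HN] := rpow_lim h (e / K) Hh ltac:(exact: Rdiv_lt_0_compat).
exists N.+1 => n harmonic; apply: Rle_lt_trans (H n ltac:(lia)) _.
have := HN n ltac:(lia) => /Rlt_div_r => /(_ HK); lra.
Qed.

Lemma Fz0_cv (s : C) : 1 < Re s -> ccv (fun n => Fz 0 n s) (Zs s / (s - 1))%C.
Proof.
move=> Hs; have [Hh Hc] := hgap_spec _ Hs.
have H1 : s <> 1%C by move=> E; rewrite E /= in Hs; lra.
have P := proj1 (Cmod_gt_0 _) (Cminus_eq_contra _ _ H1).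
apply: (ccv_intro_rpow _ _ (4 * Cmod s + / Cmod (s - 1)%C) (hgap (Re s))).
- lra.
- have := Cmod_ge_0 s; have := Rinv_0_lt_compat _ P; lra.
- move=> n harmonic; apply: Fz0_err => //; lra.
Qed.

(** By the convolution identity the sum is minus that of Lambda d * d^(-s) * Fz 0 (N / d). Replacing
    each inner sum by its limit z costs O((N / d)^(-h)), and the total of these errors is
    O(N^(-h)). *)
Lemma Fz1_cv (s : C) : 1 < Re s -> ccv (fun n => Fz 1 n s) (- (Ls s * (Zs s / (s - 1))))%C.
Proof.
move=> Hs; have [Hh Hc] := hgap_spec _ Hs; set h := hgap (Re s) in Hh Hc.
have H1 : s <> 1%C by move=> E; rewrite E /= in Hs; lra.
have P := proj1 (Cmod_gt_0 _) (Cminus_eq_contra _ _ H1).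
set z := (Zs s / (s - 1))%C.
set K := (4 * Cmod s + / Cmod (s - 1)%C).
have HK : 0 < K by rewrite /K; have := Cmod_ge_0 s; have := Rinv_0_lt_compat _ P; lra.
have Hh2 : 0 < 4 / h ^ 2 by apply: Rdiv_lt_0_compat; nra.
have E : forall N, (Fz 1 N s + Lpart N s * z = - csum (fun d => RtoC (mangoldt d) * npow d s * (Fz 0 (N %/ d) s - z)) N)%C.
  move=> N.
  have -> : Fz 1 N s = (- csum (fun n => RtoC (ln (INR n)) * npow n s) N)%C.
    have -> : (- csum (fun n => RtoC (ln (INR n)) * npow n s) N = (- (1)) * csum (fun n => RtoC (ln (INR n)) * npow n s) N)%C by ring.
    rewrite -csum_scal /Fz; apply: csum_ext => n _.
    by rewrite /= Rmult_1_r RtoC_opp; ring.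
  rewrite csum_ln_convolution /Lpart -csum_scalr.
  have -> : csum (fun d => RtoC (mangoldt d) * npow d s * (Fz 0 (N %/ d) s - z))%C N =
    (csum (fun d => RtoC (mangoldt d) * csum (fun m => npow (d * m)%nat s) (N %/ d)) N - csum (fun d => RtoC (mangoldt d) * npow d s * z) N)%C.
    rewrite -csum_minus; apply: csum_ext => d Hd.
    have -> : csum (fun m => npow (d * m)%nat s) (N %/ d) = (npow d s * Fz 0 (N %/ d) s)%C.
      rewrite /Fz -csum_scal; apply: csum_ext => m Hm; rewrite npow_mult; [|lia|lia].
      by rewrite /=; ring.
    ring.
  ring.
have bound : forall N, (0 < N)%nat -> Cmod (Fz 1 N s + Lpart N s * z - 0)%C <= (2 * K * (4 / h ^ 2)) * rpow h (INR N).
  move=> N HN.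
  have -> : (Fz 1 N s + Lpart N s * z - 0 = - csum (fun d => RtoC (mangoldt d) * npow d s * (Fz 0 (N %/ d) s - z)) N)%C by rewrite E; ring.
  rewrite Cmod_opp; apply: Rle_trans (Cmod_csum _ _) _.
  apply: Rle_trans (_ : rsum (fun d => 2 * K * rpow h (INR N) * (mangoldt d * rpow (Re s - h) (INR d))) N <= _).
    apply: rsum_le => d Hd.
    rewrite !Cmod_mult Cmod_npow Cmod_R Rabs_pos_eq; last exact: mangoldt_ge0.
    have dp : (0 < N %/ d)%nat by rewrite divn_gt0; lia.
    have A := Fz0_err s (N %/ d)%nat h Hh ltac:(lra) dp.
    (* As d <= N, the integer quotient is positive and N <= 2 d (N / d); the factor 2 of the bound
       absorbs 2^h. *)
    have B : rpow h (INR (N %/ d)%nat) <= 2 * (rpow h (INR N) * rpow (- h) (INR d)).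
      have I1 : INR N <= 2 * (INR (N %/ d)%nat * INR d).
        have X : (N <= 2 * (N %/ d * d))%nat.
          have := divn_eq N d; have := ltn_pmod N (d := d) ltac:(lia); nia.
        by have := le_INR _ _ (elimT leP X); rewrite mult_INR mult_INR /=.
      have Pq : 0 < INR (N %/ d)%nat by apply: lt_0_INR; lia.
      have Pd : 0 < INR d by apply: lt_0_INR; lia.
      have PN : 0 < INR N by apply: lt_0_INR; lia.
      have L : ln (INR N) <= ln 2 + (ln (INR (N %/ d)%nat) + ln (INR d)).
        rewrite -ln_mult // -ln_mult; [|lra|nra]; apply: ln_le => //.
      rewrite -{1}(exp_ln 2); last lra.
      rewrite /rpow -!exp_plus; apply: exp_mono.
      have L2 : 0 < ln 2 by rewrite -ln_1; apply: ln_increasing; lra.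
      nra.
    have Q : rpow (Re s) (INR d) * rpow (- h) (INR d) = rpow (Re s - h) (INR d).
      by rewrite /rpow -exp_plus; congr exp; ring.
    have W : mangoldt d * rpow (Re s) (INR d) >= 0.
      by apply: Rle_ge; apply: Rmult_le_pos; [exact: mangoldt_ge0 | apply: Rlt_le; exact: rpow_pos].
    have -> : 2 * K * rpow h (INR N) * (mangoldt d * rpow (Re s - h) (INR d)) =
      mangoldt d * rpow (Re s) (INR d) * (K * (2 * (rpow h (INR N) * rpow (- h) (INR d)))).
      by rewrite -Q; ring.
    apply: Rmult_le_compat_l; first lra.
    rewrite -/K in A; apply: Rle_trans A _; apply: Rmult_le_compat_l; lra.
  rewrite rsum_scal.
  have S1 := mangoldt_rpow_sum h (Re s - h) N Hh ltac:(lra).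
  have -> : 2 * K * (4 / h ^ 2) * rpow h (INR N) = 2 * K * rpow h (INR N) * (4 / h ^ 2) by ring.
  apply: Rmult_le_compat_l => //; have := rpow_pos h (INR N); nra.
have c1 : ccv (fun N => Fz 1 N s + Lpart N s * z)%C 0.
  by apply: (ccv_intro_rpow _ _ (2 * K * (4 / h ^ 2)) h) => //; [lra | apply: Rmult_lt_0_compat => //; lra].
have c2 : ccv (fun N => - (1) * (Lpart N s * z))%C (- (1) * (Ls s * z))%C.
  apply: ccv_mult; first exact: ccv_const.
  by apply: ccv_mult; [exact: Lpart_cv | exact: ccv_const].
have -> : (- (Ls s * z) = 0 + - (1) * (Ls s * z))%C by ring.
by apply: ccv_ext (ccv_plus _ _ _ _ c1 c2) => N; ring.
Qed.

(** The limit of [Zn1], whose last term is of size N^(1 - Re s) ln N and vanishes. It identifies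
    [Ls] with - zeta' / zeta. *)
Lemma Zs1_eq (s : C) : 1 < Re s -> Zs1 s = (Zs s / (s - 1) - Ls s * Zs s)%C.
Proof.
move=> Hs; have [Hh Hc] := hgap_spec _ Hs; set h := hgap (Re s) in Hh Hc.
have H1 : s <> 1%C by move=> E; rewrite E /= in Hs; lra.
have H2 := Cminus_eq_contra _ _ H1.
apply: ccv_clim.
have c3 : ccv (fun n => RtoC (- INR n * ln (INR n)) * npow n s)%C 0.
  apply: (ccv_intro_rpow _ _ (/ h) h); [lra | by apply: Rinv_0_lt_compat; lra | move=> n harmonic].
  have -> : (RtoC (- INR n * ln (INR n)) * npow n s - 0 = RtoC (- ln (INR n)) * (RtoC (INR n) * npow n s))%C.
    by rewrite (RtoC_mult (- INR n)) !RtoC_opp; ring.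
  rewrite INR_npow // Cmod_mult Cmod_R Rabs_Ropp Rabs_pos_eq; last exact: ln_INR_ge0.
  rewrite Cmod_cexp.
  have -> : Re ((1 - s) * RtoC (ln (INR n))) = (1 - Re s) * ln (INR n) by case: (s) => ? ? /=; ring.
  have l0 := ln_INR_ge0 n.
  have A : exp ((1 - Re s) * ln (INR n)) <= rpow h (INR n) * rpow h (INR n).
    rewrite /rpow -exp_plus; apply: exp_mono; nra.
  have E : exp (h * ln (INR n)) * rpow h (INR n) = 1 by rewrite /rpow -exp_plus -exp_0; congr exp; ring.
  have X := exp_ineq1_le (h * ln (INR n)).
  have R := rpow_pos h (INR n).
  have Y : h * ln (INR n) * rpow h (INR n) <= 1 by rewrite -E; apply: Rmult_le_compat_r; lra.
  apply: (Rle_trans _ (ln (INR n) * (rpow h (INR n) * rpow h (INR n)))); first exact: Rmult_le_compat_l.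
  have -> : ln (INR n) * (rpow h (INR n) * rpow h (INR n)) = / h * ((h * ln (INR n) * rpow h (INR n)) * rpow h (INR n)) by field; lra.
  apply: Rmult_le_compat_l; first by apply: Rlt_le; apply: Rinv_0_lt_compat; lra.
  nra.
have -> : (Zs s / (s - 1) - Ls s * Zs s = Zs s / (s - 1) + (s - 1) * - (Ls s * (Zs s / (s - 1))) + 0)%C by field.
apply: ccv_plus c3; apply: ccv_plus; first exact: Fz0_cv.
by apply: ccv_mult; [exact: ccv_const | exact: Fz1_cv].
Qed.

(** * Zeros of zeta *)

(** Shaped to match what the product rule yields for the derivative of |f|^2; [Re_div] likewise
    matches the chain rule for 1/2 ln (|f|^2). *)
Lemma Re_mult_conj w z : 2 * Re (w * Cconj z)%C = Re w * Re z + Re z * Re w + (Im w * Im z + Im z * Im w).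
Proof. case: w => a b; case: z => c d /=; ring. Qed.

Lemma Re_div (w z : C) : z <> 0%C -> Re (w / z)%C = / 2 * (2 * Re (w * Cconj z)%C * / (Cmod z ^ 2)).
Proof.
move=> /Cmod_gt_0 H; have : 0 < Cmod z ^ 2 by apply: pow_lt.
rewrite Cmod2_alt; case: w => a b; case: z {H} => c d /= H; field; lra.
Qed.

Lemma is_derive_Cmod2_line (f : C -> C) (s v l : C) (x : R) : cderiv f (s + RtoC x * v)%C l ->
  is_derive (fun y : R => Cmod (f (s + RtoC y * v)%C) ^ 2) x
    (2 * Re (l * v * Cconj (f (s + RtoC x * v)))%C).
Proof.
move=> H; have [A B] := is_derive_line _ _ _ _ _ H.
apply: (is_derive_ext (fun y : R => Re (f (s + RtoC y * v)%C) * Re (f (s + RtoC y * v)%C) + Im (f (s + RtoC y * v)%C) * Im (f (s + RtoC y * v)%C))).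
  have E : forall c : C, Re c * Re c + Im c * Im c = Cmod c ^ 2 by move=> c; rewrite Cmod2_alt; ring.
  by move=> y; exact: E.
have D := is_derive_plus _ _ _ _ _ (is_derive_mult _ _ _ _ _ A A Rmult_comm) (is_derive_mult _ _ _ _ _ B B Rmult_comm).
by rewrite Re_mult_conj; exact: D.
Qed.

Lemma half_ln_sq a : 0 < a -> / 2 * ln (a ^ 2) = ln a.
Proof. by move=> Ha; rewrite ln_pow //=; field. Qed.

(** The real part of the logarithmic derivative is reached through 1/2 ln (|f|^2), so no branch of a
    complex logarithm is chosen. *)
Lemma is_derive_ln_Cmod_line (f : C -> C) (s v l : C) (x : R) : cderiv f (s + RtoC x * v)%C l ->
  f (s + RtoC x * v)%C <> 0%C ->
  is_derive (fun y : R => ln (Cmod (f (s + RtoC y * v)%C))) x (Re (l * v / f (s + RtoC x * v)%C)%C).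
Proof.
move=> H N.
have D := is_derive_Cmod2_line _ _ _ _ _ H.
have P := proj1 (Cmod_gt_0 _) N.
have P2 : 0 < Cmod (f (s + RtoC x * v)%C) ^ 2 by apply: pow_lt.
have D2 := is_derive_comp ln _ x _ _ (is_derive_ln _ P2) D.
have D3 := is_derive_scal _ x (/2) _ D2.
have cf : ccont (fun y : C => f (s + y * v)%C) (RtoC x).
  apply: (ccont_comp f); last exact: cderiv_ccont H.
  apply: ccont_plus; first exact: ccont_const.
  apply: ccont_mult; [exact: ccont_id | exact: ccont_const].
have [d [Hd harmonic]] := ccont_neq0 _ _ cf N.
apply: (is_derive_ext_loc (fun y : R => / 2 * ln (Cmod (f (s + RtoC y * v)%C) ^ 2))).
  exists (mkposreal _ Hd) => y Hy.
  have Py : 0 < Cmod (f (s + RtoC y * v)%C).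
    apply/Cmod_gt_0; apply: harmonic; rewrite -RtoC_minus Cmod_R; exact: Hy.
  exact: half_ln_sq.
by rewrite Re_div //; exact: D3.
Qed.

Lemma pair_line (x t : R) : (RtoC t * Ci + RtoC x * 1)%C = (x, t).
Proof. by apply: injective_projections; rewrite /=; ring. Qed.

Lemma is_derive_ln_Cmod_re (f : C -> C) (x t : R) (l : C) : cderiv f (x, t) l -> f (x, t) <> 0%C ->
  is_derive (fun y : R => ln (Cmod (f (y, t)))) x (Re (l / f (x, t))%C).
Proof.
rewrite -(pair_line x t) => H N.
have D := is_derive_ln_Cmod_line f (RtoC t * Ci)%C 1 l x H N.
have E : (l * 1 = l)%C by ring.
rewrite E in D; apply: is_derive_ext D => y; by rewrite pair_line.
Qed.

Definition zeta (s : C) : C := (Zs s / (s - 1))%C.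

Lemma cderiv_zeta (s : C) : 1 < Re s -> cderiv zeta s (- Ls s * zeta s)%C.
Proof.
move=> Hs.
have H1 : s <> 1%C by move=> E; rewrite E /= in Hs; lra.
have H2 := Cminus_eq_contra _ _ H1.
have [A _] := hol_Zs s ltac:(rewrite /Dz; lra).
have D1 : cderiv (fun z => z - 1)%C s 1.
  apply: cderiv_eq (cderiv_plus _ _ _ _ _ (cderiv_id s) (cderiv_const (- (1))%C s)) _; ring.
apply: (cderiv_eq zeta s _ _ (cderiv_mult Zs (fun z => / (z - 1))%C s _ _ A (cderiv_inv (fun z => z - 1)%C s _ H2 D1))).
by rewrite Zs1_eq // /zeta; field.
Qed.

Lemma Ls_bound h s : 0 < h <= 1 -> 1 + 2 * h <= Re s -> Cmod (Ls s) <= 4 / h ^ 2.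
Proof.
move=> Hh Hs; have := Ls_err h s 0 Hh Hs.
have -> : (Ls s - Lpart 0 s = Ls s)%C by rewrite /Lpart /=; ring.
by rewrite /rpow [INR 1]/= ln_1 Rmult_0_r exp_0 Rmult_1_r.
Qed.

(** The tail beyond 1 is at most 3/4 in modulus: from 1/4 at N = 2 on, 1 / (N + 1)^2 is compared
    with 1 / N - 1 / (N + 1). *)
Lemma zeta_near_1 (s : C) : 2 <= Re s -> / 4 <= Cmod (zeta s).
Proof.
move=> Hs.
have S : forall N, (2 <= N)%nat -> Cmod (Fz 0 N s - 1) <= 3 / 4 - / INR N.
  elim=> [//|N IH] HN; rewrite leq_eqVlt in HN; case/orP: HN => [/eqP E|HN].
    rewrite -E /Fz /= npow_1.
    have -> : (0 + 1 * 1 + 1 * npow 2 s - 1 = npow 2 s)%C by ring.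
    rewrite Cmod_npow.
    apply: (Rle_trans _ (rpow 2 (INR 2))); first by apply: rpow_le.
    rewrite /rpow.
    have -> : INR 2 = 2 by rewrite /=; ring.
    have -> : - (2) * ln 2 = - ln 2 + - ln 2 by ring.
    rewrite exp_plus exp_Ropp exp_ln; lra.
  have P : 0 < INR N by apply: lt_0_INR; lia.
  rewrite Fz0_S.
  have -> : (Fz 0 N s + npow N.+1 s - 1 = (Fz 0 N s - 1) + npow N.+1 s)%C by ring.
  apply: Rle_trans (Cmod_triangle _ _) _.
  rewrite Cmod_npow.
  have A := IH ltac:(lia).
  have B : rpow (Re s) (INR N.+1) <= rpow 2 (INR N.+1) by apply: rpow_le.
  have E : rpow 2 (INR N.+1) = / (INR N + 1) * / (INR N + 1).
    rewrite /rpow.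
    have -> : - (2) * ln (INR N.+1) = - ln (INR N.+1) + - ln (INR N.+1) by ring.
    rewrite exp_plus exp_Ropp exp_ln S_INR //; lra.
  have Q : / (INR N + 1) * / (INR N + 1) <= / INR N - / (INR N + 1).
    have -> : / INR N - / (INR N + 1) = / INR N * / (INR N + 1) by field; lra.
    apply: Rmult_le_compat_r; first by apply: Rlt_le; apply: Rinv_0_lt_compat; lra.
    apply: Rinv_le_contravar; lra.
  have -> : INR N.+1 = INR N + 1 by rewrite S_INR.
  rewrite S_INR in B E; lra.
have B : Cmod (zeta s - 1) <= 3 / 4.
  apply: (ccv_bound _ _ _ _ 2%nat (Fz0_cv s ltac:(lra))) => n harmonic.
  have := S n harmonic; have : 0 < / INR n by apply: Rinv_0_lt_compat; apply: lt_0_INR; lia.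
  lra.
have := Cmod_triangle (1 - zeta s) (zeta s).
have -> : (1 - zeta s + zeta s = 1)%C by ring.
rewrite Cmod_1 Cmod_minus_sym; lra.
Qed.

(** A Gronwall argument in place of the Euler product. Along a horizontal line zeta' = - Ls zeta
    with |Ls| <= K, so |zeta|^2 exp (- 2 K x) does not increase; a zero would persist to the right,
    against [zeta_near_1]. *)
Lemma zeta_neq0 (s : C) : 1 < Re s -> zeta s <> 0%C.
Proof.
move=> Hs Z0; have [Hh Hc] := hgap_spec _ Hs.
move: (hgap (Re s)) Hh Hc => h Hh; case: s Hs Z0 => x0 t /= Hs Z0 Hc.
set K := 4 / h ^ 2.
set x1 := Rmax 2 x0.
have X1 : 2 <= x1 by apply: Rmax_l.
have X2 : x0 <= x1 by apply: Rmax_r.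
pose N := fun x : R => - (Cmod (zeta (x, t)) ^ 2 * exp (- (2 * K) * x)).
have D : forall x, x0 <= x <= x1 -> is_derive N x
   (exp (- (2 * K) * x) * Cmod (zeta (x, t)) ^ 2 * (2 * Re (Ls (x, t)) + 2 * K)).
  move=> x Hx.
  have H : cderiv zeta (RtoC t * Ci + RtoC x * 1)%C (- Ls (x, t) * zeta (x, t))%C.
    by rewrite pair_line; apply: cderiv_zeta; rewrite /=; lra.
  have D1 := is_derive_Cmod2_line _ _ _ _ _ H.
  have D2 : is_derive (fun x => exp (- (2 * K) * x)) x (- (2 * K) * exp (- (2 * K) * x)).
    by auto_derive => //; ring.
  have D3 : is_derive (fun y => - (Cmod (zeta (RtoC t * Ci + RtoC y * 1)%C) ^ 2 * exp (- (2 * K) * y))) x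
     (- (2 * Re (- Ls (x, t) * zeta (x, t) * 1 * Cconj (zeta (RtoC t * Ci + RtoC x * 1)))%C * exp (- (2 * K) * x) +
     Cmod (zeta (RtoC t * Ci + RtoC x * 1)%C) ^ 2 * (- (2 * K) * exp (- (2 * K) * x)))).
    exact: (is_derive_opp _ _ _ (is_derive_mult _ _ _ _ _ D1 D2 Rmult_comm)).
  have E : forall a b : C, exp (- (2 * K) * x) * Cmod a ^ 2 * (2 * Re b + 2 * K) =
    - (2 * Re (- b * a * 1 * Cconj a)%C * exp (- (2 * K) * x) + Cmod a ^ 2 * (- (2 * K) * exp (- (2 * K) * x))).
    by move=> [a b] [c d]; rewrite Cmod2_alt /=; ring.
  rewrite E; rewrite pair_line in D3.
  by apply: is_derive_ext D3 => y; rewrite pair_line.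
have := deriv_nonneg N _ x0 x1 X2 D.
have -> : N x0 = 0 by rewrite /N Z0 Cmod_0; ring.
move=> /(_ _) M.
have : 0 <= N x1.
  apply: M => x Hx; apply: Rmult_le_pos.
    by apply: Rmult_le_pos; [apply: Rlt_le; exact: exp_pos | exact: pow2_ge_0].
  have B := Ls_bound h (x, t) Hh.
  have := B ltac:(rewrite [Re _]/=; lra); have := re_le_Cmod (Ls (x, t)).
  move=> /Rabs_le_between; rewrite /K; lra.
rewrite /N.
have := zeta_near_1 (x1, t) X1 => Q.
have : 0 < Cmod (zeta (x1, t)) ^ 2 by apply: pow_lt; lra.
have := exp_pos (- (2 * K) * x1); nra.
Qed.

Lemma Re_npow d x t : Re (npow d (x, t)) = rpow x (INR d) * cos (t * ln (INR d)).
Proof.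
rewrite /npow /cexp /rpow /=; congr (exp _ * _); first by ring.
have -> : x * 0 + t * - ln (INR d) = - (t * ln (INR d)) by ring.
exact: cos_neg.
Qed.

Lemma Ls_341 x t : 1 < x -> 0 <= Re (Ls (x, 0)) * 3 + Re (Ls (x, t)) * 4 + Re (Ls (x, 2 * t)).
Proof.
move=> Hx.
have L : forall y, is_lim_seq (fun n => Re (Lpart n (x, y))) (Re (Ls (x, y))).
  by move=> y; case: (proj1 (ccv_re_im _ _) (Lpart_cv (x, y) Hx)).
have T := is_lim_seq_plus' _ _ _ _ (is_lim_seq_plus' _ _ _ _ (is_lim_seq_scal_r _ 3 _ (L 0)) (is_lim_seq_scal_r _ 4 _ (L t))) (L (2 * t)).
have : Rbar_le 0 (Re (Ls (x, 0)) * 3 + Re (Ls (x, t)) * 4 + Re (Ls (x, 2 * t))).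
  apply: (is_lim_seq_le _ _ _ _ _ (is_lim_seq_const 0) T) => n.
  rewrite !Re_csum.
  rewrite [rsum _ n * 3]Rmult_comm [rsum _ n * 4]Rmult_comm -!rsum_scal -!rsum_plus.
  apply: rsum_ge0 => d _; rewrite !Re_scal !Re_npow.
  have Ld := mangoldt_ge0 d; have Rp := rpow_pos x (INR d).
  set th := t * ln (INR d).
  have -> : 2 * t * ln (INR d) = 2 * th by rewrite /th; ring.
  rewrite Rmult_0_l cos_0 cos_2a_cos.
  have -> : 3 * (mangoldt d * (rpow x (INR d) * 1)) + 4 * (mangoldt d * (rpow x (INR d) * cos th)) +
    mangoldt d * (rpow x (INR d) * (2 * cos th * cos th - 1)) = 2 * (mangoldt d * rpow x (INR d)) * (cos th + 1) ^ 2 by ring.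
  apply: Rmult_le_pos; last exact: pow2_ge_0.
  apply: Rmult_le_pos; first lra. by apply: Rmult_le_pos => //; lra.
by [].
Qed.

Lemma ln_le_reg a b : 0 < b -> ln a <= ln b -> a <= b.
Proof. by move=> Hb H; apply: Rnot_lt_le => L; have := ln_increasing _ _ Hb L; lra. Qed.

(** By [Ls_341] the logarithm of the product decreases in x up to 2, where each of the 3 + 4 + 1
    factors is at least 1/4. *)
Lemma zeta_341 x t : 1 < x <= 2 ->
  (/ 4) ^ 8 <= Cmod (zeta (x, 0)) ^ 3 * Cmod (zeta (x, t)) ^ 4 * Cmod (zeta (x, 2 * t)).
Proof.
move=> Hx.
pose H := fun y => - (3 * ln (Cmod (zeta (y, 0))) + 4 * ln (Cmod (zeta (y, t))) + ln (Cmod (zeta (y, 2 * t)))).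
have D1 : forall y u, 1 < y -> is_derive (fun y => ln (Cmod (zeta (y, u)))) y (- Re (Ls (y, u))).
  move=> y u Hy; have N := zeta_neq0 (y, u) Hy.
  have := is_derive_ln_Cmod_re zeta y u _ (cderiv_zeta (y, u) Hy) N.
  have -> : (- Ls (y, u) * zeta (y, u) / zeta (y, u) = - Ls (y, u))%C by field.
  by rewrite Re_opp.
have D : forall y, x <= y <= 2 -> is_derive H y (Re (Ls (y, 0)) * 3 + Re (Ls (y, t)) * 4 + Re (Ls (y, 2 * t))).
  move=> y Hy.
  have E1 := D1 y 0 ltac:(lra); have E2 := D1 y t ltac:(lra); have E3 := D1 y (2 * t) ltac:(lra).
  have := is_derive_opp _ _ _ (is_derive_plus _ _ _ _ _ (is_derive_plus _ _ _ _ _ (is_derive_scal _ _ 3 _ E1) (is_derive_scal _ _ 4 _ E2)) E3).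
  rewrite /opp /plus /scal /= /mult /=.
  have -> : - (3 * - Re (Ls (y, 0)) + 4 * - Re (Ls (y, t)) + - Re (Ls (y, 2 * t))) = Re (Ls (y, 0)) * 3 + Re (Ls (y, t)) * 4 + Re (Ls (y, 2 * t)) by ring.
  by [].
have M := deriv_nonneg H _ x 2 (proj2 Hx) D.
have M2 : H x <= H 2 by apply: M => y Hy; apply: Ls_341; lra.
have P : forall y u, 1 < y -> 0 < Cmod (zeta (y, u)).
  by move=> y u Hy; apply/Cmod_gt_0; apply: zeta_neq0.
have Q : forall u, ln (/ 4) <= ln (Cmod (zeta (2, u))).
  by move=> u; apply: ln_le; [lra | apply: zeta_near_1; rewrite /=; lra].
have P1 := P x 0 (proj1 Hx); have P2 := P x t (proj1 Hx); have P3 := P x (2 * t) (proj1 Hx).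
have E : ln (Cmod (zeta (x, 0)) ^ 3 * Cmod (zeta (x, t)) ^ 4 * Cmod (zeta (x, 2 * t))) = - H x.
  have I3 : INR 3 = 3 by rewrite /=; ring.
  have I4 : INR 4 = 4 by rewrite /=; ring.
  rewrite ln_mult //; last by apply: Rmult_lt_0_compat; apply: pow_lt.
  rewrite ln_mult; [|exact: pow_lt|exact: pow_lt].
  by rewrite !ln_pow // I3 I4 /H; ring.
have E8 : ln ((/ 4) ^ 8) = 8 * ln (/ 4).
  by rewrite ln_pow; [have -> : INR 8 = 8 by (rewrite /=; ring) | lra].
apply: ln_le_reg.
- by apply: Rmult_lt_0_compat => //; apply: Rmult_lt_0_compat; apply: pow_lt.
rewrite E E8; have Q0 := Q 0; have Q1 := Q t; have Q2 := Q (2 * t); rewrite /H in M2 *; lra.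
Qed.

(** The line Re s = 1 lies outside the strip of [RiemannHypothesis]. A zero at 1 + i t would bound
    the three factors of [zeta_341] at x = 1 + e by O(e^-3), O(e^4) and O(1), so the product by M e,
    which is too small once e < 4^-8 / M. *)
Lemma Zs_neq0_line t : t <> 0 -> Zs (1, t) <> 0%C.
Proof.
move=> Ht Z0.
have [[q [d [Hd [cq [_ Hq]]]]] _] := hol_Zs (1, t) ltac:(rewrite /Dz /=; lra).
have [d1 [Hd1 Hq1]] := cq 1 ltac:(lra).
set K := Cmod (q (1, t)) + 1.
have HK : 1 <= K by rewrite /K; have := Cmod_ge_0 (q (1, t)); lra.
have T0 : 0 < Rabs t by apply: Rabs_pos_lt.
have ZB : forall y u, 1 <= y <= 2 -> Cmod (Zs (y, u)) <= (3 + Rabs u) + 8 * ((3 + Rabs u) * (3 + Rabs u)).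
  move=> y u Hy; apply: Rle_trans (Zs_bound _ _) _; first by rewrite /=; lra.
  have Au := Rabs_pos u.
  have A1 : Cmod (y, u) <= 3 + Rabs u.
    by apply: Rle_trans (Cmod_le_re_im _) _; rewrite /= Rabs_pos_eq; lra.
  have A2 : Cmod ((y, u) - 1)%C <= 3 + Rabs u.
    apply: Rle_trans (Cmod_triangle_minus _ _) _; rewrite Cmod_1.
    have := Cmod_le_re_im (y, u); rewrite /= (Rabs_pos_eq y); lra.
  apply: Rplus_le_compat => //; apply: Rmult_le_compat_l; first lra.
  by apply: Rmult_le_compat => //; apply: Cmod_ge_0.
set B := fun u => (3 + Rabs u) + 8 * ((3 + Rabs u) * (3 + Rabs u)).
have BP : forall u, 0 < B u by move=> u; rewrite /B; have := Rabs_pos u; nra.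
set M := B 0 ^ 3 * (K / Rabs t) ^ 4 * (B (2 * t) / (2 * Rabs t)).
have MP : 0 < M.
  rewrite /M; repeat apply: Rmult_lt_0_compat; try exact: Rlt_0_1; try exact: BP; try (apply: Rinv_0_lt_compat; lra); lra.
have [m [m0 [m1 [m2 [m3 m4]]]]] : exists m, 0 < m /\ m <= d /\ m <= d1 /\ m <= 1 /\ m <= (/ 4) ^ 8 / M.
  have Q : 0 < (/ 4) ^ 8 / M by apply: Rdiv_lt_0_compat => //; apply: pow_lt; lra.
  move: Q; set w := (/ 4) ^ 8 / M => Q.
  exists (Rmin (Rmin d d1) (Rmin 1 w)).
  have A1 := Rmin_l (Rmin d d1) (Rmin 1 w); have A2 := Rmin_r (Rmin d d1) (Rmin 1 w).
  have A3 := Rmin_l d d1; have A4 := Rmin_r d d1; have A5 := Rmin_l 1 w; have A6 := Rmin_r 1 w.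
  split; first by apply: Rmin_glb_lt; apply: Rmin_glb_lt => //; lra.
  lra.
set e := m / 2.
have [e0 [e1 [e2 [e3 e4]]]] : 0 < e /\ e < d /\ e < d1 /\ e < 1 /\ e < (/ 4) ^ 8 / M by rewrite /e; lra.
clearbody e.
have main := zeta_341 (1 + e) t ltac:(lra).
have C1 : Cmod (zeta ((1 + e)%R, 0)) <= B 0 / e.
  rewrite /zeta Cmod_div; last by move=> [] ?; lra.
  have -> : Cmod (((1 + e)%R, 0) - 1)%C = e.
    have -> : (((1 + e)%R, 0) - 1)%C = RtoC e by apply: injective_projections; rewrite /=; ring.
    by rewrite Cmod_R Rabs_pos_eq; lra.
  apply: Rmult_le_compat_r; first by apply: Rlt_le; apply: Rinv_0_lt_compat.
  by apply: ZB; lra.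
have den : forall u, u <> 0 -> (((1 + e)%R, u) - 1)%C <> 0%C /\ Rabs u <= Cmod (((1 + e)%R, u) - 1)%C.
  move=> u Hu; split; first by move=> [] ? ?; apply: Hu; lra.
  have := im_le_Cmod (((1 + e)%R, u) - 1)%C.
  by have -> : Im (((1 + e)%R, u) - 1)%C = u by rewrite /=; ring.
have C2 : Cmod (zeta ((1 + e)%R, t)) <= e * (K / Rabs t).
  have [N1 N2] := den t Ht.
  rewrite /zeta Cmod_div //.
  have Ee : (((1 + e)%R, t) - (1, t) = RtoC e)%C by apply: injective_projections; rewrite /=; ring.
  have Me : Cmod (((1 + e)%R, t) - (1, t))%C = e by rewrite Ee Cmod_R Rabs_pos_eq; lra.
  have W : Cmod (Zs ((1 + e)%R, t)) <= e * K.
    rewrite Hq; last by rewrite Me.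
    rewrite Z0 Cplus_0_l Cmod_mult Me; apply: Rmult_le_compat_l; first lra.
    have := Hq1 ((1 + e)%R, t) ltac:(by rewrite Me).
    have := Cmod_triangle (q ((1 + e)%R, t) - q (1, t))%C (q (1, t)).
    have -> : (q ((1 + e)%R, t) - q (1, t) + q (1, t) = q ((1 + e)%R, t))%C by ring.
    rewrite /K; lra.
  have -> : e * (K / Rabs t) = e * K * / Rabs t by rewrite /Rdiv; ring.
  apply: Rmult_le_compat => //; first exact: Cmod_ge_0.
    by apply: Rlt_le; apply: Rinv_0_lt_compat; lra.
  by apply: Rinv_le_contravar.
have C3 : Cmod (zeta ((1 + e)%R, (2 * t)%R)) <= B (2 * t) / (2 * Rabs t).
  have [N1 N2] := den (2 * t) ltac:(lra).
  rewrite Rabs_mult (Rabs_pos_eq 2) in N2; last lra.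
  rewrite /zeta Cmod_div //.
  apply: Rmult_le_compat => //; first exact: Cmod_ge_0.
  - by apply: Rlt_le; apply: Rinv_0_lt_compat; lra.
  - by apply: ZB; lra.
  - by apply: Rinv_le_contravar => //; lra.
have F : Cmod (zeta ((1 + e)%R, 0)) ^ 3 * Cmod (zeta ((1 + e)%R, t)) ^ 4 * Cmod (zeta ((1 + e)%R, (2 * t)%R)) <=
  (B 0 / e) ^ 3 * (e * (K / Rabs t)) ^ 4 * (B (2 * t) / (2 * Rabs t)).
  apply: Rmult_le_compat => //; try exact: Cmod_ge_0.
    by apply: Rmult_le_pos; apply: pow_le; apply: Cmod_ge_0.
  apply: Rmult_le_compat; try (by apply: pow_le; apply: Cmod_ge_0); apply: pow_incr; split => //; exact: Cmod_ge_0.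
have G : (B 0 / e) ^ 3 * (e * (K / Rabs t)) ^ 4 * (B (2 * t) / (2 * Rabs t)) = M * e.
  by rewrite /M; field; lra.
move: e4 => /Rlt_div_r => /(_ MP); rewrite G in F; lra.
Qed.

Lemma Zs_neq0 (RH : RiemannHypothesis) (s : C) : / 2 < Re s -> Zs s <> 0%C.
Proof.
move=> Hs; case: (Rlt_dec (Re s) 1) => H1; first by apply: Zs_neq0_strip => //; lra.
case: (Rlt_dec 1 (Re s)) => H2.
  move=> Z0; apply: (zeta_neq0 s H2); rewrite /zeta Z0 /Cdiv; ring.
case: s Hs H1 H2 => x t /= Hs H1 H2; have -> : x = 1 by lra.
case: (Req_dec t 0) => [->|Ht]; last exact: Zs_neq0_line.
have -> : (1, 0) = RtoC 1 by [].
rewrite Zs_1; move=> [] ?; lra.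
Qed.

(** * The Borel-Caratheodory inequality *)

Lemma is_derive_ln_Cmod_im (f : C -> C) (x t : R) (l : C) : cderiv f (x, t) l -> f (x, t) <> 0%C ->
  is_derive (fun y : R => ln (Cmod (f (x, y)))) t (- Im (l / f (x, t))%C).
Proof.
have E : forall y : R, (RtoC x + RtoC y * Ci)%C = (x, y).
  by move=> y; apply: injective_projections; rewrite /=; ring.
rewrite -(E t) => H N.
have D := is_derive_ln_Cmod_line f (RtoC x) Ci l t H N.
have E2 : Re (l * Ci / f (RtoC x + RtoC t * Ci))%C = - Im (l / f (RtoC x + RtoC t * Ci))%C.
  have -> : (l * Ci / f (RtoC x + RtoC t * Ci) = (l / f (RtoC x + RtoC t * Ci)) * Ci)%C by rewrite /Cdiv; ring.
  by move: (l / _)%C => [a b] /=; ring.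
rewrite E2 in D; apply: is_derive_ext D => y; by rewrite E.
Qed.

Lemma continuous_ex_derive (f : R -> R) x l : is_derive f x l -> continuous f x.
Proof. by move=> H; apply: (ex_derive_continuous f); exists l. Qed.

Section BorelCaratheodory.

Variables (f f1 f2 : C -> C) (s0 : C) (r : R).
Hypothesis r_gt0 : 0 < r.
Let D : C -> Prop := fun z => Cmod (z - s0) < r.
Hypothesis Hf : hol D f f1.
Hypothesis Hf1 : hol D f1 f2.
Hypothesis f_neq0 : forall z, D z -> f z <> 0%C.

(** [phi] is f' / f. In the coordinate w = x + i t with z = s0 + exp w, [P] is the harmonic function
    ln |f| and [g] the derivative of a logarithm of f, so the x- and t-derivatives of [P] are Re g
    and - Im g. *)
Let phi : C -> C := fun z => (f1 z * / f z)%C.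
Let E : C -> C := fun w => (s0 + cexp w)%C.
Let P : R -> R -> R := fun x t => ln (Cmod (f (E (x, t)))).
Let g : C -> C := fun w => (phi (E w) * cexp w)%C.

Let E_in w : Re w < ln r -> D (E w).
Proof.
move=> Hw; rewrite /D /E.
have -> : (s0 + cexp w - s0 = cexp w)%C by ring.
rewrite Cmod_cexp -(exp_ln r) //; exact: exp_increasing.
Qed.

Let E_lim : forall d, 0 < d -> exists y0, y0 <= ln r /\ forall w, Re w < y0 -> Cmod (E w - s0) < d.
Proof.
move=> d Hd; exists (Rmin (ln r) (ln d)); split; first exact: Rmin_l.
move=> w Hw; rewrite /E.
have -> : (s0 + cexp w - s0 = cexp w)%C by ring.
rewrite Cmod_cexp -(exp_ln d) //; apply: exp_increasing; apply: Rlt_le_trans Hw (Rmin_r _ _).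
Qed.

Let s0_in : D s0.
Proof. by rewrite /D Cmod_minus_diag. Qed.

Let E_per y : E (y, 2 * PI) = E (y, 0).
Proof. by rewrite /E cexp_period. Qed.

Let phi_hol : exists phi1, hol D phi phi1.
Proof. by eexists; apply: hol_mult Hf1 (hol_inv _ _ _ f_neq0 Hf). Qed.

Let phi_cont : ccont phi s0.
Proof. have [phi1 H] := phi_hol; exact: cderiv_ccont (proj1 (H _ s0_in)). Qed.

Let phiE_hol : exists h, hol (fun w => Re w < ln r) (fun w => phi (E w)) h.
Proof. have [phi1 H] := phi_hol; eexists; exact: hol_circle H. Qed.

Let hol_cexp DD : hol DD cexp cexp.
Proof. by move=> w _; split; [exact: cderiv_cexp | exact: ccont_cexp]. Qed.

Let phiE_lim : forall e, 0 < e -> exists y0, forall w, Re w < y0 -> Cmod (phi (E w) - phi s0)%C < e.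
Proof.
move=> e He; have [d [Hd H]] := phi_cont e He; have [y0 [_ Hy]] := E_lim d Hd.
by exists y0 => w Hw; apply: H; apply: Hy.
Qed.

Let small_lim (h : C -> C) : (forall w, Re w < 0 -> Cmod (h w) <= Cmod (phi (E w)) * exp (Re w)) ->
  forall e, 0 < e -> exists y0, forall w, Re w < y0 -> Cmod (h w - 0)%C < e.
Proof.
move=> Hh e He; have [y0 H0] := phiE_lim 1 ltac:(lra).
set K := Cmod (phi s0) + 1.
have HK : 1 <= K by rewrite /K; have := Cmod_ge_0 (phi s0); lra.
exists (Rmin (Rmin y0 0) (ln (e / K))) => w Hw.
have W1 := Rlt_le_trans _ _ _ Hw (Rmin_l _ _); have W2 := Rlt_le_trans _ _ _ Hw (Rmin_r _ _).
have W3 := Rlt_le_trans _ _ _ W1 (Rmin_l _ _); have W4 := Rlt_le_trans _ _ _ W1 (Rmin_r _ _).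
have -> : (h w - 0 = h w)%C by ring.
apply: Rle_lt_trans (Hh w W4) _.
have A : Cmod (phi (E w)) <= K.
  have := H0 w W3; have := Cmod_triangle (phi (E w) - phi s0) (phi s0).
  have -> : (phi (E w) - phi s0 + phi s0 = phi (E w))%C by ring.
  rewrite /K; lra.
have B : exp (Re w) < e / K.
  rewrite -(exp_ln (e / K)); first exact: exp_increasing.
  apply: Rdiv_lt_0_compat; lra.
have Pe := exp_pos (Re w).
apply: (Rle_lt_trans _ (K * exp (Re w))); first by apply: Rmult_le_compat_r; lra.
have : K * exp (Re w) < K * (e / K) by apply: Rmult_lt_compat_l; lra.
have -> : K * (e / K) = e by field; lra.
done.
Qed.

Let Pd_x x t : x < ln r -> is_derive (fun y => P y t) x (Re (g (x, t))) /\ is_derive (fun y => P x y) t (- Im (g (x, t))).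
Proof.
move=> Hx; have H := proj1 (hol_circle _ _ _ _ r_gt0 Hf (x, t) Hx).
have N := f_neq0 _ (E_in (x, t) Hx).
have Q : (g (x, t) = cexp (x, t) * f1 (s0 + cexp (x, t)) / f (s0 + cexp (x, t)))%C.
  by rewrite /g /phi /E /Cdiv; ring.
rewrite Q; split.
- exact: (is_derive_ln_Cmod_re (fun w => f (s0 + cexp w)%C)).
- exact: (is_derive_ln_Cmod_im (fun w => f (s0 + cexp w)%C)).
Qed.

Let g_hol : exists g', hol (fun w => Re w < ln r) g g'.
Proof. have [h H] := phiE_hol; eexists; exact: hol_mult H (hol_cexp _). Qed.

Let g_cont x t : x < ln r -> ccont g (x, t).
Proof. move=> Hx; have [g' H] := g_hol; exact: cderiv_ccont (proj1 (H (x, t) Hx)). Qed.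

Let P_int x (c : R) : x < ln r -> ex_RInt (fun t => P x t) 0 c.
Proof.
move=> Hx; apply: ex_RInt_continuous => t _.
exact: continuous_ex_derive (proj2 (Pd_x x t Hx)).
Qed.

Let g_mean x : x < ln r -> RInt (fun t => Re (g (x, t))) 0 (2 * PI) = 0.
Proof.
move=> Hx; have [g' H] := g_hol.
rewrite (periodic_mean g g' (ln r) x 0 H) ?Rmult_0_r //.
- by move=> y; rewrite /g E_per cexp_period.
- by apply: small_lim => w _; rewrite /g Cmod_mult Cmod_cexp; apply: Rle_refl.
Qed.

Let P_mean_derive x : x < ln r -> is_derive (fun y => RInt (P y) 0 (2 * PI)) x 0.
Proof.
move=> Hx.
have nb : 0 < ln r - x by lra.
have nbP : forall y, Rabs (y - x) < ln r - x -> y < ln r.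
  move=> y /Rabs_def2; lra.
have K : is_derive (fun y => RInt (fun t => P y t) 0 (2 * PI)) x (RInt (fun t => Derive (fun y => P y t) x) 0 (2 * PI)).
  apply: (is_derive_RInt_param P).
  - exists (mkposreal _ nb) => y By t _; exists (Re (g (y, t))); exact: (proj1 (Pd_x y t (nbP y By))).
  - move=> t _.
    apply: (continuity_2d_pt_ext_loc (fun u v => Re (g (u, v)))).
      exists (mkposreal _ nb) => u v /= Hu _; symmetry; apply: is_derive_unique; exact: (proj1 (Pd_x u v (nbP u Hu))).
    by case: (ccont_2d g x t (g_cont x t Hx)).
  - exists (mkposreal _ nb) => y By; apply: P_int; exact: nbP.
have Q : RInt (fun t => Derive (fun y => P y t) x) 0 (2 * PI) = 0.
  rewrite (RInt_ext _ (fun t => Re (g (x, t)))); first exact: g_mean.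
  by move=> t _; apply: is_derive_unique; exact: (proj1 (Pd_x x t Hx)).
by rewrite Q in K.
Qed.

(** The mean of ln |f| over a circle about s0 does not depend on the radius, because Re g has mean
    0, and it tends to ln |f s0| as the radius shrinks. *)
Let P_mean x : x < ln r -> RInt (P x) 0 (2 * PI) = 2 * PI * ln (Cmod (f s0)).
Proof.
move=> Hx; have P0 := PI_RGT_0.
have N0 := f_neq0 _ s0_in; have M0 := proj1 (Cmod_gt_0 _) N0.
have cl : forall e, 0 < e -> exists y0, y0 <= ln r /\ forall w, Re w < y0 -> Rabs (ln (Cmod (f (E w))) - ln (Cmod (f s0))) <= e.
  move=> e He.
  have cln : continuous ln (Cmod (f s0)) by apply: continuous_ex_derive (is_derive_ln _ M0).
  have [d1 Hd1] := proj1 (filterlim_locally _ _) cln (mkposreal _ He).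
  have [d [Hd H]] := cderiv_ccont _ _ _ (proj1 (Hf _ s0_in)) d1 (cond_pos d1).
  have [y0 [Y1 Hy]] := E_lim d Hd; exists y0; split=> // w Hw; apply: Rlt_le; apply: Hd1.
  have B := H _ (Hy w Hw).
  apply: Rle_lt_trans B.
  have T1 := Cmod_triangle_inv (f (E w)) (f s0); have T2 := Cmod_triangle_inv (f s0) (f (E w)).
  rewrite (Cmod_minus_sym (f s0)) in T2.
  by apply: Rabs_le; rewrite /minus /plus /opp /=; lra.
have key : forall e, 0 < e -> Rabs (RInt (P x) 0 (2 * PI) - 2 * PI * ln (Cmod (f s0))) <= 2 * PI * e.
  move=> e He; have [y0 [Y1 Hy0]] := cl e He.
  set y := Rmin x y0 - 1.
  have [Yx Yy] : y < x /\ y < y0 by rewrite /y; have := Rmin_l x y0; have := Rmin_r x y0; lra.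
  have K : Rabs (RInt (P x) 0 (2 * PI) - RInt (P y) 0 (2 * PI)) <= 0 * (x - y).
    apply: (deriv_bound (fun y => RInt (P y) 0 (2 * PI)) (fun _ => 0)); first lra.
      by move=> z Hz; apply: P_mean_derive; lra.
    by move=> z _; rewrite Rabs_R0; apply: Rle_refl.
  have -> : RInt (P x) 0 (2 * PI) = RInt (P y) 0 (2 * PI).
    by apply: Rminus_diag_uniq; apply: Rabs_eq_0; have := Rabs_pos (RInt (P x) 0 (2 * PI) - RInt (P y) 0 (2 * PI)); lra.
  have Ec : 2 * PI * ln (Cmod (f s0)) = RInt (fun t => ln (Cmod (f s0))) 0 (2 * PI).
    by rewrite RInt_const /scal /= /mult /=; ring.
  have Iy : ex_RInt (P y) 0 (2 * PI) by apply: P_int; lra.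
  rewrite Ec RInt_Rminus //; last exact: ex_RInt_const.
  have -> : 2 * PI * e = (2 * PI - 0) * e by ring.
  apply: abs_RInt_le_const; first lra.
    by apply: ex_RInt_Rminus => //; exact: ex_RInt_const.
  by move=> t Ht; apply: Hy0.
apply: Rminus_diag_uniq; apply: Rabs_eq_0.
apply: Rle_antisym; last exact: Rabs_pos.
apply: le_epsilon => e He; rewrite Rplus_0_l.
apply: Rle_trans (key (e / (2 * PI)) _) _; first by apply: Rdiv_lt_0_compat; lra.
by apply: Req_le; field; lra.
Qed.

(** Integration by parts in t: [S'] integrates to 0 by periodicity, and the product of Im g with a
    sine wave splits into [G0], whose mean is its value at the centre, and [G2], which vanishes at
    the centre. *)
Let first_harmonic x A (a b : R) : x < ln r ->
  RInt (fun t => (P x t - A) * (a * cos t + b * sin t)) 0 (2 * PI) = PI * exp x * Re ((a, b) * phi s0)%C.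
Proof.
move=> Hx; have [h Hh] := phiE_hol.
have e0 := exp_pos x.
pose G0 := fun w : C => ((a, b) * phi (E w))%C.
pose G2 := fun w : C => ((a, (- b)%R) * (phi (E w) * (cexp w * cexp w)))%C.
have [G0' H0] : exists G0', hol (fun w => Re w < ln r) G0 G0' by eexists; exact: hol_scal Hh.
have [G2' H2] : exists G2', hol (fun w => Re w < ln r) G2 G2'.
  eexists; apply: hol_scal; apply: hol_mult Hh _; exact: hol_mult (hol_cexp _) (hol_cexp _).
have M0 : RInt (fun t => Re (G0 (x, t))) 0 (2 * PI) = 2 * PI * Re ((a, b) * phi s0)%C.
  apply: (periodic_mean G0 G0' (ln r)) => //; first by move=> y; rewrite /G0 E_per.
  move=> e He.
  set K := Cmod (a, b) + 1; have HK : 0 < K by rewrite /K; have := Cmod_ge_0 (a, b); lra.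
  have [y0 H] := phiE_lim (e / K) ltac:(exact: Rdiv_lt_0_compat); exists y0 => w Hw.
  have -> : (G0 w - (a, b) * phi s0 = (a, b) * (phi (E w) - phi s0))%C by rewrite /G0; ring.
  rewrite Cmod_mult; have := H w Hw => /Rlt_div_r => /(_ HK).
  have := Cmod_ge_0 (phi (E w) - phi s0)%C; rewrite /K; nra.
have M2 : RInt (fun t => Re (G2 (x, t))) 0 (2 * PI) = 2 * PI * Re 0.
  apply: (periodic_mean G2 G2' (ln r)) => //; first by move=> y; rewrite /G2 E_per cexp_period.
  move=> e He.
  set K := Cmod (a, (- b)%R) + 1; have HK : 0 < K by rewrite /K; have := Cmod_ge_0 (a, (- b)%R); lra.
  have sm : forall w, Re w < 0 -> Cmod (phi (E w) * (cexp w * cexp w))%C <= Cmod (phi (E w)) * exp (Re w).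
    move=> w Hw; rewrite Cmod_mult (Cmod_mult (cexp w)) Cmod_cexp.
    apply: Rmult_le_compat_l; first exact: Cmod_ge_0.
    have := exp_pos (Re w); have : exp (Re w) < 1 by rewrite -exp_0; apply: exp_increasing.
    nra.
  have [y0 H] := small_lim (fun w => phi (E w) * (cexp w * cexp w))%C sm (e / K) ltac:(exact: Rdiv_lt_0_compat).
  exists y0 => w Hw.
  have -> : (G2 w - 0 = (a, (- b)%R) * (phi (E w) * (cexp w * cexp w) - 0))%C by rewrite /G2; ring.
  rewrite Cmod_mult; have := H w Hw => /Rlt_div_r => /(_ HK).
  have := Cmod_ge_0 (phi (E w) * (cexp w * cexp w) - 0)%C; rewrite /K; nra.
have int0 : ex_RInt (fun t => Re (G0 (x, t))) 0 (2 * PI).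
  by apply: ex_RInt_ccont => t _; apply: cderiv_ccont (proj1 (H0 (x, t) Hx)).
have int2 : ex_RInt (fun t => Re (G2 (x, t))) 0 (2 * PI).
  by apply: ex_RInt_ccont => t _; apply: cderiv_ccont (proj1 (H2 (x, t) Hx)).
pose S := fun t => (P x t - A) * (a * sin t - b * cos t).
pose S' := fun t => (P x t - A) * (a * cos t + b * sin t) - (exp x / 2 * Re (G0 (x, t)) - / (2 * exp x) * Re (G2 (x, t))).
have DS : forall t, is_derive S t (S' t).
  move=> t.
  have D1 : is_derive (fun t => P x t - A) t (- Im (g (x, t))).
    have := is_derive_minus _ _ _ _ _ (proj2 (Pd_x x t Hx)) (is_derive_const A t).
    by rewrite /minus /plus /opp /zero /= Ropp_0 Rplus_0_r.
  have D2 : is_derive (fun t => a * sin t - b * cos t) t (a * cos t + b * sin t).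
    by auto_derive => //; ring.
  suff Eq : - Im (g (x, t)) * (a * sin t - b * cos t) + (P x t - A) * (a * cos t + b * sin t) = S' t.
    by rewrite -Eq; exact: (is_derive_mult _ _ _ _ _ D1 D2 Rmult_comm).
  rewrite /S' /G0 /G2 /g.
  have -> : cexp (x, t) = ((exp x * cos t)%R, (exp x * sin t)%R) by [].
  have SC := sin2_cos2 t; rewrite /Rsqr in SC.
  move: (phi (E (x, t))) => [u v].
  have Re1 : Re ((a, b) * (u, v))%C = a * u - b * v by [].
  have Re2 : Re ((a, (- b)%R) * ((u, v) * (((exp x * cos t)%R, (exp x * sin t)%R) * ((exp x * cos t)%R, (exp x * sin t)%R))))%C =
    exp x * exp x * (a * (u * (cos t * cos t - sin t * sin t) - v * (2 * sin t * cos t)) + b * (u * (2 * sin t * cos t) + v * (cos t * cos t - sin t * sin t))).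
    by rewrite /=; ring.
  have Im1 : Im ((u, v) * ((exp x * cos t)%R, (exp x * sin t)%R))%C = exp x * (u * sin t + v * cos t) by rewrite /=; ring.
  rewrite Re1 Re2 Im1.
  have -> : / (2 * exp x) * (exp x * exp x * (a * (u * (cos t * cos t - sin t * sin t) - v * (2 * sin t * cos t)) + b * (u * (2 * sin t * cos t) + v * (cos t * cos t - sin t * sin t)))) =
   exp x / 2 * (a * (u * (cos t * cos t - sin t * sin t) - v * (2 * sin t * cos t)) + b * (u * (2 * sin t * cos t) + v * (cos t * cos t - sin t * sin t))) by field; lra.
  have -> : a * u - b * v = (a * u - b * v) * (sin t * sin t + cos t * cos t) by rewrite SC; ring.
  field.
have cS : forall t, continuous S' t.
  move=> t; apply: (continuous_minus (fun t => (P x t - A) * (a * cos t + b * sin t))).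
    apply: (continuous_mult (fun t => P x t - A)).
      apply: (continuous_minus (fun t => P x t)); last exact: continuous_const.
      exact: continuous_ex_derive (proj2 (Pd_x x t Hx)).
    by apply: (ex_derive_continuous (fun t => a * cos t + b * sin t)); auto_derive.
  apply: (continuous_minus (fun t => exp x / 2 * Re (G0 (x, t)))).
    apply: (continuous_scal_r (exp x / 2) (fun t => Re (G0 (x, t)))).
    exact: (proj1 (ccont_cont_v _ _ _ (cderiv_ccont _ _ _ (proj1 (H0 (x, t) Hx))))).
  apply: (continuous_scal_r (/ (2 * exp x)) (fun t => Re (G2 (x, t)))).
  exact: (proj1 (ccont_cont_v _ _ _ (cderiv_ccont _ _ _ (proj1 (H2 (x, t) Hx))))).
have I0 : RInt S' 0 (2 * PI) = 0.
  rewrite (is_RInt_unique _ _ _ _ (is_RInt_derive S S' 0 (2 * PI) (fun t _ => DS t) (fun t _ => cS t))).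
  rewrite /minus /plus /opp /= /S cos_2PI sin_2PI cos_0 sin_0 /P E_per; ring.
have intP : ex_RInt (fun t => (P x t - A) * (a * cos t + b * sin t)) 0 (2 * PI).
  apply: ex_RInt_continuous => t _.
  apply: (continuous_mult (fun t => P x t - A)).
    apply: (continuous_minus (fun t => P x t)); last exact: continuous_const.
    exact: continuous_ex_derive (proj2 (Pd_x x t Hx)).
  by apply: (ex_derive_continuous (fun t => a * cos t + b * sin t)); auto_derive.
have i0 := ex_RInt_Rscal _ (exp x / 2) _ _ int0.
have i2 := ex_RInt_Rscal _ (/ (2 * exp x)) _ _ int2.
move: I0; rewrite /S' -RInt_Rminus //; last exact: ex_RInt_Rminus.
rewrite -RInt_Rminus // !RInt_Rscal // M0 M2 /= => I0.
have : exp x / 2 * (2 * PI * Re ((a, b) * phi s0)%C) = PI * exp x * Re ((a, b) * phi s0)%C by field.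
rewrite /= in I0 *; lra.
Qed.

(** Since A - P is nonnegative and |a cos t + b sin t| <= 1, the first harmonic is at most the
    integral of A - P, which [P_mean] evaluates. The pair (a, b) rotates f' / f at s0 onto its
    modulus. *)
Lemma borel_caratheodory_circle (A x : R) : x < ln r -> (forall z, D z -> ln (Cmod (f z)) <= A) ->
  Cmod (f1 s0 / f s0)%C <= 2 / exp x * (A - ln (Cmod (f s0))).
Proof.
move=> Hx HA.
have P0 := PI_RGT_0; have e0 := exp_pos x.
have [[a b] [Hk Ek]] := Cmod_unit_rotation (phi s0).
rewrite -/(phi s0) -Ek.
have H1 := first_harmonic x A a b Hx.
have ab : a * a + b * b <= 1.
  have : Cmod (a, b) ^ 2 <= 1 ^ 2 by apply: pow_incr; split; first exact: Cmod_ge_0.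
  rewrite Cmod2_alt /=; lra.
have intP : ex_RInt (fun t => P x t) 0 (2 * PI) by apply: P_int.
have I1 : ex_RInt (fun t => A - P x t) 0 (2 * PI) by apply: ex_RInt_Rminus => //; exact: ex_RInt_const.
have B : RInt (fun t => (P x t - A) * (a * cos t + b * sin t)) 0 (2 * PI) <= RInt (fun t => A - P x t) 0 (2 * PI).
  apply: RInt_le => //; first lra.
    apply: ex_RInt_continuous => t _.
    apply: (continuous_mult (fun t => P x t - A)).
      apply: (continuous_minus (fun t => P x t)); last exact: continuous_const.
      exact: continuous_ex_derive (proj2 (Pd_x x t Hx)).
    by apply: (ex_derive_continuous (fun t => a * cos t + b * sin t)); auto_derive.
  move=> t _.
  have N : P x t <= A by apply: HA; apply: E_in.
  have SC := sin2_cos2 t; rewrite /Rsqr in SC.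
  have : -1 <= a * cos t + b * sin t <= 1.
    have : (a * cos t + b * sin t) * (a * cos t + b * sin t) <= 1.
      have : (a * cos t + b * sin t) * (a * cos t + b * sin t) + (a * sin t - b * cos t) * (a * sin t - b * cos t) = (a * a + b * b) * (sin t * sin t + cos t * cos t) by ring.
      rewrite SC; have := Rle_0_sqr (a * sin t - b * cos t); rewrite /Rsqr; lra.
    move: (_ + _) => y Hy; split; nra.
  move: (_ + _) => y Hy; nra.
rewrite H1 -RInt_Rminus // in B; last exact: ex_RInt_const.
rewrite RInt_const P_mean // /scal /= /mult /= in B.
rewrite -/(Re _) in B *.
have B2 : PI * exp x * Re ((a, b) * phi s0)%C <= 2 * PI * (A - ln (Cmod (f s0))).
  apply: Rle_trans B _; apply: Req_le; ring.
apply: (Rmult_le_reg_l (PI * exp x)); first exact: Rmult_lt_0_compat.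
apply: Rle_trans B2 _; apply: Req_le; field; lra.
Qed.

End BorelCaratheodory.

(** * The logarithmic derivative to the right of the critical line *)

(** The circle of the previous bound lies strictly inside the disc; its radius now tends to r. *)
Lemma borel_caratheodory (f f1 f2 : C -> C) (s0 : C) (r A : R) : 0 < r ->
  hol (fun z => Cmod (z - s0) < r) f f1 -> hol (fun z => Cmod (z - s0) < r) f1 f2 ->
  (forall z, Cmod (z - s0) < r -> f z <> 0%C) ->
  (forall z, Cmod (z - s0) < r -> ln (Cmod (f z)) <= A) ->
  Cmod (f1 s0 / f s0)%C <= 2 / r * (A - ln (Cmod (f s0))).
Proof.
move=> Hr H H1 N HA; set p := Cmod _; set B := A - _.
have p0 : 0 <= p by apply: Cmod_ge_0.
have key : forall r', 0 < r' < r -> p * r' <= 2 * B.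
  move=> r' Hr'.
  have := borel_caratheodory_circle f f1 f2 s0 r Hr H H1 N A (ln r') ltac:(apply: ln_increasing; lra) HA.
  rewrite exp_ln; last lra. rewrite -/p -/B => K.
  have -> : 2 * B = 2 / r' * B * r' by field; lra.
  apply: Rmult_le_compat_r K; lra.
have : p * r <= 2 * B.
  apply: le_epsilon => e He.
  set d := Rmin (r / 2) (e / (p + 1)).
  have d0 : 0 < d by apply: Rmin_glb_lt; [lra | apply: Rdiv_lt_0_compat; lra].
  have d1 : d <= r / 2 by apply: Rmin_l.
  have d2 : d * (p + 1) <= e.
    have : d <= e / (p + 1) by apply: Rmin_r.
    by move=> /Rle_div_r; apply; lra.
  have := key (r - d) ltac:(lra); nra.
move=> K; have -> : 2 / r * B = 2 * B / r by field; lra.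
by apply/Rle_div_r.
Qed.

Lemma pow_le_exp (n : nat) (y : R) : 0 <= y -> (1 + y) ^ n <= exp (INR n * y).
Proof.
move=> Hy; elim: n => [|n IH]; first by rewrite /= Rmult_0_l exp_0; lra.
have -> : INR n.+1 * y = INR n * y + y by rewrite S_INR; ring.
rewrite exp_plus /= Rmult_comm; apply: Rmult_le_compat => //; [apply: pow_le; lra | lra | exact: exp_ineq1_le].
Qed.

Lemma ln_36 : ln 36 <= 4.
Proof.
rewrite -(ln_exp 4); apply: ln_le; first lra.
have := pow_le_exp 32 (/ 8) ltac:(lra).
have -> : INR 32 * / 8 = 4 by rewrite /=; field.
lra.
Qed.

(** Dominates A - ln |Zs (2 + i t)| in the next lemma: 4 replaces ln 36 = ln 9 + ln 4, where 9 comes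
    from [Zs_bound] and 4 from [zeta_near_1]. *)
Definition growth (t : R) : R := 2 * ln (Rabs t + 5) + 4.

(** Borel-Caratheodory at (y, t) needs a lower bound for |Zs| there, which is clear only at y = 2.
    It is carried to the left by a differential inequality: the derivative of v is at least - 2 v /
    (y - 1/2), so v (y - 1/2)^2 increases. A second use of Borel-Caratheodory, at x, concludes. *)
Lemma Zs_logderiv_bound (RH : RiemannHypothesis) (x t : R) : 11 / 20 <= x <= 2 ->
  Cmod (Zs1 (x, t) / Zs (x, t))%C <= 36000 * growth t.
Proof.
move=> Hx.
have T0 := Rabs_pos t.
(* A point of a disc of radius at most 3/2 about (y, t), y <= 2, has modulus at most |t| + 7/2;
   hence |z| + 8 |z| |z - 1| <= 9 (|t| + 9/2)^2. *)
set A := ln 9 + 2 * ln (Rabs t + 9 / 2).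
pose v := fun y => A - ln (Cmod (Zs (y, t))).
have N : forall y, / 2 < y -> Zs (y, t) <> 0%C by move=> y Hy; apply: Zs_neq0.
have Bound : forall z : C, / 2 < Re z -> Cmod z <= Rabs t + 7 / 2 -> ln (Cmod (Zs z)) <= A.
  move=> z Hz Hm.
  have Nz := Zs_neq0 RH z Hz; have Pz := proj1 (Cmod_gt_0 _) Nz.
  have -> : A = ln (9 * ((Rabs t + 9 / 2) * (Rabs t + 9 / 2))).
    by rewrite ln_mult; [|lra|nra]; rewrite ln_mult; [|lra|lra]; rewrite /A; ring.
  apply: ln_le => //.
  apply: Rle_trans (Zs_bound z ltac:(lra)) _.
  have Q : Cmod (z - 1)%C <= Rabs t + 9 / 2.
    by have := Cmod_triangle_minus z 1; rewrite Cmod_1; lra.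
  have Z0 := Cmod_ge_0 z.
  have : Cmod z * Cmod (z - 1)%C <= (Rabs t + 9 / 2) * (Rabs t + 9 / 2).
    apply: Rmult_le_compat => //; [exact: Cmod_ge_0 | lra].
  nra.
have BC : forall y, / 2 < y <= 2 -> Cmod (Zs1 (y, t) / Zs (y, t))%C <= 2 / (y - / 2) * v y.
  move=> y Hy.
  have In : forall z : C, Cmod (z - (y, t))%C < y - / 2 -> / 2 < Re z.
    move=> z Hz; have := re_le_Cmod (z - (y, t))%C; rewrite Re_minus => /Rabs_le_between /=; lra.
  apply: (borel_caratheodory Zs Zs1 Zs2); first lra.
  - by apply: hol_sub hol_Zs => z Hz; rewrite /Dz; have := In z Hz; lra.
  - by apply: hol_sub hol_Zs1 => z Hz; rewrite /Dz; have := In z Hz; lra.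
  - by move=> z Hz; apply: Zs_neq0 => //; exact: In.
  - move=> z Hz; apply: Bound; first exact: In.
    have M1 : Cmod (y, t) <= 2 + Rabs t.
      by apply: Rle_trans (Cmod_le_re_im _) _; rewrite /= Rabs_pos_eq; lra.
    have := Cmod_triangle (z - (y, t))%C (y, t).
    have -> : (z - (y, t) + (y, t) = z)%C by ring.
    lra.
have Dv : forall y, / 2 < y -> is_derive v y (- Re (Zs1 (y, t) / Zs (y, t))%C).
  move=> y Hy.
  have := is_derive_ln_Cmod_re Zs y t _ (proj1 (hol_Zs (y, t) ltac:(rewrite /Dz /=; lra))) (N y Hy).
  move=> D; have := is_derive_minus _ _ _ _ _ (is_derive_const A y) D.
  by rewrite /minus /plus /opp /zero /= Rplus_0_l.
(* The exponent 2 is the constant of Borel-Caratheodory. *)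
have mono : v x * (x - / 2) ^ 2 <= v 2 * (2 - / 2) ^ 2.
  apply: (deriv_nonneg (fun y => v y * (y - / 2) ^ 2) (fun y => - Re (Zs1 (y, t) / Zs (y, t))%C * (y - / 2) ^ 2 + v y * (2 * (y - / 2)))); first lra.
    move=> y Hy.
    have D2 : is_derive (fun y => (y - / 2) ^ 2) y (2 * (y - / 2)) by auto_derive => //; ring.
    exact: (is_derive_mult _ _ _ _ _ (Dv y ltac:(lra)) D2 Rmult_comm).
  move=> y Hy.
  have B := BC y ltac:(lra).
  have := re_le_Cmod (Zs1 (y, t) / Zs (y, t))%C => /Rabs_le_between [_ R1].
  have K : Re (Zs1 (y, t) / Zs (y, t))%C * (y - / 2) <= 2 * v y.
    have -> : 2 * v y = 2 / (y - / 2) * v y * (y - / 2) by field; lra.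
    apply: Rmult_le_compat_r; lra.
  have -> : - Re (Zs1 (y, t) / Zs (y, t))%C * (y - / 2) ^ 2 + v y * (2 * (y - / 2)) =
    (y - / 2) * (2 * v y - Re (Zs1 (y, t) / Zs (y, t))%C * (y - / 2)) by ring.
  apply: Rmult_le_pos; lra.
have v2 : v 2 <= growth t.
  have Z2 : / 4 <= Cmod (Zs (2, t)).
    have H1 : ((2, t) - 1)%C <> 0%C by move=> [] ? _; lra.
    have -> : Zs (2, t) = (zeta (2, t) * ((2, t) - 1))%C by rewrite /zeta; field.
    rewrite Cmod_mult.
    have Q := zeta_near_1 (2, t) ltac:(rewrite /=; lra).
    have Q2 : 1 <= Cmod ((2, t) - 1)%C.
      apply: Rle_trans (re_le_Cmod _); rewrite Re_minus /= Rabs_pos_eq; lra.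
    nra.
  have L4 : - ln 4 <= ln (Cmod (Zs (2, t))).
    by rewrite -ln_Rinv; [apply: ln_le; lra | lra].
  have L36 := ln_36.
  have E36 : ln 36 = ln 9 + ln 4 by rewrite -ln_mult; [congr ln; ring | lra | lra].
  have : ln (Rabs t + 9 / 2) <= ln (Rabs t + 5) by apply: ln_le; lra.
  rewrite /v /A /growth; lra.
have g0 : 0 <= growth t.
  have : 0 <= ln (Rabs t + 5) by rewrite -ln_1; apply: ln_le; lra.
  rewrite /growth; lra.
apply: Rle_trans (BC x ltac:(lra)) _.
set d := x - / 2 in mono *.
have Hd : / 20 <= d by rewrite /d; lra.
have V : v x <= 9 / 4 * growth t / d ^ 2.
  apply/Rle_div_r; first by apply: pow_lt; lra.
  apply: Rle_trans mono _; nra.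
have I : / d <= 20 by rewrite -(Rinv_inv 20); apply: Rinv_le_contravar; lra.
have I0 : 0 < / d by apply: Rinv_0_lt_compat; lra.
apply: (Rle_trans _ (2 / d * (9 / 4 * growth t / d ^ 2))).
  apply: Rmult_le_compat_l V; rewrite /Rdiv; lra.
(* Here d >= 1/20, and 9/2 * 20^3 = 36000. *)
have -> : 2 / d * (9 / 4 * growth t / d ^ 2) = 9 / 2 * growth t * (/ d) ^ 3 by field; lra.
have : (/ d) ^ 3 <= 20 ^ 3 by apply: pow_incr; lra.
nra.
Qed.

(** * Perron's formula *)

Lemma Cmod_inv_sqr_le (T : R) (s : C) : 0 < T -> T <= Cmod s -> Cmod (/ (s * s)) <= / T ^ 2.
Proof.
move=> HT Hs.
have N : s <> 0%C by apply/Cmod_gt_0; lra.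
rewrite Cmod_inv ?Cmod_mult; last exact: Cmult_neq_0.
apply: Rinv_le_contravar; nra.
Qed.

(* Perron's kernel [x^s / s^2] at [x = exp u]. *)
Definition Kp (u : R) (s : C) : C := (cexp (s * RtoC u) * / (s * s))%C.

Lemma hol_Kp u : exists K', hol (fun s => 0 < Re s) (Kp u) K'.
Proof.
eexists; apply: hol_mult; first exact: hol_cexp_lin.
apply: hol_inv; last by apply: hol_mult; exact: hol_id.
by move=> s Hs; apply: Cmult_neq_0 => E; rewrite E /= in Hs; lra.
Qed.

Lemma Cmod_Kp u s T : 0 < T -> T <= Cmod s -> Cmod (Kp u s) <= exp (Re s * u) / T ^ 2.
Proof.
move=> HT Hs; rewrite /Kp Cmod_mult Cmod_cexp.
have -> : Re (s * RtoC u) = Re s * u by case: (s) => a b /=; ring.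
apply: Rmult_le_compat_l; first by apply: Rlt_le; exact: exp_pos.
exact: Cmod_inv_sqr_le.
Qed.

Lemma Rabs_le_Cmod_pair (x t : R) : Rabs t <= Cmod (x, t).
Proof. exact: (im_le_Cmod (x, t)). Qed.

Lemma Rabs_le_Cmod_pair1 (x t : R) : Rabs x <= Cmod (x, t).
Proof. exact: (re_le_Cmod (x, t)). Qed.

Definition vint (f : C -> C) (x T : R) : R := RInt (fun t => Re (f (x, t))) (- T) T.

Lemma vint_shift (f f' : C -> C) (a x1 x2 T M : R) : hol (fun s => a < Re s) f f' -> a < x1 -> x1 <= x2 ->
  (forall x, x1 <= x <= x2 -> Cmod (f (x, T)) <= M /\ Cmod (f (x, - T)) <= M) ->
  Rabs (vint f x2 T - vint f x1 T) <= 2 * M * (x2 - x1).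
Proof.
move=> Hf H1 H12 HM.
apply: (vertical_shift_bound f f' a (x2 + 1)) => //; last 1 first.
- move=> x Hx; have [A B] := HM x Hx.
  have := im_le_Cmod (f (x, T)); have := im_le_Cmod (f (x, - T)).
  have := Rabs_triang (Im (f (x, T))) (- Im (f (x, - T))); rewrite Rabs_Ropp /Rminus; lra.
- by apply: hol_sub Hf => s [].
- lra.
Qed.

Lemma vint_bound (f f' : C -> C) (a x T M : R) : hol (fun s => a < Re s) f f' -> a < x -> 0 <= T ->
  (forall t, - T <= t <= T -> Cmod (f (x, t)) <= M) -> Rabs (vint f x T) <= 2 * T * M.
Proof.
move=> Hf Hx HT HM.
have -> : 2 * T * M = (T - - T) * M by ring.
apply: abs_RInt_le_const; first lra.
  by apply: ex_RInt_ccont => t _; apply: cderiv_ccont (proj1 (Hf (x, t) Hx)).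
by move=> t Ht; apply: Rle_trans (HM t Ht); exact: re_le_Cmod.
Qed.

(* For u <= 0 the line of integration is pushed to the right by T. *)
Lemma perron_neg c u T : 0 < c -> u <= 0 -> 0 < T -> Rabs (vint (Kp u) c T) <= 4 * exp (c * u) / T.
Proof.
move=> Hc Hu HT; have [K' HK] := hol_Kp u.
have e0 := exp_pos (c * u).
have A : Rabs (vint (Kp u) (c + T) T - vint (Kp u) c T) <= 2 * (exp (c * u) / T ^ 2) * (c + T - c).
  apply: (vint_shift _ _ 0 _ _ _ _ HK) => //; first lra.
  have H : forall x t, c <= x -> Rabs t = T -> Cmod (Kp u (x, t)) <= exp (c * u) / T ^ 2.
    move=> x t Hx Ht; apply: Rle_trans (Cmod_Kp u (x, t) T HT _) _.
      by rewrite -Ht; exact: Rabs_le_Cmod_pair.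
    apply: Rmult_le_compat_r; first by apply: Rlt_le; apply: Rinv_0_lt_compat; apply: pow_lt.
    apply: exp_mono; rewrite /=; nra.
  move=> x Hx; split; apply: H; rewrite ?Rabs_Ropp ?Rabs_pos_eq; lra.
have B : Rabs (vint (Kp u) (c + T) T) <= 2 * T * (exp (c * u) / T ^ 2).
  apply: (vint_bound _ _ 0 _ _ _ HK); [lra | lra | move=> t _].
  apply: Rle_trans (Cmod_Kp u (c + T, t) T HT _) _.
    apply: Rle_trans (Rabs_le_Cmod_pair1 _ _); rewrite Rabs_pos_eq; lra.
  apply: Rmult_le_compat_r; first by apply: Rlt_le; apply: Rinv_0_lt_compat; apply: pow_lt.
  apply: exp_mono; rewrite /=; nra.
have E1 : 2 * (exp (c * u) / T ^ 2) * (c + T - c) = 2 * exp (c * u) / T by field; lra.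
have E2 : 2 * T * (exp (c * u) / T ^ 2) = 2 * exp (c * u) / T by field; lra.
have -> : 4 * exp (c * u) / T = 2 * exp (c * u) / T + 2 * exp (c * u) / T by field; lra.
have := Rabs_triang (- (vint (Kp u) (c + T) T - vint (Kp u) c T)) (vint (Kp u) (c + T) T).
rewrite Rabs_Ropp.
have -> : - (vint (Kp u) (c + T) T - vint (Kp u) c T) + vint (Kp u) (c + T) T = vint (Kp u) c T by ring.
lra.
Qed.

Lemma sinh_bounds a : 0 <= a <= / 2 -> 0 <= (exp a + exp (- a)) / 2 - 1 <= 2 * a ^ 2 /\
  0 <= (exp a - exp (- a)) / 2 - a <= 2 * a ^ 3.
Proof.
have C1 : forall b, 0 <= b <= / 2 -> 0 <= (exp b + exp (- b)) / 2 - 1 <= 2 * b ^ 2.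
  move=> b Hb.
  have A := exp_taylor1 b ltac:(rewrite Rabs_pos_eq; lra).
  have B := exp_taylor1 (- b) ltac:(rewrite Rabs_Ropp Rabs_pos_eq; lra).
  have : (- b) ^ 2 = b ^ 2 by ring.
  lra.
move=> Ha; split; first exact: C1.
pose f := fun x => (exp x - exp (- x)) / 2 - x.
have D : forall x, is_derive f x ((exp x + exp (- x)) / 2 - 1).
  by move=> x; rewrite /f; auto_derive => //; field.
have f0 : f 0 = 0 by rewrite /f Ropp_0; field.
split.
  rewrite -f0; apply: (deriv_nonneg f _ 0 a (proj1 Ha)) => [x _|x Hx]; first exact: D.
  by case: (C1 x ltac:(lra)).
have := deriv_bound f _ 0 a (2 * a ^ 2) (proj1 Ha) (fun x _ => D x).
rewrite f0 !Rminus_0_r => H.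
have : Rabs (f a) <= 2 * a ^ 2 * a.
  apply: H => x Hx; have [A B] := C1 x ltac:(lra).
  rewrite Rabs_pos_eq //; nra.
move=> /Rabs_le_between [_ H2]; rewrite /f in H2; nra.
Qed.

(* The odd function (2 sinh z - 2 z) / z ^ 2 is purely imaginary on the imaginary axis. *)
Lemma sinh_kernel_bound (a b : R) : 0 < a <= / 2 ->
  Rabs (Re ((cexp (a, b) - cexp (- (a, b)) - 2 * (a, b)) / ((a, b) * (a, b)))%C) <= 12 * a.
Proof.
move=> Ha.
have [[Ch0 Ch1] [Sh0 Sh1]] := sinh_bounds a ltac:(lra).
set ch := (exp a + exp (- a)) / 2 in Ch0 Ch1; set sh := (exp a - exp (- a)) / 2 in Sh0 Sh1.
set n := a ^ 2 + b ^ 2.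
have n0 : 0 < n by rewrite /n; nra.
set X := 2 * (sh * cos b - a); set Y := 2 * (ch * sin b - b).
have E : Re ((cexp (a, b) - cexp (- (a, b)) - 2 * (a, b)) / ((a, b) * (a, b)))%C = (X * (a ^ 2 - b ^ 2) + Y * (2 * a * b)) / n ^ 2.
  rewrite /cexp /= cos_neg sin_neg /X /Y /sh /ch /n; field.
  have n2 : 0 < n ^ 2 by apply: pow_lt.
  have -> : (a * a - b * b) * (a * a - b * b) + (a * b + b * a) * (a * b + b * a) = n ^ 2 by rewrite /n; ring.
  by split; apply: Rgt_not_eq.
rewrite E.
have c1 := Rabs_cos_minus_1 b; have s1 := Rabs_sin_minus b; have s2 := Rabs_sin_le b.
have b0 := Rabs_pos b.
have b2 : Rabs b ^ 2 = b ^ 2 by rewrite pow2_abs.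
have HX : Rabs X <= 4 * a * n.
  have -> : X = 2 * (sh - a) + 2 * sh * (cos b - 1) by rewrite /X; ring.
  apply: Rle_trans (Rabs_triang _ _) _.
  rewrite (Rabs_pos_eq (2 * (sh - a))); last lra.
  rewrite Rabs_mult (Rabs_pos_eq (2 * sh)); last lra.
  have : 2 * sh * Rabs (cos b - 1) <= 2 * (3 / 2 * a) * (b ^ 2 / 2).
    apply: Rmult_le_compat; [lra | exact: Rabs_pos | nra | done].
  have : 0 <= a * b ^ 2 by apply: Rmult_le_pos; [lra | exact: pow2_ge_0].
  have : 4 * a * n = 4 * a ^ 3 + 4 * (a * b ^ 2) by rewrite /n; ring.
  lra.
have HY : Rabs Y <= 4 * Rabs b * n.
  have -> : Y = 2 * (ch - 1) * sin b + 2 * (sin b - b) by rewrite /Y; ring.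
  apply: Rle_trans (Rabs_triang _ _) _.
  rewrite Rabs_mult (Rabs_pos_eq (2 * (ch - 1))); last lra.
  rewrite Rabs_mult (Rabs_pos_eq 2); last lra.
  have : 2 * (ch - 1) * Rabs (sin b) <= 2 * (2 * a ^ 2) * Rabs b.
    apply: Rmult_le_compat; [lra | exact: Rabs_pos | lra | done].
  have : Rabs b ^ 3 = Rabs b * b ^ 2 by rewrite -b2; ring.
  have : 0 <= Rabs b * b ^ 2 by apply: Rmult_le_pos => //; exact: pow2_ge_0.
  have : 4 * Rabs b * n = 4 * (Rabs b * a ^ 2) + 4 * (Rabs b * b ^ 2) by rewrite /n; ring.
  lra.
rewrite /Rdiv Rabs_mult (Rabs_pos_eq (/ _)); last by apply: Rlt_le; apply: Rinv_0_lt_compat; apply: pow_lt.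
apply/Rle_div_l; first exact: pow_lt.
apply: Rle_trans (Rabs_triang _ _) _; rewrite (Rabs_mult X) (Rabs_mult Y) (Rabs_mult (2 * a)) (Rabs_pos_eq (2 * a)); last lra.
have D1 : Rabs (a ^ 2 - b ^ 2) <= n by apply: Rabs_le; rewrite /n; nra.
have T1 : Rabs X * Rabs (a ^ 2 - b ^ 2) <= 4 * a * n * n.
  by apply: Rmult_le_compat => //; exact: Rabs_pos.
have T2 : Rabs Y * (2 * a * Rabs b) <= 4 * Rabs b * n * (2 * a * Rabs b).
  apply: Rmult_le_compat_r => //; nra.
have E3 : 4 * Rabs b * n * (2 * a * Rabs b) = 8 * a * n * b ^ 2 by rewrite -b2; ring.
have : 8 * a * n * b ^ 2 <= 8 * a * n * n.
  apply: Rmult_le_compat_l; rewrite /n; nra.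
lra.
Qed.

Lemma atan_le x : 0 <= x -> atan x <= x.
Proof.
move=> Hx.
have := deriv_nonneg (fun y => y - atan y) (fun y => 1 - / (1 + y ^ 2)) 0 x Hx.
rewrite atan_0 => H.
have : 0 - 0 <= x - atan x.
  apply: H => y Hy.
    by auto_derive => //; rewrite /Rsqr /=; field; nra.
  have : / (1 + y ^ 2) <= / 1 by apply: Rinv_le_contravar; nra.
  rewrite Rinv_1; lra.
lra.
Qed.

Lemma RInt_poisson c T : 0 < c -> 0 < T ->
  RInt (fun t => c / (c ^ 2 + t ^ 2)) (- T) T = 2 * atan (T / c) /\ ex_RInt (fun t => c / (c ^ 2 + t ^ 2)) (- T) T.
Proof.
move=> Hc HT.
have K : is_RInt (fun t => c / (c ^ 2 + t ^ 2)) (- T) T (minus (atan (T / c)) (atan (- T / c))).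
  apply: (is_RInt_derive (fun t => atan (t / c))) => t _.
    by auto_derive => //; rewrite /Rsqr /=; field; split; nra.
  by apply: (ex_derive_continuous (fun t => c / (c ^ 2 + t ^ 2))); auto_derive; nra.
split; last by eexists; exact: K.
rewrite (is_RInt_unique _ _ _ _ K) /minus /plus /opp /=.
have -> : - T / c = - (T / c) by field; lra.
rewrite atan_opp; ring.
Qed.

(** No residue is taken at 0. The line is moved to c0 near 0; there Kp u - Kp (- u) - 2 u / s has a
    real part of size O(c0), Kp (- u) falls under [perron_neg], and Re (2 u / s) is a Poisson kernel
    with integral 4 u atan (T / c0), close to 2 PI u. The errors that depend on c0 add up to c0 *
    q. *)
Lemma perron_pos c u T : 0 < c -> 0 < u -> 0 < T ->
  Rabs (vint (Kp u) c T - 2 * PI * u) <= 2 * c * exp (c * u) / T ^ 2 + 4 / T.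
Proof.
move=> Hc Hu HT; apply: le_epsilon => e He.
have P0 := PI_RGT_0.
set q := 24 * T * u ^ 3 + 4 * u / T.
have q0 : 0 < q.
  have : 0 < u ^ 3 by apply: pow_lt.
  have : 0 < 4 * u / T by apply: Rdiv_lt_0_compat; lra.
  rewrite /q; nra.
have [c0 [C0 [C1 [C2 C3]]]] : exists c0, 0 < c0 /\ c0 <= c /\ c0 * u <= / 2 /\ c0 * q <= e.
  exists (Rmin c (Rmin (/ 2 / u) (e / q))).
  have A := Rmin_l c (Rmin (/ 2 / u) (e / q)); have B := Rmin_r c (Rmin (/ 2 / u) (e / q)).
  have A' := Rmin_l (/ 2 / u) (e / q); have B' := Rmin_r (/ 2 / u) (e / q).
  split.
    by apply: Rmin_glb_lt => //; apply: Rmin_glb_lt; apply: Rdiv_lt_0_compat; lra.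
  split; first lra.
  by split; apply/Rle_div_r; lra.
have [K' HK] := hol_Kp u; have [K2' HK2] := hol_Kp (- u).
have S1 : Rabs (vint (Kp u) c T - vint (Kp u) c0 T) <= 2 * (exp (c * u) / T ^ 2) * (c - c0).
  apply: (vint_shift _ _ 0 _ _ _ _ HK) => //.
  have H : forall x t, x <= c -> Rabs t = T -> Cmod (Kp u (x, t)) <= exp (c * u) / T ^ 2.
    move=> x t Hx Ht; apply: Rle_trans (Cmod_Kp u (x, t) T HT _) _.
      by rewrite -Ht; exact: Rabs_le_Cmod_pair.
    apply: Rmult_le_compat_r; first by apply: Rlt_le; apply: Rinv_0_lt_compat; apply: pow_lt.
    apply: exp_mono; rewrite /=; nra.
  move=> x Hx; split; apply: H; rewrite ?Rabs_Ropp ?Rabs_pos_eq; lra.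
have S2 := perron_neg c0 (- u) T C0 ltac:(lra) HT.
have S2' : 4 * exp (c0 * - u) / T <= 4 / T.
  apply: Rmult_le_compat_r; first by apply: Rlt_le; apply: Rinv_0_lt_compat.
  have : exp (c0 * - u) <= 1 by rewrite -exp_0; apply: exp_mono; nra.
  lra.
have [PI1 PI2] := RInt_poisson c0 T C0 HT.
have i1 : ex_RInt (fun t => Re (Kp u (c0, t))) (- T) T.
  by apply: ex_RInt_ccont => t _; apply: cderiv_ccont (proj1 (HK (c0, t) C0)).
have i2 : ex_RInt (fun t => Re (Kp (- u) (c0, t))) (- T) T.
  by apply: ex_RInt_ccont => t _; apply: cderiv_ccont (proj1 (HK2 (c0, t) C0)).
have i3 := ex_RInt_Rscal _ (2 * u) _ _ PI2.
have i4 := ex_RInt_Rminus _ _ _ _ i1 i2.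
have S3 : Rabs (vint (Kp u) c0 T - vint (Kp (- u)) c0 T - 2 * u * (2 * atan (T / c0))) <= (T - - T) * (12 * u ^ 3 * c0).
  rewrite -PI1 /vint RInt_Rminus // -RInt_Rscal // RInt_Rminus //.
  apply: abs_RInt_le_const; [lra | exact: ex_RInt_Rminus | move=> t _].
  have H := sinh_kernel_bound (c0 * u) (t * u) ltac:(nra).
  have n0 : 0 < c0 ^ 2 + t ^ 2 by nra.
  have s0 : (c0, t) <> RtoC 0 by move=> [] ?; lra.
  have u0 : RtoC u <> RtoC 0 by move=> [] ?; lra.
  have Ez : ((c0 * u)%R, (t * u)%R) = ((c0, t) * RtoC u)%C by apply: injective_projections; rewrite /=; ring.
  have Einv : c0 / (c0 ^ 2 + t ^ 2) = Re (/ (c0, t))%C by rewrite /=; field; lra.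
  have -> : Re (Kp u (c0, t)) - Re (Kp (- u) (c0, t)) - 2 * u * (c0 / (c0 ^ 2 + t ^ 2)) =
    u ^ 2 * Re ((cexp ((c0 * u)%R, (t * u)%R) - cexp (- ((c0 * u)%R, (t * u)%R)) - 2 * ((c0 * u)%R, (t * u)%R)) / (((c0 * u)%R, (t * u)%R) * ((c0 * u)%R, (t * u)%R)))%C.
    rewrite Einv -!Re_scal -!Re_minus; congr Re; rewrite /Kp Ez.
    have -> : ((c0, t) * RtoC (- u) = - ((c0, t) * RtoC u))%C by rewrite RtoC_opp; ring.
    have -> : RtoC (u ^ 2) = (RtoC u * RtoC u)%C by rewrite -RtoC_mult; congr RtoC; ring.
    have -> : RtoC (2 * u) = (2 * RtoC u)%C by rewrite RtoC_mult.
    move: (cexp _) (cexp _) s0 u0 => x y; move: (c0, t) (RtoC u) => s w s0 u0.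
    by field.
  rewrite Rabs_mult (Rabs_pos_eq (u ^ 2)); last exact: pow2_ge_0.
  have -> : 12 * u ^ 3 * c0 = u ^ 2 * (12 * (c0 * u)) by ring.
  apply: Rmult_le_compat_l => //; exact: pow2_ge_0.
have tc : 0 < T / c0 by apply: Rdiv_lt_0_compat.
have AT : PI / 2 - c0 / T <= atan (T / c0) <= PI / 2.
  have := atan_inv (T / c0) tc.
  have -> : / (T / c0) = c0 / T by field; lra.
  have := atan_le (c0 / T) ltac:(apply: Rlt_le; exact: Rdiv_lt_0_compat).
  have := atan_bound (T / c0); lra.
have S4 : Rabs (2 * u * (2 * atan (T / c0)) - 2 * PI * u) <= c0 * (4 * u / T).
  have -> : c0 * (4 * u / T) = 4 * u * (c0 / T) by field; lra.
  apply: Rabs_le; nra.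
have E1 : 2 * (exp (c * u) / T ^ 2) * (c - c0) <= 2 * c * exp (c * u) / T ^ 2.
  have -> : 2 * c * exp (c * u) / T ^ 2 = 2 * (exp (c * u) / T ^ 2) * c by field; lra.
  apply: Rmult_le_compat_l; last lra.
  have : 0 < exp (c * u) / T ^ 2 by apply: Rdiv_lt_0_compat; [exact: exp_pos | exact: pow_lt].
  lra.
have E2 : (T - - T) * (12 * u ^ 3 * c0) + c0 * (4 * u / T) = c0 * q by rewrite /q; ring.
have -> : vint (Kp u) c T - 2 * PI * u = (vint (Kp u) c T - vint (Kp u) c0 T) +
  ((vint (Kp u) c0 T - vint (Kp (- u)) c0 T - 2 * u * (2 * atan (T / c0))) +
  (vint (Kp (- u)) c0 T + (2 * u * (2 * atan (T / c0)) - 2 * PI * u))) by ring.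
move: S1 S2 S3 S4 => /Rabs_le_between S1 /Rabs_le_between S2 /Rabs_le_between S3 /Rabs_le_between S4.
apply: Rabs_le; lra.
Qed.

(** * The contribution of the pole of zeta to Perron's formula *)

Definition Wp (s : C) : C := (/ (s * s * (s - 1)))%C.
(** Perron's kernel times 1 / (s - 1), the polar part of - zeta' / zeta at 1. *)
Definition Qp (u : R) (s : C) : C := (cexp (s * RtoC u) * Wp s)%C.

Lemma Wp_den (s : C) : 1 < Re s -> (s * s * (s - 1))%C <> 0%C.
Proof.
move=> Hs; apply: Cmult_neq_0; first by apply: Cmult_neq_0 => E; rewrite E /= in Hs; lra.
apply: Cminus_eq_contra => E; rewrite E /= in Hs; lra.
Qed.

Lemma hol_Wp : exists W', hol (fun s => 1 < Re s) Wp W'.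
Proof.
eexists; apply: hol_inv; first by move=> s Hs; exact: Wp_den.
apply: hol_mult; first by apply: hol_mult; exact: hol_id.
by apply: hol_plus; [exact: hol_id | exact: hol_const].
Qed.

Lemma hol_Qp u : exists Q', hol (fun s => 1 < Re s) (Qp u) Q'.
Proof. have [W' H] := hol_Wp; eexists; apply: hol_mult H; exact: hol_cexp_lin. Qed.

Lemma Qp0_bound T : 1 <= T -> Rabs (vint (Qp 0) 2 T) <= 4 / T.
Proof.
move=> HT; have [Q' HQ] := hol_Qp 0.
have B : forall s, 2 <= Re s -> T <= Cmod s -> Cmod (Qp 0 s) <= / T ^ 2.
  move=> s Hs Ms; rewrite /Qp Cmult_0_r cexp_0 Cmult_1_l /Wp.
  have s0 : s <> 0%C by apply/Cmod_gt_0; lra.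
  have s1 : (s - 1)%C <> 0%C by apply: Cminus_eq_contra => E; rewrite E /= in Hs; lra.
  have -> : (/ (s * s * (s - 1)) = / (s * s) * / (s - 1))%C by field.
  rewrite Cmod_mult.
  have P := Cmod_inv_sqr_le T s ltac:(lra) Ms.
  have Q : Cmod (/ (s - 1))%C <= 1.
    rewrite Cmod_inv // -Rinv_1; apply: Rinv_le_contravar; first lra.
    apply: Rle_trans (re_le_Cmod _); rewrite Re_minus /= Rabs_pos_eq; lra.
  have := Cmod_ge_0 (/ (s * s))%C; have := Cmod_ge_0 (/ (s - 1))%C; nra.
have S1 : Rabs (vint (Qp 0) (2 + T) T - vint (Qp 0) 2 T) <= 2 * (/ T ^ 2) * (2 + T - 2).
  apply: (vint_shift _ _ 1 _ _ _ _ HQ); [lra | lra | move=> x Hx].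
  split; apply: B; rewrite ?[Re _]/=; try lra; apply: Rle_trans (Rabs_le_Cmod_pair _ _);
    rewrite ?Rabs_Ropp Rabs_pos_eq; lra.
have S2 : Rabs (vint (Qp 0) (2 + T) T) <= 2 * T * (/ T ^ 2).
  apply: (vint_bound _ _ 1 _ _ _ HQ); [lra | lra | move=> t _].
  apply: B; rewrite ?[Re _]/=; first lra; apply: Rle_trans (Rabs_le_Cmod_pair1 _ _);
    rewrite ?Rabs_Ropp Rabs_pos_eq; lra.
have E1 : 2 * (/ T ^ 2) * (2 + T - 2) = 2 / T by field; lra.
have E2 : 2 * T * (/ T ^ 2) = 2 / T by field; lra.
have -> : 4 / T = 2 / T + 2 / T by field; lra.
move: S1 S2 => /Rabs_le_between S1 /Rabs_le_between S2; apply: Rabs_le; lra.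
Qed.

(** The factor exp (- u) brings down s - 1 under differentiation, which cancels the pole. Integrals
    of [Qp] thus follow from those of [Kp] by integrating in u, and no residue at 1 is computed. *)
Lemma Qp_derive T u : is_derive (fun u => exp (- u) * vint (Qp u) 2 T) u (exp (- u) * vint (Kp u) 2 T).
Proof.
pose al := fun t : R => Re (Wp (2, t)); pose be := fun t : R => Im (Wp (2, t)).
have [W' HW] := hol_Wp.
have H2 : forall t : R, 1 < Re (2, t) by move=> t /=; lra.
have [cal cbe] : (forall t, continuity_pt al t) /\ (forall t, continuity_pt be t).
  have Q : forall t, ccont Wp (2, t) by move=> t; exact: cderiv_ccont (proj1 (HW _ (H2 t))).
  by split=> t; apply/continuity_pt_filterlim; case: (ccont_cont_v _ _ _ (Q t)).
(* The integrand with u and t separated into exponential, sine and cosine, so that joint continuity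
   is visible factor by factor. *)
pose F := fun u t => exp u * (cos (t * u) * al t - sin (t * u) * be t).
pose F' := fun u t => exp u * (cos (t * u) * (al t - t * be t) - sin (t * u) * (be t + t * al t)).
have DF : forall u t, is_derive (fun u => F u t) u (F' u t).
  by move=> v t; rewrite /F /F'; auto_derive => //; ring.
have EF : forall u t, F u t = exp (- u) * Re (Qp u (2, t)).
  move=> v t; rewrite /Qp /F.
  have -> : ((2, t) * RtoC v)%C = ((v + v)%R, (t * v)%R) by apply: injective_projections; rewrite /=; ring.
  rewrite /al /be; move: (Wp _) => [a b].
  rewrite /cexp /= exp_plus exp_Ropp; field; have := exp_pos v; lra.
have EF' : forall u t, F' u t = exp (- u) * Re (Kp u (2, t)).
  move=> v t; rewrite /Kp /F'.
  have -> : (/ ((2, t) * (2, t)))%C = (((2, t) - 1) * Wp (2, t))%C.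
    have D := Wp_den (2, t) (H2 t).
    have D1 : (2, t) <> RtoC 0 by move=> [] ?; lra.
    have D2 : ((2, t) - 1)%C <> 0%C by move=> [] ? _; lra.
    by rewrite /Wp; field.
  have -> : ((2, t) * RtoC v)%C = ((v + v)%R, (t * v)%R) by apply: injective_projections; rewrite /=; ring.
  rewrite /al /be; move: (Wp _) => [a b].
  rewrite /cexp /= exp_plus exp_Ropp; field; have := exp_pos v; lra.
have contF : forall v t, continuous (fun t => F v t) t.
  move=> v t; apply/continuity_pt_filterlim.
  have ct : forall t, continuity_pt (fun t => t * v) t by move=> z; apply: derivable_continuous_pt; reg.
  apply: continuity_pt_mult; first by apply: continuity_pt_const.
  apply: continuity_pt_minus; apply: continuity_pt_mult => //.
    by apply: (continuity_pt_comp (fun t => t * v) cos) => //; apply: continuity_cos.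
  by apply: (continuity_pt_comp (fun t => t * v) sin) => //; apply: continuity_sin.
have iF : forall v, ex_RInt (fun t => F v t) (- T) T by move=> v; apply: ex_RInt_continuous => t _; exact: contF.
have K : is_derive (fun u => RInt (fun t => F u t) (- T) T) u (RInt (fun t => Derive (fun u => F u t) u) (- T) T).
  apply: (is_derive_RInt_param F).
  - by exists (mkposreal 1 Rlt_0_1) => y _ t _; exists (F' y t).
  - move=> t _; apply: (continuity_2d_pt_ext F').
      by move=> x y; symmetry; apply: is_derive_unique.
    have c1 : forall f, (forall t, continuity_pt f t) -> continuity_2d_pt (fun _ y : R => f y) u t.
      by move=> f Hf; apply: (continuity_1d_2d_pt_comp f (fun _ y => y)) => //; exact: continuity_2d_pt_id2.
    have cm : continuity_2d_pt (fun x y => y * x) u t.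
      by apply: continuity_2d_pt_mult; [exact: continuity_2d_pt_id2 | exact: continuity_2d_pt_id1].
    rewrite /F'; apply: continuity_2d_pt_mult.
      apply: (continuity_1d_2d_pt_comp exp (fun x _ => x)); last exact: continuity_2d_pt_id1.
      by apply: derivable_continuous_pt; reg.
    apply: continuity_2d_pt_minus; apply: continuity_2d_pt_mult.
    - by apply: (continuity_1d_2d_pt_comp cos) => //; apply: continuity_cos.
    - by apply: continuity_2d_pt_minus; [exact: c1 | apply: continuity_2d_pt_mult; [exact: continuity_2d_pt_id2 | exact: c1]].
    - by apply: (continuity_1d_2d_pt_comp sin) => //; apply: continuity_sin.
    - by apply: continuity_2d_pt_plus; [exact: c1 | apply: continuity_2d_pt_mult; [exact: continuity_2d_pt_id2 | exact: c1]].
  - by exists (mkposreal 1 Rlt_0_1) => y _; exact: iF.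
have E2 : RInt (fun t => Derive (fun u => F u t) u) (- T) T = exp (- u) * vint (Kp u) 2 T.
  rewrite /vint -RInt_Rscal; last first.
    have [K' HK] := hol_Kp u.
    by apply: ex_RInt_ccont => t _; apply: cderiv_ccont (proj1 (HK (2, t) _)); rewrite /=; lra.
  by apply: RInt_ext => t _; rewrite -EF'; apply: is_derive_unique.
rewrite E2 in K; apply: is_derive_ext K => v.
have [Q' HQ] := hol_Qp v.
rewrite /vint -RInt_Rscal; last by apply: ex_RInt_ccont => t _; apply: cderiv_ccont (proj1 (HQ (2, t) _)).
by apply: RInt_ext => t _; rewrite EF.
Qed.

(** Both signs of u in one formula, on a line where the von Mangoldt series converges absolutely. *)
Lemma perron2 u T : 1 <= T -> Rabs (vint (Kp u) 2 T - 2 * PI * Rmax 0 u) <= 8 * exp (2 * u) / T.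
Proof.
move=> HT; have e0 := exp_pos (2 * u).
have I : 0 < / T by apply: Rinv_0_lt_compat; lra.
case: (Rle_dec u 0) => Hu.
  rewrite Rmax_left // Rmult_0_r Rminus_0_r.
  apply: Rle_trans (perron_neg 2 u T ltac:(lra) Hu ltac:(lra)) _.
  apply: Rmult_le_compat_r; lra.
rewrite Rmax_right; last lra.
apply: Rle_trans (perron_pos 2 u T ltac:(lra) ltac:(lra) ltac:(lra)) _.
have e1 : 1 <= exp (2 * u) by rewrite -exp_0; apply: exp_mono; lra.
have I2 : / T ^ 2 <= / T by apply: Rinv_le_contravar; nra.
rewrite /Rdiv.
have -> : 8 * exp (2 * u) * / T = 2 * 2 * exp (2 * u) * / T + 4 * exp (2 * u) * / T by ring.
apply: Rplus_le_compat; first by apply: Rmult_le_compat_l; lra.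
apply: Rmult_le_compat_r; lra.
Qed.

(** [Qp_derive] integrated from 0 to u with [perron2] as input: the main term is exp u times the
    integral of v exp (- v), which is exp u - 1 - u. The initial value is small by [Qp0_bound]. *)
Lemma perron_pole u T : 1 <= T -> 0 <= u ->
  Rabs (vint (Qp u) 2 T - 2 * PI * (exp u - 1 - u)) <= exp u * (4 + 8 * exp u * u) / T.
Proof.
move=> HT Hu.
have I : 0 < / T by apply: Rinv_0_lt_compat; lra.
pose Dl := fun v => exp (- v) * vint (Qp v) 2 T - 2 * PI * (1 - exp (- v) - v * exp (- v)).
have DD : forall v, is_derive Dl v (exp (- v) * vint (Kp v) 2 T - 2 * PI * (v * exp (- v))).
  move=> v.
  have D2 : is_derive (fun v => 2 * PI * (1 - exp (- v) - v * exp (- v))) v (2 * PI * (v * exp (- v))).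
    by auto_derive => //; ring.
  exact: (is_derive_minus _ _ _ _ _ (Qp_derive T v) D2).
have B : Rabs (Dl u - Dl 0) <= 8 * exp u / T * (u - 0).
  apply: (deriv_bound Dl _ 0 u _ Hu (fun v _ => DD v)) => v Hv.
  have -> : exp (- v) * vint (Kp v) 2 T - 2 * PI * (v * exp (- v)) = exp (- v) * (vint (Kp v) 2 T - 2 * PI * Rmax 0 v).
    by rewrite Rmax_right; [ring | lra].
  rewrite Rabs_mult (Rabs_pos_eq (exp (- v))); last by apply: Rlt_le; exact: exp_pos.
  have P := perron2 v T HT.
  apply: (Rle_trans _ (exp (- v) * (8 * exp (2 * v) / T))).
    by apply: Rmult_le_compat_l => //; apply: Rlt_le; exact: exp_pos.
  have -> : exp (- v) * (8 * exp (2 * v) / T) = 8 * exp v / T.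
    have -> : 2 * v = v + v by ring.
    rewrite exp_plus exp_Ropp; field; split; [lra | have := exp_pos v; lra].
  apply: Rmult_le_compat_r; first lra.
  have := exp_mono v u ltac:(lra); lra.
have B0 : Rabs (Dl 0) <= 4 / T.
  rewrite /Dl Ropp_0 exp_0.
  have -> : 1 * vint (Qp 0) 2 T - 2 * PI * (1 - 1 - 0 * 1) = vint (Qp 0) 2 T by ring.
  exact: Qp0_bound.
have -> : vint (Qp u) 2 T - 2 * PI * (exp u - 1 - u) = exp u * Dl u.
  rewrite /Dl exp_Ropp; field; have := exp_pos u; lra.
rewrite Rabs_mult (Rabs_pos_eq (exp u)); last by apply: Rlt_le; exact: exp_pos.
have -> : exp u * (4 + 8 * exp u * u) / T = exp u * (4 / T + 8 * exp u / T * (u - 0)) by field; lra.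
apply: Rmult_le_compat_l; first by apply: Rlt_le; exact: exp_pos.
move: B B0 => /Rabs_le_between B /Rabs_le_between B0; apply: Rabs_le; lra.
Qed.

(* The integral of [psi (exp v)] over [v <= u], as soon as [exp u <= N]. *)
Definition Aint (u : R) (N : nat) : R := rsum (fun n => mangoldt n * Rmax 0 (u - ln (INR n))) N.

Lemma hol_Lpart D N : exists L', hol D (Lpart N) L'.
Proof. eexists; apply: (hol_csum D (fun n s => RtoC (mangoldt n) * npow n s)%C) => n; apply: hol_scal; exact: hol_npow. Qed.

Lemma vint_Lpart u T N : vint (fun s => Lpart N s * Kp u s)%C 2 T = rsum (fun n => mangoldt n * vint (Kp (u - ln (INR n))) 2 T) N.
Proof.
have iK : forall v, ex_RInt (fun t => Re (Kp v (2, t))) (- T) T.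
  move=> v; have [K' HK] := hol_Kp v.
  by apply: ex_RInt_ccont => t _; apply: cderiv_ccont (proj1 (HK (2, t) _)); rewrite /=; lra.
elim: N => [|N IH].
  rewrite /vint (RInt_ext _ (fun _ => 0)).
    by rewrite RInt_const /scal /= /mult /=; ring.
  by move=> t _; rewrite /Lpart [csum _ _]/= Cmult_0_l.
rewrite rsum_S -IH /vint -RInt_Rscal // RInt_Rplus.
- apply: RInt_ext => t _; rewrite -Re_scal -Re_plus; congr Re.
  rewrite /Lpart csum_S /Kp /npow.
  have -> : ((2, t) * RtoC (u - ln (INR N.+1)))%C = ((2, t) * RtoC (- ln (INR N.+1)) + (2, t) * RtoC u)%C.
    by rewrite RtoC_minus RtoC_opp; ring.
  rewrite cexp_plus; ring.
- have [L' HL] := hol_Lpart (fun s => 0 < Re s) N; have [K' HK] := hol_Kp u.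
  apply: (ex_RInt_ccont (fun s => Lpart N s * Kp u s)%C) => t _.
  by apply: cderiv_ccont (proj1 (hol_mult _ _ _ _ _ HL HK (2, t) _)); rewrite /=; lra.
- exact: ex_RInt_Rscal.
Qed.

Lemma Aint_stable u M N : exp u <= INR M -> (M <= N)%nat -> Aint u N = Aint u M.
Proof.
move=> HM HN; apply: rsum_extend => // n harmonic.
have : u <= ln (INR n).
  rewrite -(ln_exp u); apply: ln_le; first exact: exp_pos.
  apply: Rle_trans HM _; apply: le_INR; lia.
by move=> H; rewrite Rmax_left; [ring | lra].
Qed.

(** For partial sums this is [perron2] term by term; the errors carry the weights Lambda n / n^2,
    whose sum is at most 16, whence 128 = 8 * 16. For fixed T the partial sums converge uniformly on
    the line, so N may tend to infinity. *)
Lemma perron_Ls u T M : 1 <= T -> exp u <= INR M ->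
  Rabs (vint (fun s => Ls s * Kp u s)%C 2 T - 2 * PI * Aint u M) <= 128 * exp (2 * u) / T.
Proof.
move=> HT HM.
have I : 0 < / T by apply: Rinv_0_lt_compat; lra.
have e0 := exp_pos (2 * u).
have main : forall N, (M <= N)%nat -> Rabs (vint (fun s => Lpart N s * Kp u s)%C 2 T - 2 * PI * Aint u M) <= 128 * exp (2 * u) / T.
  move=> N HN; rewrite -(Aint_stable u M N HM HN) vint_Lpart /Aint -rsum_scal.
  have D : forall f g, rsum f N - rsum g N = rsum (fun n => f n + -1 * g n) N.
    by move=> f g; rewrite rsum_plus rsum_scal; ring.
  rewrite D.
  have TR : forall f, Rabs (rsum f N) <= rsum (fun n => Rabs (f n)) N.
    move=> f; elim: (N) => [|k IH] /=; first by rewrite Rabs_R0; lra.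
    by apply: Rle_trans (Rabs_triang _ _) _; lra.
  apply: Rle_trans (TR _) _.
  apply: (Rle_trans _ (rsum (fun n => 8 * exp (2 * u) / T * (mangoldt n * rpow 2 (INR n))) N)).
    apply: rsum_le => n harmonic.
    have -> : mangoldt n * vint (Kp (u - ln (INR n))) 2 T + -1 * (2 * PI * (mangoldt n * Rmax 0 (u - ln (INR n)))) =
      mangoldt n * (vint (Kp (u - ln (INR n))) 2 T - 2 * PI * Rmax 0 (u - ln (INR n))) by ring.
    rewrite Rabs_mult (Rabs_pos_eq (mangoldt n)); last exact: mangoldt_ge0.
    have -> : 8 * exp (2 * u) / T * (mangoldt n * rpow 2 (INR n)) = mangoldt n * (8 * exp (2 * (u - ln (INR n))) / T).
      have -> : 2 * (u - ln (INR n)) = 2 * u + - (2) * ln (INR n) by ring.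
      rewrite exp_plus /rpow; field; lra.
    by apply: Rmult_le_compat_l; [exact: mangoldt_ge0 | exact: perron2].
  rewrite rsum_scal.
  have S := mangoldt_rpow_sum (/ 2) 2 N ltac:(lra) ltac:(lra).
  have -> : 128 * exp (2 * u) / T = 8 * exp (2 * u) / T * (4 / (/ 2) ^ 2) by field; lra.
  apply: Rmult_le_compat_l => //.
  by apply: Rlt_le; apply: Rdiv_lt_0_compat; lra.
have [K' HK] := hol_Kp u.
have Kb : forall t, Cmod (Kp u (2, t)) <= exp (2 * u).
  move=> t; apply: Rle_trans (Cmod_Kp u (2, t) 1 ltac:(lra) _) _.
    apply: Rle_trans (Rabs_le_Cmod_pair1 _ _); rewrite Rabs_pos_eq; lra.
  rewrite [Re _]/= pow1 /Rdiv Rinv_1; lra.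
(* Continuity of [Ls] is read off from Ls = 1 / (s - 1) - Zs1 / Zs near the line. *)
have cLK : forall t, ccont (fun s => Ls s * Kp u s)%C (2, t).
  move=> t; apply: ccont_mult; last by apply: cderiv_ccont (proj1 (HK (2, t) _)); rewrite /=; lra.
  have H1 : forall s : C, 1 < Re s -> (s - 1)%C <> 0%C.
    by move=> s Hs; apply: Cminus_eq_contra => E; rewrite E /= in Hs; lra.
  apply: (ccont_ext_loc (fun s => / (s - 1) + - (1) * (Zs1 s * / Zs s))%C _ (2, t) 1); first lra.
    move=> z Hz.
    have Hz1 : 1 < Re z.
      have := re_le_Cmod (z - (2, t))%C; rewrite Re_minus => /Rabs_le_between /=; lra.
    have Zn0 : Zs z <> 0%C.
      by move=> E; apply: (zeta_neq0 z Hz1); rewrite /zeta E /Cdiv; ring.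
    have := H1 z Hz1 => N1; rewrite Zs1_eq //; field; split => //.
  have Hc : 1 < Re (2, t) by rewrite /=; lra.
  have Zn0 : Zs (2, t) <> 0%C.
    by move=> E; apply: (zeta_neq0 (2, t) Hc); rewrite /zeta E /Cdiv; ring.
  have Dz2 : Dz (2, t) by rewrite /Dz /=; lra.
  apply: ccont_plus.
    apply: ccont_inv; first exact: H1.
    by apply: ccont_plus; [exact: ccont_id | exact: ccont_const].
  apply: ccont_mult; first exact: ccont_const.
  apply: ccont_mult; first exact: cderiv_ccont (proj1 (hol_Zs1 _ Dz2)).
  by apply: ccont_inv => //; exact: cderiv_ccont (proj1 (hol_Zs _ Dz2)).
have iLK : ex_RInt (fun t => Re (Ls (2, t) * Kp u (2, t))%C) (- T) T.
  by apply: (ex_RInt_ccont (fun s => Ls s * Kp u s)%C) => t _.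
apply: le_epsilon => e He.
set q := 2 * T * (16 * exp (2 * u)).
have q0 : 0 < q by rewrite /q; nra.
have [N0 HN0] := rpow_lim (/ 2) (e / q) ltac:(lra) ltac:(exact: Rdiv_lt_0_compat).
set N := maxn M N0.
have A := main N ltac:(lia).
have Bd : Rabs (vint (fun s => Ls s * Kp u s)%C 2 T - vint (fun s => Lpart N s * Kp u s)%C 2 T) <= e.
  have [L' HL] := hol_Lpart (fun s => 0 < Re s) N.
  have iL : ex_RInt (fun t => Re (Lpart N (2, t) * Kp u (2, t))%C) (- T) T.
    apply: (ex_RInt_ccont (fun s => Lpart N s * Kp u s)%C) => t _.
    by apply: cderiv_ccont (proj1 (hol_mult _ _ _ _ _ HL HK (2, t) _)); rewrite /=; lra.
  rewrite /vint RInt_Rminus //.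
  apply: Rle_trans (abs_RInt_le_const _ _ _ (4 / (/ 2) ^ 2 * rpow (/ 2) (INR N.+1) * exp (2 * u)) _ _ _) _; first lra.
  - exact: ex_RInt_Rminus.
  - move=> t _; rewrite -Re_minus; apply: Rle_trans (re_le_Cmod _) _.
    have -> : (Ls (2, t) * Kp u (2, t) - Lpart N (2, t) * Kp u (2, t) = (Ls (2, t) - Lpart N (2, t)) * Kp u (2, t))%C by ring.
    rewrite Cmod_mult; apply: Rmult_le_compat; [exact: Cmod_ge_0 | exact: Cmod_ge_0 | | exact: Kb].
    apply: Ls_err; rewrite /=; lra.
  have R1 := HN0 N.+1 ltac:(lia).
  have := proj2 (Rlt_div_r _ _ _ q0) R1.
  rewrite /q; nra.
move: A Bd => /Rabs_le_between A /Rabs_le_between Bd; apply: Rabs_le; lra.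
Qed.

(** * The prime number theorem under RH *)

Lemma RInt_bound_deriv (f phi phi' : R -> R) a b : a <= b -> ex_RInt f a b ->
  (forall t, a <= t <= b -> is_derive phi t (phi' t)) -> (forall t, a <= t <= b -> continuous phi' t) ->
  (forall t, a <= t <= b -> Rabs (f t) <= phi' t) -> Rabs (RInt f a b) <= phi b - phi a.
Proof.
move=> Hab If D C0 B.
have K : is_RInt phi' a b (minus (phi b) (phi a)).
  apply: is_RInt_derive; rewrite Rmin_left // Rmax_right //.
have -> : phi b - phi a = RInt phi' a b by rewrite (is_RInt_unique _ _ _ _ K).
have I2 : ex_RInt phi' a b by eexists; exact: K.
apply: Rle_trans (abs_RInt_le _ _ _ Hab If) _.
apply: RInt_le => //; last by move=> t Ht; apply: B; lra.
exact: ex_RInt_norm If.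
Qed.

Lemma RInt_fold (f : R -> R) T : 0 <= T -> ex_RInt f (- T) T ->
  RInt f (- T) T = RInt (fun t => f t + f (- t)) 0 T /\ ex_RInt (fun t => f t + f (- t)) 0 T.
Proof.
move=> HT If.
have I1 : ex_RInt f 0 T by apply: (ex_RInt_Chasles_2 f (- T)) => //; lra.
have I2 : ex_RInt f (- T) 0 by apply: (ex_RInt_Chasles_1 f _ _ T) => //; lra.
have I3 : ex_RInt f (- 0) (- T) by rewrite Ropp_0; apply: ex_RInt_swap.
have I4 : is_RInt (fun t => f (- t)) 0 T (RInt f (- T) 0).
  have K : is_RInt (fun y => opp (f (- y))) 0 T (RInt f (- 0) (- T)).
    by apply: is_RInt_comp_opp; exact: RInt_correct.
  have := is_RInt_opp _ _ _ _ K.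
  rewrite Ropp_0 (_ : opp (RInt f 0 (- T)) = RInt f (- T) 0); last by rewrite opp_RInt_swap //; exact: ex_RInt_swap.
  by apply: is_RInt_ext => t _; rewrite opp_opp.
have I5 : ex_RInt (fun t => f (- t)) 0 T by eexists; exact: I4.
split; last exact: ex_RInt_Rplus.
rewrite -RInt_Rplus // (is_RInt_unique _ _ _ _ I4) -(RInt_Chasles f (- T) 0 T) // /plus /=; ring.
Qed.

Lemma ln_6 : ln 6 <= 19 / 10.
Proof.
rewrite -(ln_exp (19 / 10)); apply: ln_le; first lra.
have := pow_le_exp 38 (/ 20) ltac:(lra).
have -> : INR 38 * / 20 = 19 / 10 by rewrite /=; field.
lra.
Qed.

(* The three ranges |t| <= 1, 1 <= |t| <= 1 / h and |t| >= 1 / h. *)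
Lemma kernel_integral_bound (f : R -> R) (W h T : R) : 0 < W -> 0 < h -> h <= / 100 -> / h <= T ->
  ex_RInt f (- T) T ->
  (forall t x, 0 < x -> 11 / 20 <= x -> Rabs t <= x -> x <= Cmod (11 / 20, t) ->
     Rabs (f t) <= W * growth t * (8 / 5 * h / x) /\ Rabs (f t) <= W * growth t * (21 / 10 / x ^ 2)) ->
  Rabs (RInt f (- T) T) <= W * h * (16 / 5 * ln (/ h) ^ 2 + 34 * ln (/ h) + 88).
Proof.
move=> HW Hh Hh1 HT If Hf.
set H := / h in HT *; set l := ln H.
have hH : h * H = 1 by rewrite /H; field; lra.
have H100 : 100 <= H by rewrite /H -(Rinv_inv 100); apply: Rinv_le_contravar; lra.
have [-> I0] := RInt_fold f T ltac:(lra) If.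
set g := fun t => f t + f (- t).
have l6 := ln_6.
have G0 : forall t, growth (- t) = growth t by move=> t; rewrite /growth Rabs_Ropp.
have C1 : forall t, Rabs t <= Cmod (11 / 20, t) /\ 11 / 20 <= Cmod (11 / 20, t).
  move=> t; split; first exact: Rabs_le_Cmod_pair.
  apply: Rle_trans (Rabs_le_Cmod_pair1 _ _); rewrite Rabs_pos_eq; lra.
have gpos : forall t, 0 <= growth t.
  move=> t; rewrite /growth; have : 0 <= ln (Rabs t + 5) by rewrite -ln_1; apply: ln_le; have := Rabs_pos t; lra.
  lra.
(* t + 5 <= 6 t, and 2 * 19/10 + 4 = 39/5. *)
have gb : forall t, 1 <= t -> growth t <= 2 * ln t + 39 / 5.
  move=> t Ht; rewrite /growth Rabs_pos_eq; last lra.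
  have : ln (t + 5) <= ln 6 + ln t by rewrite -ln_mult; [apply: ln_le; lra | lra | lra].
  lra.
have g2 : forall t, Rabs (g t) <= Rabs (f t) + Rabs (f (- t)) by move=> t; exact: Rabs_triang.
have B1 : forall t, 0 <= t <= 1 -> Rabs (g t) <= W * h * 46.
  move=> t Ht; apply: Rle_trans (g2 t) _.
  have gt : growth t <= 39 / 5.
    rewrite /growth Rabs_pos_eq; last lra.
    have : ln (t + 5) <= ln 6 by apply: ln_le; lra.
    lra.
  have K : forall t', growth t' = growth t -> Rabs t' = t -> Rabs (f t') <= W * h * 23.
    move=> t' E1 E2; have [A B] := C1 t'.
    have [F1 _] := Hf t' (Cmod (11 / 20, t')) ltac:(lra) B A (Rle_refl _).
    apply: Rle_trans F1 _; rewrite E1.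
    have -> : W * h * 23 = W * (39 / 5) * (h * (23 * 5 / 39)) by field.
    apply: Rmult_le_compat.
    - by apply: Rmult_le_pos; [lra | exact: gpos].
    - apply: Rmult_le_pos; first lra. by apply: Rlt_le; apply: Rinv_0_lt_compat; lra.
    - by apply: Rmult_le_compat_l; lra.
    have I : / Cmod (11 / 20, t') <= 20 / 11.
      by have -> : 20 / 11 = / (11 / 20) by [field]; apply: Rinv_le_contravar; lra.
    rewrite /Rdiv in I *; nra.
  have F1 := K t erefl (Rabs_pos_eq t (proj1 Ht)).
  have F2 := K (- t) (G0 t) ltac:(rewrite Rabs_Ropp; apply: Rabs_pos_eq; lra).
  lra.
have B23 : forall t, 1 <= t -> Rabs (g t) <= W * (16 / 5 * h) * ((2 * ln t + 39 / 5) / t) /\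
   Rabs (g t) <= W * (21 / 5) * ((2 * ln t + 39 / 5) / t ^ 2).
  move=> t Ht.
  have gt := gb t Ht; have gp := gpos t.
  have [A B] := C1 t; have [A' B'] := C1 (- t).
  rewrite Rabs_pos_eq in A; last lra. rewrite Rabs_Ropp Rabs_pos_eq in A'; last lra.
  have [F1 F2] := Hf t t ltac:(lra) ltac:(lra) ltac:(rewrite Rabs_pos_eq; lra) A.
  have [F1' F2'] := Hf (- t) t ltac:(lra) ltac:(lra) ltac:(rewrite Rabs_Ropp Rabs_pos_eq; lra) A'.
  rewrite G0 in F1' F2'.
  have I1 : 0 < / t by apply: Rinv_0_lt_compat; lra.
  have I2 : 0 < / t ^ 2 by apply: Rinv_0_lt_compat; nra.
  have L := g2 t.
  split.
    have -> : W * (16 / 5 * h) * ((2 * ln t + 39 / 5) / t) = W * (2 * ln t + 39 / 5) * (8 / 5 * h / t) + W * (2 * ln t + 39 / 5) * (8 / 5 * h / t) by field; lra.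
    have : W * growth t * (8 / 5 * h / t) <= W * (2 * ln t + 39 / 5) * (8 / 5 * h / t).
      by apply: Rmult_le_compat_r; [rewrite /Rdiv; nra | apply: Rmult_le_compat_l; lra].
    lra.
  have -> : W * (21 / 5) * ((2 * ln t + 39 / 5) / t ^ 2) = W * (2 * ln t + 39 / 5) * (21 / 10 / t ^ 2) + W * (2 * ln t + 39 / 5) * (21 / 10 / t ^ 2) by field; lra.
  have : W * growth t * (21 / 10 / t ^ 2) <= W * (2 * ln t + 39 / 5) * (21 / 10 / t ^ 2).
    by apply: Rmult_le_compat_r; [rewrite /Rdiv; nra | apply: Rmult_le_compat_l; lra].
  lra.
have J1 : ex_RInt g 0 1 by apply: (ex_RInt_Chasles_1 g _ _ T) => //; lra.
have J1' : ex_RInt g 1 T by apply: (ex_RInt_Chasles_2 g 0) => //; lra.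
have J2 : ex_RInt g 1 H by apply: (ex_RInt_Chasles_1 g _ _ T) => //; lra.
have J3 : ex_RInt g H T by apply: (ex_RInt_Chasles_2 g 1) => //; lra.
have R1 : Rabs (RInt g 0 1) <= (1 - 0) * (W * h * 46).
  by apply: abs_RInt_le_const => //; lra.
have R2 : Rabs (RInt g 1 H) <= W * (16 / 5 * h) * (ln H ^ 2 + 39 / 5 * ln H) - W * (16 / 5 * h) * (ln 1 ^ 2 + 39 / 5 * ln 1).
  apply: (RInt_bound_deriv g (fun t => W * (16 / 5 * h) * (ln t ^ 2 + 39 / 5 * ln t)) (fun t => W * (16 / 5 * h) * ((2 * ln t + 39 / 5) / t))) => //; first lra.
  - by move=> t Ht; auto_derive; [lra | field; lra].
  - move=> t Ht; apply: (ex_derive_continuous (fun t => W * (16 / 5 * h) * ((2 * ln t + 39 / 5) / t))).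
    by auto_derive; split; lra.
  - by move=> t Ht; case: (B23 t (proj1 Ht)).
(* An antiderivative of (2 ln t + 39/5) / t^2 is - (2 ln t + 49/5) / t. *)
have R3 : Rabs (RInt g H T) <= - (W * (21 / 5) * ((2 * ln T + 49 / 5) / T)) - - (W * (21 / 5) * ((2 * ln H + 49 / 5) / H)).
  apply: (RInt_bound_deriv g (fun t => - (W * (21 / 5) * ((2 * ln t + 49 / 5) / t))) (fun t => W * (21 / 5) * ((2 * ln t + 39 / 5) / t ^ 2))) => //.
  - by move=> t Ht; auto_derive; [split; lra | field; lra].
  - move=> t Ht; apply: (ex_derive_continuous (fun t => W * (21 / 5) * ((2 * ln t + 39 / 5) / t ^ 2))).
    by auto_derive; split; [lra | nra].
  - by move=> t Ht; case: (B23 t ltac:(lra)).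
have lT : 0 <= ln T by rewrite -ln_1; apply: ln_le; lra.
have R3' : 0 <= W * (21 / 5) * ((2 * ln T + 49 / 5) / T).
  by apply: Rmult_le_pos; [lra | apply: Rlt_le; apply: Rdiv_lt_0_compat; lra].
have E3 : W * (21 / 5) * ((2 * ln H + 49 / 5) / H) = W * h * (21 / 5 * (2 * l + 49 / 5)).
  rewrite /l {2}/H; field; lra.
have Ch : RInt g 0 T = RInt g 0 1 + (RInt g 1 H + RInt g H T).
  by rewrite -(RInt_Chasles g 0 1 T) // -(RInt_Chasles g 1 H T).
have l0 : 0 <= l by rewrite /l -ln_1; apply: ln_le; lra.
rewrite Ch; apply: Rle_trans (Rabs_triang _ _) _.
have := Rabs_triang (RInt g 1 H) (RInt g H T).
rewrite ln_1 -/l in R2; rewrite E3 in R3.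
have Wh : 0 < W * h by nra.
(* The coefficients add up: 16/5 * 39/5 + 42/5 is below 34, and 46 + 21/5 * 49/5 is below 88. *)
have : W * (16 / 5 * h) * (l ^ 2 + 39 / 5 * l) = W * h * (16 / 5 * l ^ 2 + 16 / 5 * (39 / 5) * l) by ring.
nra.
Qed.

Lemma growth_le t : 1 <= Rabs t -> growth t <= 14 * Rabs t.
Proof.
move=> Ht; rewrite /growth.
have := exp_ineq1_le (ln (Rabs t + 5)); rewrite exp_ln; lra.
Qed.

(** This is - zeta' / zeta with its pole at 1 removed, so the line of integration crosses Re s = 1
    freely; under RH it is holomorphic up to Re s = 1/2. *)
Definition Gz (s : C) : C := (- (1) * (Zs1 s * / Zs s))%C.

Lemma hol_Gz (RH : RiemannHypothesis) : exists G', hol (fun s => / 2 < Re s) Gz G'.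
Proof.
eexists; apply: hol_scal; apply: hol_mult.
  by apply: hol_sub hol_Zs1 => s Hs; rewrite /Dz; lra.
apply: hol_inv; first by move=> s Hs; exact: Zs_neq0.
by apply: hol_sub hol_Zs => s Hs; rewrite /Dz; lra.
Qed.

Lemma Gz_bound (RH : RiemannHypothesis) x t : 11 / 20 <= x <= 2 -> Cmod (Gz (x, t)) <= 36000 * growth t.
Proof.
move=> Hx; rewrite /Gz Cmod_mult Cmod_opp Cmod_1 Rmult_1_l; exact: Zs_logderiv_bound.
Qed.

Lemma Gz_Ls (s : C) : 1 < Re s -> Gz s = (Ls s - / (s - 1))%C.
Proof.
move=> Hs.
have H1 : (s - 1)%C <> 0%C by apply: Cminus_eq_contra => E; rewrite E /= in Hs; lra.
have Z0 : Zs s <> 0%C by move=> E; apply: (zeta_neq0 s Hs); rewrite /zeta E /Cdiv; ring.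
rewrite /Gz Zs1_eq //; field; split => //.
Qed.

Lemma vint_Gz_Kp (RH : RiemannHypothesis) u T M : 1 <= T -> 0 <= u -> exp u <= INR M ->
  Rabs (vint (fun s => Gz s * Kp u s)%C 2 T - 2 * PI * (Aint u M - (exp u - 1 - u))) <=
    (128 * exp (2 * u) + exp u * (4 + 8 * exp u * u)) / T.
Proof.
move=> HT Hu HM.
have A := perron_Ls u T M HT HM.
have B := perron_pole u T HT Hu.
have [G' HG] := hol_Gz RH; have [K' HK] := hol_Kp u; have [Q' HQ] := hol_Qp u.
have H2 : forall t : R, 1 < Re (2, t) by move=> t /=; lra.
have E : forall t : R, (Gz (2, t) * Kp u (2, t) + Qp u (2, t) = Ls (2, t) * Kp u (2, t))%C.
  move=> t; rewrite Gz_Ls // /Kp /Qp /Wp.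
  have D1 : (2, t) <> RtoC 0 by move=> [] ?; lra.
  have D2 : ((2, t) - 1)%C <> 0%C by move=> [] ? _; lra.
  by field.
have iG : ex_RInt (fun t => Re (Gz (2, t) * Kp u (2, t))%C) (- T) T.
  apply: (ex_RInt_ccont (fun s => Gz s * Kp u s)%C) => t _; apply: ccont_mult.
    by apply: cderiv_ccont (proj1 (HG (2, t) _)); rewrite /=; lra.
  by apply: cderiv_ccont (proj1 (HK (2, t) _)); rewrite /=; lra.
have iQ : ex_RInt (fun t => Re (Qp u (2, t))) (- T) T.
  by apply: ex_RInt_ccont => t _; exact: cderiv_ccont (proj1 (HQ (2, t) (H2 t))).
have S : vint (fun s => Gz s * Kp u s)%C 2 T + vint (Qp u) 2 T = vint (fun s => Ls s * Kp u s)%C 2 T.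
  by rewrite /vint RInt_Rplus //; apply: RInt_ext => t _; rewrite -Re_plus E.
have -> : (128 * exp (2 * u) + exp u * (4 + 8 * exp u * u)) / T = 128 * exp (2 * u) / T + exp u * (4 + 8 * exp u * u) / T by field; lra.
move: A B => /Rabs_le_between A /Rabs_le_between B; apply: Rabs_le; lra.
Qed.

(** * Differencing Perron's kernel and moving the line to 11/20 *)

Definition Kd (u h : R) (s : C) : C := (Kp (u + h) s - Kp u s)%C.

(** The first bound uses |exp (s h) - 1| = O(h |s|), the second only that it is bounded; they cross
    near |s| = 1 / h. The first saves the factor h that is later divided out. The constants round
    3/2 * 101/100 and 1 + 101/100. *)
Lemma Cmod_Kd u h x t y : 0 < h -> h <= / 100 -> x = 11 / 20 -> 0 < y -> y <= Cmod (x, t) ->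
  Cmod (Kd u h (x, t)) <= exp (x * u) * (8 / 5 * h / y) /\ Cmod (Kd u h (x, t)) <= exp (x * u) * (21 / 10 / y ^ 2).
Proof.
move=> Hh Hh1 Hx Hy Hm.
have s0 : (x, t) <> RtoC 0 by apply/Cmod_gt_0; lra.
have e0 := exp_pos (x * u).
have E : Kd u h (x, t) = (cexp ((x, t) * RtoC u) * ((cexp ((x, t) * RtoC h) - 1) * / ((x, t) * (x, t))))%C.
  rewrite /Kd /Kp.
  have -> : ((x, t) * RtoC (u + h) = (x, t) * RtoC u + (x, t) * RtoC h)%C by rewrite RtoC_plus; ring.
  by rewrite cexp_plus; ring.
have Rv : forall v, Re ((x, t) * RtoC v)%C = x * v by move=> v /=; ring.
have M1 : Cmod (Kd u h (x, t)) = exp (x * u) * (Cmod (cexp ((x, t) * RtoC h) - 1)%C * / (Cmod (x, t) * Cmod (x, t))).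
  rewrite E Cmod_mult Cmod_cexp Rv Cmod_mult Cmod_inv ?Cmod_mult //; exact: Cmult_neq_0.
have eh : exp (x * h) <= 101 / 100.
  have X1 : 0 <= x * h by nra.
  have := exp_taylor1 (x * h) ltac:(rewrite Rabs_pos_eq; nra).
  have : x * h <= / 100 * (11 / 20) by nra.
  nra.
set m := Cmod (x, t) in Hm M1 *.
have m0 : 0 < m by lra.
have I1 : / m <= / y by apply: Rinv_le_contravar.
have I0 : 0 < / m by apply: Rinv_0_lt_compat.
have E2 : / (m * m) = / m * / m by field; lra.
have N1 : Cmod (cexp ((x, t) * RtoC h) - 1)%C <= 8 / 5 * h * m.
  have := Cmod_cexp_minus_1 ((x, t) * RtoC h)%C.
  rewrite Rv Cmod_mult Cmod_R (Rabs_pos_eq h) ?(Rabs_pos_eq (x * h)); [|nra|lra].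
  rewrite -/m; have : 0 < m * h by nra.
  nra.
have N2 : Cmod (cexp ((x, t) * RtoC h) - 1)%C <= 21 / 10.
  apply: Rle_trans (Cmod_triangle_minus _ _) _; rewrite Cmod_1 Cmod_cexp Rv; lra.
have P := Cmod_ge_0 (cexp ((x, t) * RtoC h) - 1)%C.
rewrite M1 E2; split; (apply: Rmult_le_compat_l; first lra).
- apply: (Rle_trans _ (8 / 5 * h * m * (/ m * / m))).
    by apply: Rmult_le_compat_r => //; nra.
  have -> : 8 / 5 * h * m * (/ m * / m) = 8 / 5 * h * / m by field; lra.
  apply: Rmult_le_compat_l => //; lra.
- apply: (Rle_trans _ (21 / 10 * (/ m * / m))).
    by apply: Rmult_le_compat_r => //; nra.
  have -> : 21 / 10 / y ^ 2 = 21 / 10 * (/ y * / y) by field; lra.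
  apply: Rmult_le_compat_l; first lra. nra.
Qed.

Lemma Aint_increment (RH : RiemannHypothesis) u h M : 0 <= u -> 0 < h -> h <= / 100 -> exp (u + h) <= INR M ->
  2 * PI * Rabs (Aint (u + h) M - Aint u M - (exp (u + h) - exp u - h)) <=
    36000 * exp (11 / 20 * u) * h * (16 / 5 * ln (/ h) ^ 2 + 34 * ln (/ h) + 88).
Proof.
move=> Hu Hh Hh1 HM; have P0 := PI_RGT_0.
set X := _ - _ - _; set B := 36000 * _ * _ * _.
have HM' : exp u <= INR M by apply: Rle_trans (exp_mono u (u + h) ltac:(lra)) HM.
have [G' HG] := hol_Gz RH; have [Ku' HKu] := hol_Kp u; have [Kv' HKv] := hol_Kp (u + h).
pose f := fun s : C => (Gz s * Kp (u + h) s + - (1) * (Gz s * Kp u s))%C.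
have Ef : forall s, f s = (Gz s * Kd u h s)%C by move=> s; rewrite /f /Kd; ring.
have HKu2 := hol_sub _ (fun s => / 2 < Re s) _ _ (fun s (H : / 2 < Re s) => Rlt_trans 0 (/2) _ ltac:(lra) H) HKu.
have HKv2 := hol_sub _ (fun s => / 2 < Re s) _ _ (fun s (H : / 2 < Re s) => Rlt_trans 0 (/2) _ ltac:(lra) H) HKv.
have HGu := hol_mult _ _ _ _ _ HG HKu2; have HGv := hol_mult _ _ _ _ _ HG HKv2.
have [f' Hff] : exists f', hol (fun s => / 2 < Re s) f f' by eexists; apply: hol_plus HGv _; apply: hol_scal HGu.
have if_ : forall g g' x T, hol (fun s => / 2 < Re s) g g' -> / 2 < x -> ex_RInt (fun t => Re (g (x, t))) (- T) T.
  by move=> g g' x T Hg Hx; apply: ex_RInt_ccont => t _; exact: cderiv_ccont (proj1 (Hg (x, t) Hx)).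
set e1 := exp (2 * u); set e2 := exp (2 * (u + h)).
set Cu := (128 * exp (2 * u) + exp u * (4 + 8 * exp u * u)).
set Cv := (128 * exp (2 * (u + h)) + exp (u + h) * (4 + 8 * exp (u + h) * (u + h))).
set Cs := 36000 * 14 * (e1 + e2) * 2 * (2 - 11 / 20).
have key : forall T, / h <= T -> 2 * PI * Rabs X <= B + (Cu + Cv + Cs) / T.
  move=> T HT.
  have H1 : 100 <= / h by rewrite -(Rinv_inv 100); apply: Rinv_le_contravar; lra.
  have A1 := vint_Gz_Kp RH u T M ltac:(lra) Hu HM'.
  have A2 := vint_Gz_Kp RH (u + h) T M ltac:(lra) ltac:(lra) HM.
  rewrite -/Cu in A1; rewrite -/Cv in A2.
  have S1 : vint f 2 T = vint (fun s => Gz s * Kp (u + h) s)%C 2 T - vint (fun s => Gz s * Kp u s)%C 2 T.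
    have i1 := if_ _ _ 2 T HGu ltac:(lra); have i2 := if_ _ _ 2 T HGv ltac:(lra).
    rewrite /vint RInt_Rminus //; apply: RInt_ext => t _.
    by rewrite -Re_minus; congr Re; rewrite /f; ring.
  have S2 : Rabs (vint f 2 T - vint f (11 / 20) T) <= 2 * (36000 * 14 * (e1 + e2) / T) * (2 - 11 / 20).
    apply: (vint_shift _ _ (/ 2) _ _ _ _ Hff); [lra | lra | move=> x Hx].
    have K : forall t, Rabs t = T -> Cmod (f (x, t)) <= 36000 * 14 * (e1 + e2) / T.
      move=> t Ht; rewrite Ef Cmod_mult.
      have g1 := Gz_bound RH x t Hx; have g2 := growth_le t ltac:(lra).
      have k1 : Cmod (Kd u h (x, t)) <= (e1 + e2) / T ^ 2.
        have b1 := Cmod_Kp u (x, t) T ltac:(lra) ltac:(rewrite -Ht; exact: Rabs_le_Cmod_pair).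
        have b2 := Cmod_Kp (u + h) (x, t) T ltac:(lra) ltac:(rewrite -Ht; exact: Rabs_le_Cmod_pair).
        have c1 : exp (Re (x, t) * u) <= e1 by apply: exp_mono; rewrite /=; nra.
        have c2 : exp (Re (x, t) * (u + h)) <= e2 by apply: exp_mono; rewrite /=; nra.
        have I : 0 < / T ^ 2 by apply: Rinv_0_lt_compat; nra.
        apply: Rle_trans (Cmod_triangle_minus _ _) _.
        rewrite /Rdiv in b1 b2 *; nra.
      rewrite Ht in g2.
      have -> : 36000 * 14 * (e1 + e2) / T = 36000 * (14 * T) * ((e1 + e2) / T ^ 2) by field; lra.
      apply: Rmult_le_compat => //; [exact: Cmod_ge_0 | exact: Cmod_ge_0 | lra].
    by split; apply: K; rewrite ?Rabs_Ropp Rabs_pos_eq; lra.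
  have S3 : Rabs (vint f (11 / 20) T) <= B.
    have -> : B = 36000 * exp (11 / 20 * u) * h * (16 / 5 * ln (/ h) ^ 2 + 34 * ln (/ h) + 88) by [].
    apply: (kernel_integral_bound _ (36000 * exp (11 / 20 * u)) h T) => //.
    - by have := exp_pos (11 / 20 * u); lra.
    - by apply: (if_ _ _ _ _ Hff); lra.
    - move=> t x Hx Hx1 Hx2 Hx3.
      have [k1 k2] := Cmod_Kd u h (11 / 20) t x Hh Hh1 erefl Hx Hx3.
      have g1 := Gz_bound RH (11 / 20) t ltac:(lra).
      have L : Rabs (Re (f (11 / 20, t))) <= Cmod (Gz (11 / 20, t)) * Cmod (Kd u h (11 / 20, t)).
        by rewrite Ef -Cmod_mult; exact: re_le_Cmod.
      split; apply: Rle_trans L _.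
        have -> : 36000 * exp (11 / 20 * u) * growth t * (8 / 5 * h / x) = 36000 * growth t * (exp (11 / 20 * u) * (8 / 5 * h / x)) by ring.
        by apply: Rmult_le_compat => //; exact: Cmod_ge_0.
      have -> : 36000 * exp (11 / 20 * u) * growth t * (21 / 10 / x ^ 2) = 36000 * growth t * (exp (11 / 20 * u) * (21 / 10 / x ^ 2)) by ring.
      by apply: Rmult_le_compat => //; exact: Cmod_ge_0.
  have -> : 2 * PI * Rabs X = Rabs (2 * PI * X) by rewrite Rabs_mult (Rabs_pos_eq (2 * PI)) //; lra.
  have E1 : (Cu + Cv + Cs) / T = Cu / T + Cv / T + 2 * (36000 * 14 * (e1 + e2) / T) * (2 - 11 / 20) by rewrite /Cs; field; lra.
  move: A1 A2 S2 S3 => /Rabs_le_between A1 /Rabs_le_between A2 /Rabs_le_between S2 /Rabs_le_between S3.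
  have EX : 2 * PI * X = 2 * PI * (Aint (u + h) M - (exp (u + h) - 1 - (u + h))) - 2 * PI * (Aint u M - (exp u - 1 - u)) by rewrite /X; ring.
  apply: Rabs_le; rewrite E1 EX; lra.
apply: le_epsilon => e He.
(* The constant depends on u and h but not on T, which is chosen last. *)
set Ct := Cu + Cv + Cs in key *.
have C0 : 0 < Rabs Ct + 1 by have := Rabs_pos Ct; lra.
set T := Rmax (/ h) ((Rabs Ct + 1) / e).
have T1 : / h <= T by apply: Rmax_l.
have T0 : 0 < T by apply: Rlt_le_trans T1; apply: Rinv_0_lt_compat.
have T2 : (Rabs Ct + 1) / e <= T by apply: Rmax_r.
apply: Rle_trans (key T T1) _.
have : Ct / T <= e.
  apply/Rle_div_l => //; move: T2 => /(Rle_div_l _ _ _ He) T2; have := Rle_abs Ct; lra.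
lra.
Qed.

Definition psi (N : nat) : R := rsum mangoldt N.
Definition psi_error (t : R) : R := 1400000 * exp (3 / 5 * ln t).

(** The squared logarithm is paid for by raising the exponent from 11/20 to 3/5. The gain exp (X /
    20) is at least e^2 at X = 40 and grows faster than the quadratic afterwards; 2 * 3 is a lower
    bound for 2 PI. *)
Lemma error_constant X : 40 <= X ->
  36000 * exp (11 / 20 * X) * (16 / 5 * (2 / 5 * X) ^ 2 + 34 * (2 / 5 * X) + 88) <= 2 * 3 * (1300000 * exp (3 / 5 * X)).
Proof.
move=> HX; set y := (X - 40) / 20; have Hy : 0 <= y by rewrite /y; lra.
have EX : X = 40 + 20 * y by rewrite /y; field.
have E1 : exp (3 / 5 * X) = exp (11 / 20 * X) * (exp 2 * (exp (y / 2) * exp (y / 2))).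
  by rewrite -!exp_plus; congr exp; rewrite EX; field.
have e2 : 69 / 10 <= exp 2.
  have := pow_le_exp 32 (/ 16) ltac:(lra).
  have -> : INR 32 * / 16 = 2 by rewrite /=; field.
  lra.
have ey := exp_ineq1_le (y / 2).
have e0 := exp_pos (11 / 20 * X).
have K : 6000 * (16 / 5 * (2 / 5 * X) ^ 2 + 34 * (2 / 5 * X) + 88) <= 1300000 * (exp 2 * (exp (y / 2) * exp (y / 2))).
  have : (1 + y / 2) * (1 + y / 2) <= exp (y / 2) * exp (y / 2) by apply: Rmult_le_compat; lra.
  move=> Q.
  have : 69 / 10 * ((1 + y / 2) * (1 + y / 2)) <= exp 2 * (exp (y / 2) * exp (y / 2)) by apply: Rmult_le_compat; nra.
  rewrite EX; nra.
rewrite E1; nra.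
Qed.

(** The difference is the integral of psi (exp v) over [u, u + h]; as psi does not decrease, it lies
    between h times the values at the two ends. This is applied with exp u = N here and exp (u + h)
    = N in [Aint_diff_upper]. *)
Lemma Aint_diff_lower u h N M : 0 < h -> (N <= M)%nat -> ln (INR N) <= u -> h * psi N <= Aint (u + h) M - Aint u M.
Proof.
move=> Hh HN Hu.
have -> : Aint (u + h) M - Aint u M = rsum (fun n => mangoldt n * (Rmax 0 (u + h - ln (INR n)) - Rmax 0 (u - ln (INR n)))) M.
  rewrite (rsum_ext _ (fun n => mangoldt n * Rmax 0 (u + h - ln (INR n)) + -1 * (mangoldt n * Rmax 0 (u - ln (INR n))))).
    by rewrite rsum_plus rsum_scal /Aint; ring.
  by move=> n _; ring.
have -> : h * psi N = rsum (fun n => if (n <= N)%nat then h * mangoldt n else 0) M.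
  rewrite (rsum_extend _ N M) //; last by move=> i Hi; rewrite ifF //; apply/negP; lia.
  rewrite /psi -rsum_scal; apply: rsum_ext => n harmonic; rewrite ifT //; lia.
apply: rsum_le => n harmonic; have L0 := mangoldt_ge0 n.
case: ifP => Hc.
  have : ln (INR n) <= ln (INR N) by apply: ln_le; [apply: lt_0_INR; lia | apply: le_INR; lia].
  move=> L; rewrite !Rmax_right; [|lra|lra]; apply: Req_le; ring.
apply: Rmult_le_pos => //.
have := Rle_max_compat_l (u - ln (INR n)) (u + h - ln (INR n)) 0 ltac:(lra); lra.
Qed.

Lemma Aint_diff_upper u h N M : 0 < h -> (N <= M)%nat -> u + h = ln (INR N) -> (0 < N)%nat -> Aint (u + h) M - Aint u M <= h * psi N.
Proof.
move=> Hh HN Hu N0.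
have -> : Aint (u + h) M - Aint u M = rsum (fun n => mangoldt n * (Rmax 0 (u + h - ln (INR n)) - Rmax 0 (u - ln (INR n)))) M.
  rewrite (rsum_ext _ (fun n => mangoldt n * Rmax 0 (u + h - ln (INR n)) + -1 * (mangoldt n * Rmax 0 (u - ln (INR n))))).
    by rewrite rsum_plus rsum_scal /Aint; ring.
  by move=> n _; ring.
have -> : h * psi N = rsum (fun n => if (n <= N)%nat then h * mangoldt n else 0) M.
  rewrite (rsum_extend _ N M) //; last by move=> i Hi; rewrite ifF //; apply/negP; lia.
  rewrite /psi -rsum_scal; apply: rsum_ext => n harmonic; rewrite ifT //; lia.
apply: rsum_le => n harmonic; have L0 := mangoldt_ge0 n.
case: ifP => Hc.
  rewrite Rmult_comm; apply: Rmult_le_compat_r => //.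
  have A := Rmax_l 0 (u - ln (INR n)); have B := Rmax_r 0 (u - ln (INR n)).
  by rewrite {1}/Rmax; case: Rle_dec => _; lra.
have : ln (INR N) <= ln (INR n).
  have Hlt : (N < n)%nat by rewrite ltnNge Hc.
  apply: ln_le; [apply: lt_0_INR; lia | apply: le_INR; lia].
move=> L; rewrite !Rmax_left; [|lra|lra]; apply: Req_le; ring.
Qed.

(** With x = N, the step h = x^(-2/5) makes the smoothing error x h equal to x^(3/5), the size of
    the analytic error. Increments to the right of ln N bound psi from above, increments to its left
    from below. *)
Lemma psi_bound (RH : RiemannHypothesis) N : 40 <= ln (INR N) -> Rabs (psi N - INR N) <= psi_error (INR N).
Proof.
move=> HX; set X := ln (INR N) in HX *.
have N0 : (0 < N)%nat by case: (N) @X HX => // X; rewrite /X /= /ln; case: Rlt_dec => // H; [case: (Rlt_irrefl _ H) | lra].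
have PN : 0 < INR N by apply: lt_0_INR; lia.
set h := exp (- (2 / 5 * X)).
have h0 : 0 < h by exact: exp_pos.
have h1 : h <= / 100.
  rewrite /h exp_Ropp; apply: Rinv_le_contravar; first lra.
  have : (1 + 1) ^ 16 <= exp (INR 16 * 1) by apply: pow_le_exp; lra.
  have : exp (INR 16 * 1) <= exp (2 / 5 * X) by apply: exp_mono; rewrite /=; lra.
  lra.
have lh : ln (/ h) = 2 / 5 * X by rewrite /h -exp_Ropp ln_exp; ring.
have EN : exp X = INR N by rewrite exp_ln.
have Nh : INR N * h = exp (3 / 5 * X) by rewrite -EN /h -exp_plus; congr exp; field.
have X6 : 1 <= exp (3 / 5 * X) by rewrite -exp_0; apply: exp_mono; lra.
have [t1a t1b] := exp_taylor1 h ltac:(rewrite Rabs_pos_eq; lra).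
have [t2a t2b] := exp_taylor1 (- h) ltac:(rewrite Rabs_Ropp Rabs_pos_eq; lra).
have P3 : 3 <= PI by have := PI2_3_2; lra.
have EC := error_constant X HX.
have [M HM] := INR_unbounded (exp (X + h)).
have HNM : (N <= M)%nat.
  apply/leP; apply: INR_le; rewrite -EN; apply: Rlt_le; apply: Rlt_trans HM; apply: exp_increasing; lra.
have fin : forall u, 0 <= u <= X -> exp (u + h) <= INR M ->
    Rabs (Aint (u + h) M - Aint u M - (exp (u + h) - exp u - h)) <= h * (1300000 * exp (3 / 5 * X)).
  move=> u Hu HuM.
  have K := Aint_increment RH u h M (proj1 Hu) h0 h1 HuM.
  rewrite lh in K.
  have U : exp (11 / 20 * u) <= exp (11 / 20 * X) by apply: exp_mono; lra.
  set Q := 16 / 5 * (2 / 5 * X) ^ 2 + 34 * (2 / 5 * X) + 88 in K EC.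
  have Q0 : 0 <= Q by rewrite /Q; nra.
  have K2 : 36000 * exp (11 / 20 * u) * h * Q <= h * (36000 * exp (11 / 20 * X) * Q).
    have -> : h * (36000 * exp (11 / 20 * X) * Q) = exp (11 / 20 * X) * (36000 * h * Q) by ring.
    have -> : 36000 * exp (11 / 20 * u) * h * Q = exp (11 / 20 * u) * (36000 * h * Q) by ring.
    apply: Rmult_le_compat_r => //; apply: Rmult_le_pos => //; lra.
  have K3 : h * (36000 * exp (11 / 20 * X) * Q) <= h * (2 * 3 * (1300000 * exp (3 / 5 * X))).
    by apply: Rmult_le_compat_l => //; lra.
  set Z := Rabs _ in K *.
  have Z0 : 0 <= Z by exact: Rabs_pos.
  nra.
have up : psi N - INR N <= 1300000 * exp (3 / 5 * X) + 2 * exp (3 / 5 * X).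
  have L := Aint_diff_lower X h N M h0 HNM (Rle_refl _).
  have := fin X ltac:(lra) (Rlt_le _ _ HM) => /Rabs_le_between [_ F].
  rewrite exp_plus EN in F.
  apply: (Rmult_le_reg_l h) => //.
  have : INR N * exp h <= INR N * (1 + h + 2 * h ^ 2) by apply: Rmult_le_compat_l; lra.
  have : INR N * (2 * h ^ 2) = h * (2 * exp (3 / 5 * X)) by rewrite -Nh; ring.
  nra.
have lo : - (1300000 * exp (3 / 5 * X) + 2 * exp (3 / 5 * X) + 1) <= psi N - INR N.
  have Eu : X - h + h = X by ring.
  have L := Aint_diff_upper (X - h) h N M h0 HNM Eu N0.
  have := fin (X - h) ltac:(lra) ltac:(rewrite Eu; apply: Rlt_le; apply: Rle_lt_trans HM; apply: exp_mono; lra) => /Rabs_le_between [F _].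
  rewrite Eu in L F.
  have E3 : exp (X - h) = INR N * exp (- h) by rewrite -EN -exp_plus.
  rewrite E3 EN in F.
  apply: (Rmult_le_reg_l h) => //.
  have : INR N * exp (- h) <= INR N * (1 - h + 2 * h ^ 2).
    apply: Rmult_le_compat_l; first lra. have : (- h) ^ 2 = h ^ 2 by ring. lra.
  have : INR N * (2 * h ^ 2) = h * (2 * exp (3 / 5 * X)) by rewrite -Nh; ring.
  nra.
rewrite /psi_error -/X; apply: Rabs_le; lra.
Qed.

(** * Partial summation *)

(** Prime powers are kept, with weight 1 / j at p^j, in this sum and in [mertens_sum], so both come
    from psi by partial summation alone; primes are singled out only at the end. *)
Definition riemann_pi (N : nat) : R := rsum mangoldt_log N.
Definition mertens_sum (N : nat) : R := rsum (fun n => mangoldt_log n / INR n) N.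

(* The asymptotic expansion of li, with last coefficient 28 instead of 24 so that the derivative exceeds [/ ln t] for [ln t >= 35]. *)
Definition li_majorant (t : R) : R :=
  t * (/ ln t + / ln t ^ 2 + 2 / ln t ^ 3 + 6 / ln t ^ 4 + 28 / ln t ^ 5).

Lemma is_derive_li_majorant t : 1 < t -> is_derive li_majorant t (/ ln t + 4 / ln t ^ 5 - 140 / ln t ^ 6).
Proof.
move=> Ht; have l0 : 0 < ln t by rewrite -ln_1; apply: ln_increasing; lra.
rewrite /li_majorant; auto_derive; last by field; lra.
have p : forall n, ln t ^ n <> 0 by move=> n; apply: pow_nonzero; lra.
have := p 2%nat; have := p 3%nat; have := p 4%nat; have := p 5%nat; rewrite /=.
repeat split => //; lra.
Qed.

Lemma is_derive_psi_error t : 0 < t -> is_derive psi_error t (3 / 5 * psi_error t / t).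
Proof. move=> Ht; rewrite /psi_error; auto_derive => //; field; lra. Qed.

Lemma psi_error_pos t : 0 < psi_error t.
Proof. rewrite /psi_error; have := exp_pos (3 / 5 * ln t); lra. Qed.

Lemma psi_error_mono a b : 0 < a -> a <= b -> psi_error a <= psi_error b.
Proof.
move=> Ha Hab; rewrite /psi_error; have : exp (3 / 5 * ln a) <= exp (3 / 5 * ln b); last lra.
by apply: exp_mono; have := ln_le _ _ Ha Hab; lra.
Qed.

Lemma ln_ge_gt1 x y : 0 < x -> x <= ln y -> 1 < y.
Proof.
move=> Hx Hy; apply: Rnot_le_lt => H.
case: (Rlt_dec 0 y) => H0; first by have := ln_le _ _ H0 H; rewrite ln_1; lra.
move: Hy; rewrite /ln; case: Rlt_dec => //; lra.
Qed.

(** One step of partial summation. With the divisor L = ln (N + 1) frozen, the claim is that a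
    function increases on [N, N + 1]. The factor 2 before psi_error / ln contributes 6/5 where 3/5
    is needed, and the surplus covers the derivative of 1 / ln. *)
Lemma li_majorant_increment N : 40 <= ln (INR N) ->
  (INR N.+1 + psi_error (INR N.+1) - (INR N + psi_error (INR N))) / ln (INR N.+1) <=
  (li_majorant (INR N.+1) + 2 * psi_error (INR N.+1) / ln (INR N.+1)) - (li_majorant (INR N) + 2 * psi_error (INR N) / ln (INR N)).
Proof.
move=> HN; have N1 := ln_ge_gt1 40 _ ltac:(lra) HN.
rewrite S_INR; set n := INR N in HN N1 *; set L := ln (n + 1).
have HL : 40 <= L by apply: Rle_trans HN _; apply: ln_le; lra.
pose f := fun t => li_majorant t + 2 * psi_error t / ln t - (t + psi_error t) / L.
suff : f n <= f (n + 1).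
  rewrite /f -/L => H.
  have -> : (n + 1 + psi_error (n + 1) - (n + psi_error n)) / L = (n + 1 + psi_error (n + 1)) / L - (n + psi_error n) / L by field; lra.
  lra.
apply: (deriv_nonneg f (fun t => (/ ln t + 4 / ln t ^ 5 - 140 / ln t ^ 6) + (2 * (3 / 5 * psi_error t / t) / ln t - 2 * psi_error t / (t * ln t ^ 2)) - (1 + 3 / 5 * psi_error t / t) / L)); first lra.
- move=> t Ht; have lt : 40 <= ln t by apply: Rle_trans HN _; apply: ln_le; lra.
  have D1 := is_derive_li_majorant t ltac:(lra); have D2 := is_derive_psi_error t ltac:(lra).
  have D3 : is_derive (fun t => / ln t) t (- (/ t) / ln t ^ 2) by auto_derive; [split; lra | field; lra].
  have D4 := is_derive_mult _ _ _ _ _ (is_derive_scal psi_error t 2 _ D2) D3 Rmult_comm.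
  have D5 := is_derive_scal _ t (/ L) _ (is_derive_plus _ _ _ _ _ (is_derive_id t) D2).
  have D6 := is_derive_minus _ _ _ _ _ (is_derive_plus _ _ _ _ _ D1 D4) D5.
  have E1 : minus (plus (/ ln t + 4 / ln t ^ 5 - 140 / ln t ^ 6) (plus (mult (2 * (3 / 5 * psi_error t / t)) (/ ln t)) (mult (2 * psi_error t) (- / t / ln t ^ 2)))) (/ L * (plus 1 (3 / 5 * psi_error t / t)))
   = (/ ln t + 4 / ln t ^ 5 - 140 / ln t ^ 6) + (2 * (3 / 5 * psi_error t / t) / ln t - 2 * psi_error t / (t * ln t ^ 2)) - (1 + 3 / 5 * psi_error t / t) / L.
    rewrite /minus /plus /opp /mult /=; field; lra.
  rewrite -E1; apply: is_derive_ext D6 => y.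
  rewrite /f /minus /plus /opp /mult /Rdiv /= /mult /=; ring.
- move=> t Ht; have lt : 40 <= ln t by apply: Rle_trans HN _; apply: ln_le; lra.
  have lL : ln t <= L by apply: ln_le; lra.
  have I : / L <= / ln t by apply: Rinv_le_contravar; lra.
  have e0 := psi_error_pos t.
  set q := psi_error t / t.
  have q0 : 0 < q by apply: Rdiv_lt_0_compat; lra.
  have i0 : 0 < / ln t by apply: Rinv_0_lt_compat; lra.
  have i1 : / ln t <= / 40 by apply: Rinv_le_contravar; lra.
  set i := / ln t in I i0 i1 *.
  have -> : i + 4 / ln t ^ 5 - 140 / ln t ^ 6 = i + i ^ 5 * (4 - 140 * i) by rewrite /i; field; lra.
  have -> : 2 * (3 / 5 * psi_error t / t) / ln t - 2 * psi_error t / (t * ln t ^ 2) = q * (6 / 5 * i - 2 * i * i) by rewrite /q /i; field; lra.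
  have -> : (1 + 3 / 5 * psi_error t / t) / L = (1 + 3 / 5 * q) * / L by rewrite /q /Rdiv; ring.
  have i5 : 0 <= i ^ 5 by apply: pow_le; lra.
  have A : 0 <= i ^ 5 * (4 - 140 * i) by apply: Rmult_le_pos; lra.
  have B : (1 + 3 / 5 * q) * / L <= (1 + 3 / 5 * q) * i by apply: Rmult_le_compat_l; lra.
  have C0 : 0 <= q * i * (3 / 5 - 2 * i) by apply: Rmult_le_pos; [apply: Rmult_le_pos; lra | lra].
  nra.
Qed.

Lemma riemann_pi_le (RH : RiemannHypothesis) n0 N : 40 <= ln (INR n0) -> (n0 <= N)%nat ->
  riemann_pi N <= li_majorant (INR N) + 2 * psi_error (INR N) / ln (INR N) + INR n0.
Proof.
move=> H0 HN.
have lN : forall n, (n0 <= n)%nat -> 40 <= ln (INR n).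
  move=> n harmonic; apply: (Rle_trans _ _ _ H0); apply: ln_le; last by apply: le_INR; lia.
  have := ln_ge_gt1 40 _ ltac:(lra) H0; lra.
(* The added quotient is nonpositive by [psi_bound]. It is the boundary term of the partial
   summation and makes the claim inductive: its change contains the new term of [riemann_pi]. *)
suff K : riemann_pi N <= li_majorant (INR N) + 2 * psi_error (INR N) / ln (INR N) + INR n0 + (psi N - (INR N + psi_error (INR N))) / ln (INR N).
  have P := psi_bound RH N (lN N HN); move: P => /Rabs_le_between [_ P].
  have : (psi N - (INR N + psi_error (INR N))) / ln (INR N) <= 0.
    have I : 0 < / ln (INR N) by apply: Rinv_0_lt_compat; have := lN N HN; lra.
    rewrite /Rdiv; nra.
  lra.
elim: N HN => [|N IH] HN.
  have : n0 = 0%nat by lia.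
  by move=> E; move: H0; rewrite E /= => /(ln_ge_gt1 40 0 ltac:(lra)); lra.
case: (leqP n0 N) => Hc; last first.
  have -> : N.+1 = n0 by lia.
  have Pn : riemann_pi n0 <= INR n0.
    rewrite /riemann_pi; elim: (n0) => [|k IHk]; first by rewrite /=; lra.
    rewrite rsum_S S_INR; have := mangoldt_log_le1 k.+1; lra.
  have P := psi_bound RH n0 H0; move: P => /Rabs_le_between [P _].
  have I : 0 < / ln (INR n0) by apply: Rinv_0_lt_compat; lra.
  have Q : - (2 * psi_error (INR n0)) * / ln (INR n0) <= (psi n0 - (INR n0 + psi_error (INR n0))) * / ln (INR n0).
    by apply: Rmult_le_compat_r; lra.
  have m0 : 0 <= li_majorant (INR n0).
    have n1 := ln_ge_gt1 40 _ ltac:(lra) H0.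
    rewrite /li_majorant /Rdiv; apply: Rmult_le_pos; first lra.
    have p : forall j, 0 < / ln (INR n0) ^ j by move=> j; apply: Rinv_0_lt_compat; apply: pow_lt; lra.
    have := p 2%nat; have := p 3%nat; have := p 4%nat; have := p 5%nat; lra.
  rewrite /Rdiv in Q *; lra.
have St := li_majorant_increment N (lN N Hc).
have := IH Hc; have L1 := lN N Hc; have L2 := lN N.+1 ltac:(lia).
have Lm : ln (INR N) <= ln (INR N.+1).
  by apply: ln_le; [have := ln_ge_gt1 40 _ ltac:(lra) L1; lra | apply: le_INR; lia].
have -> : riemann_pi N.+1 = riemann_pi N + mangoldt_log N.+1 by [].
have Ea : mangoldt_log N.+1 = mangoldt N.+1 / ln (INR N.+1) by rewrite mangoldt_logE; field; lra.
have Ep : psi N.+1 = psi N + mangoldt N.+1 by [].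
have P := psi_bound RH N L1; move: P => /Rabs_le_between [_ P].
have Neg : (psi N - (INR N + psi_error (INR N))) / ln (INR N) <= (psi N - (INR N + psi_error (INR N))) / ln (INR N.+1).
  have I : / ln (INR N.+1) <= / ln (INR N) by apply: Rinv_le_contravar; lra.
  rewrite /Rdiv; nra.
rewrite Ea Ep => IHN.
have E : (psi N + mangoldt N.+1 - (INR N.+1 + psi_error (INR N.+1))) / ln (INR N.+1) =
  (psi N - (INR N + psi_error (INR N))) / ln (INR N.+1) + mangoldt N.+1 / ln (INR N.+1) - (INR N.+1 + psi_error (INR N.+1) - (INR N + psi_error (INR N))) / ln (INR N.+1) by field; lra.
lra.
Qed.

Definition Vt (t : R) : R := 5 / 2 * psi_error t / (t * ln t).
(* [Wn] removes the boundary term of the partial summation of [psi N - N]; [Vt] (above) dominates the remaining tail. *)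
Definition Wn (N : nat) : R := mertens_sum N - (psi N - INR N) / (INR N * ln (INR N)) - ln (ln (INR N)).

(** With r t = 1 / (t ln t), n = N and m = N + 1, the step changes [Wn] by (psi N - n) (r n - r m) +
    r m - (ln ln m - ln ln n). The decrease of [Vt] pays for the first part; the rest is nonpositive
    because r, the derivative of ln ln, decreases. *)
Lemma Wn_step (RH : RiemannHypothesis) N : 40 <= ln (INR N) -> Wn N.+1 + Vt (INR N.+1) <= Wn N + Vt (INR N).
Proof.
move=> HN; have N1 := ln_ge_gt1 40 _ ltac:(lra) HN.
have P := psi_bound RH N HN.
have EN := S_INR N.
have HN1 : 40 <= ln (INR N.+1) by apply: Rle_trans HN _; apply: ln_le; lra.
set n := INR N in HN N1 P EN *; set m := INR N.+1 in EN HN1 *.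
have lt40 : forall t, n <= t <= n + 1 -> 40 <= ln t by move=> t Ht; apply: Rle_trans HN _; apply: ln_le; lra.
pose r := fun t => / (t * ln t).
have Dr : forall t, n <= t <= n + 1 -> is_derive r t (- ((ln t + 1) / (t ^ 2 * ln t ^ 2))).
  move=> t Ht; have L := lt40 t Ht; rewrite /r; auto_derive; last by field; lra.
  split; first lra. split=> //; apply: Rgt_not_eq; apply: Rmult_lt_0_compat; lra.
(* As [psi_error] is of order t^(3/5), the coefficient 5/2 = 1 / (1 - 3/5) makes the leading terms
   of - Vt' and - psi_error r' agree. *)
have DV : forall t, n <= t <= n + 1 -> is_derive Vt t (- (5 / 2 * (psi_error t / t ^ 2) * (2 / 5 / ln t + / ln t ^ 2))).
  move=> t Ht; have L := lt40 t Ht.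
  have D := is_derive_mult _ _ _ _ _ (is_derive_scal psi_error t (5 / 2) _ (is_derive_psi_error t ltac:(lra))) (Dr t Ht) Rmult_comm.
  have E1 : plus (mult (5 / 2 * (3 / 5 * psi_error t / t)) (r t)) (mult (5 / 2 * psi_error t) (- ((ln t + 1) / (t ^ 2 * ln t ^ 2)))) =
     - (5 / 2 * (psi_error t / t ^ 2) * (2 / 5 / ln t + / ln t ^ 2)).
    rewrite /plus /mult /= /r; field; lra.
  rewrite -E1; apply: is_derive_ext D => y; rewrite /Vt /r /Rdiv /mult /=; ring.
have A : psi_error n * (r n - r m) <= Vt n - Vt m.
  have := deriv_nonneg (fun t => psi_error n * r t - Vt t) (fun t => psi_error n * - ((ln t + 1) / (t ^ 2 * ln t ^ 2)) - - (5 / 2 * (psi_error t / t ^ 2) * (2 / 5 / ln t + / ln t ^ 2))) n (n + 1) ltac:(lra).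
  rewrite -EN => K.
  have : psi_error n * r n - Vt n <= psi_error n * r m - Vt m.
    apply: K => t Ht; rewrite EN in Ht.
      exact: (is_derive_minus _ _ _ _ _ (is_derive_scal r t (psi_error n) _ (Dr t Ht)) (DV t Ht)).
    have L := lt40 t Ht.
    have em : psi_error n <= psi_error t by apply: psi_error_mono; lra.
    have e0 := psi_error_pos n.
    have i0 : 0 < / ln t by apply: Rinv_0_lt_compat; lra.
    have t0 : 0 < / t ^ 2 by apply: Rinv_0_lt_compat; nra.
    set i := / ln t in i0 *; set w := / t ^ 2 in t0 *.
    have -> : (ln t + 1) / (t ^ 2 * ln t ^ 2) = w * (i + i * i) by rewrite /w /i; field; lra.
    have -> : 5 / 2 * (psi_error t / t ^ 2) * (2 / 5 / ln t + / ln t ^ 2) = psi_error t * (w * (i + 5 / 2 * (i * i))) by rewrite /w /i; field; lra.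
    have ii : 0 < i * i by nra.
    have : psi_error n * (w * (i + i * i)) <= psi_error t * (w * (i + 5 / 2 * (i * i))).
      apply: Rmult_le_compat; [lra | nra | lra |].
      apply: Rmult_le_compat_l; lra.
    lra.
  lra.
have B : r m <= ln (ln m) - ln (ln n).
  have := deriv_nonneg (fun t => ln (ln t) - r m * t) (fun t => r t - r m) n (n + 1) ltac:(lra).
  rewrite -EN => K.
  have : ln (ln n) - r m * n <= ln (ln m) - r m * m.
    apply: K => t Ht; rewrite EN in Ht; have L := lt40 t Ht.
      by rewrite /r; auto_derive; [split; lra | field; split; [rewrite -/m | ]; nra].
    suff : r m <= r t by lra.
    have Lm : ln t <= ln m by apply: ln_le; lra.
    apply: Rinv_le_contravar; first by apply: Rmult_lt_0_compat; lra.
    apply: Rmult_le_compat; lra.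
  rewrite EN; lra.
have Cr : r m <= r n.
  have Lm : ln n <= ln m by apply: ln_le; lra.
  apply: Rinv_le_contravar; first by apply: Rmult_lt_0_compat; lra.
  apply: Rmult_le_compat; lra.
have F : (psi N - n) * (r n - r m) <= psi_error n * (r n - r m).
  apply: Rmult_le_compat_r; first lra. by move: P => /Rabs_le_between; lra.
rewrite /Wn -/n -/m.
have -> : mertens_sum N.+1 = mertens_sum N + mangoldt_log N.+1 / m by [].
have Ea : mangoldt_log N.+1 / m = mangoldt N.+1 * r m.
  by rewrite mangoldt_logE -/m /r; field; lra.
have Ep : psi N.+1 = psi N + mangoldt N.+1 by [].
have E1 : (psi N.+1 - m) / (m * ln m) = (psi N - n) * r m + mangoldt N.+1 * r m - r m.
  rewrite Ep /r EN; field; rewrite -EN; lra.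
have E2 : (psi N - n) / (n * ln n) = (psi N - n) * r n by [].
rewrite Ea E1 E2; lra.
Qed.

Lemma mertens_sum_upper (RH : RiemannHypothesis) N Y : 40 <= ln (INR N) -> (N <= Y)%nat ->
  mertens_sum Y <= ln (ln (INR Y)) + (Wn N + Vt (INR N)) + psi_error (INR Y) / (INR Y * ln (INR Y)).
Proof.
move=> HN HY.
have lN : forall n, (N <= n)%nat -> 40 <= ln (INR n).
  move=> n harmonic; apply: (Rle_trans _ _ _ HN); apply: ln_le; last by apply: le_INR; lia.
  have := ln_ge_gt1 40 _ ltac:(lra) HN; lra.
have K : Wn Y + Vt (INR Y) <= Wn N + Vt (INR N).
  elim: Y HY => [|Y IH]; first by rewrite leqn0 => /eqP ->; apply: Rle_refl.
  rewrite leq_eqVlt => /orP [/eqP ->|H]; first exact: Rle_refl.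
  have := IH ltac:(lia); have := Wn_step RH Y (lN Y ltac:(lia)); lra.
have L := lN Y HY; have Y1 := ln_ge_gt1 40 _ ltac:(lra) L.
have I : 0 < / (INR Y * ln (INR Y)) by apply: Rinv_0_lt_compat; apply: Rmult_lt_0_compat; lra.
have V0 : 0 <= Vt (INR Y).
  by rewrite /Vt /Rdiv; apply: Rmult_le_pos; [have := psi_error_pos (INR Y); lra | lra].
have P := psi_bound RH Y L; move: P => /Rabs_le_between [_ P].
have : (psi Y - INR Y) / (INR Y * ln (INR Y)) <= psi_error (INR Y) / (INR Y * ln (INR Y)).
  by apply: Rmult_le_compat_r; lra.
rewrite {1}/Wn in K; lra.
Qed.

(** * The constant in Mertens' theorem *)

Definition harmonic (m : nat) : R := rsum (fun j => / INR j) m.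

(** The defining sequence decreases and stays nonnegative, so its [Lim_seq] is a finite limit and
    lies below every term. *)
Lemma euler_gamma_le m : (0 < m)%nat -> euler_gamma <= harmonic m - ln (INR m).
Proof.
move=> Hm.
set u := fun n : nat => sum_f_R0 (fun j => / INR (j + 1)) n - ln (INR (n + 1)).
have Eu : forall n, u n = harmonic n.+1 - ln (INR n.+1).
  move=> n; rewrite /u addn1; congr (_ - _).
  elim: n => [|n IH]; first by rewrite /= /harmonic /=; ring.
  by rewrite tech5 IH addn1.
have dec : forall n, u n.+1 <= u n.
  move=> n; rewrite !Eu /harmonic rsum_S.
  have P : 0 < INR n.+1 by apply: lt_0_INR; lia.
  have E : INR n.+2 = INR n.+1 + 1 by rewrite S_INR.
  have := exp_ineq1_le (ln (INR n.+1) - ln (INR n.+2)).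
  rewrite /Rminus exp_plus exp_Ropp !exp_ln; [|lra|lra].
  have -> : INR n.+1 * / INR n.+2 = 1 - / INR n.+2 by rewrite E; field; lra.
  lra.
have low : forall n, 0 <= u n.
  move=> n; rewrite Eu.
  suff : ln (INR n.+2) <= harmonic n.+1.
    have : ln (INR n.+1) <= ln (INR n.+2) by apply: ln_le; [apply: lt_0_INR; lia | apply: le_INR; lia].
    lra.
  elim: n => [|n IH].
    rewrite /harmonic /= Rplus_0_l Rinv_1; have := exp_ineq1_le 1 => H.
    by apply: (Rle_trans _ (ln (exp 1))); [apply: ln_le; lra | rewrite ln_exp; lra].
  have -> : harmonic n.+2 = harmonic n.+1 + / INR n.+2 by [].
  have P : 0 < INR n.+2 by apply: lt_0_INR; lia.
  have E : INR n.+3 = INR n.+2 + 1 by rewrite S_INR.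
  have := exp_ineq1_le (/ INR n.+2) => H.
  have : ln (INR n.+3) <= ln (INR n.+2) + / INR n.+2; last lra.
  rewrite -[X in _ <= _ + X](ln_exp (/ INR n.+2)) -ln_mult //; last exact: exp_pos.
  apply: ln_le; first lra.
  have : INR n.+2 * (1 + / INR n.+2) <= INR n.+2 * exp (/ INR n.+2) by apply: Rmult_le_compat_l; lra.
  have -> : INR n.+2 * (1 + / INR n.+2) = INR n.+2 + 1 by field; lra.
  lra.
have L : is_lim_seq u euler_gamma.
  apply: Lim_seq_correct'; exact: (ex_finite_lim_seq_decr u 0).
have := is_lim_seq_decr_compare u _ L dec m.-1.
by rewrite Eu prednK.
Qed.

Lemma log_series_le x N : 0 <= x < 1 -> rsum (fun j => x ^ j / INR j) N <= - ln (1 - x).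
Proof.
move=> Hx.
pose f := fun y => - ln (1 - y) - rsum (fun j => y ^ j / INR j) N.
have D : forall y, y < 1 -> is_derive f y (/ (1 - y) - rsum (fun j => y ^ j.-1) N).
  move=> y Hy.
  have D1 : is_derive (fun y => - ln (1 - y)) y (/ (1 - y)) by auto_derive; [lra | field; lra].
  have D2 : is_derive (fun y => rsum (fun j => y ^ j / INR j) N) y (rsum (fun j => y ^ j.-1) N).
    elim: (N) => [|n IH]; first exact: is_derive_const.
    have D3 : is_derive (fun y => y ^ n.+1 / INR n.+1) y (y ^ n).
      have P : INR n.+1 <> 0 by apply: not_0_INR.
      have P' : match n with 0%nat => 1 | _.+1 => INR n + 1 end <> 0 by [].
      auto_derive => //; rewrite -/(INR n.+1); field; exact: P.
    exact: (is_derive_plus _ _ _ _ _ IH D3).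
  exact: (is_derive_minus _ _ _ _ _ D1 D2).
have G : forall y M, (1 - y) * rsum (fun j => y ^ j.-1) M = 1 - y ^ M.
  by move=> y; elim=> [|n IH]; [rewrite /=; ring | rewrite rsum_S Rmult_plus_distr_l IH /=; ring].
have f0 : f 0 = 0.
  rewrite /f Rminus_0_r ln_1 rsum_eq0; first by ring.
  by move=> j Hj; case: j Hj => // j _; rewrite /= Rmult_0_l /Rdiv Rmult_0_l.
have : f 0 <= f x.
  apply: (deriv_nonneg f _ 0 x (proj1 Hx)) => [y Hy|y Hy]; first by apply: D; lra.
  have P : 0 < 1 - y by lra.
  have : rsum (fun j => y ^ j.-1) N = (1 - y ^ N) * / (1 - y) by rewrite -G; field; lra.
  move=> ->.
  have : 0 <= y ^ N * / (1 - y) by apply: Rmult_le_pos; [apply: pow_le; lra | apply: Rlt_le; apply: Rinv_0_lt_compat].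
  lra.
rewrite f0 /f; lra.
Qed.

(* The logarithmic derivative in s of the left side is at least that of the right side, by the convolution identity; both sides tend to 0 as s grows. *)
Lemma ln_partial_zeta_le N s : (0 < N)%nat -> 0 < s ->
  ln (rsum (fun n => rpow s (INR n)) N) <= rsum (fun d => mangoldt_log d * rpow s (INR d)) N.
Proof.
move=> HN Hs.
set F := fun y => rsum (fun n => rpow y (INR n)) N.
have F1 : forall y, 1 <= F y.
  move=> y; rewrite /F; case: (N) HN => // M _.
  elim: M => [|M IH]; first by rewrite /= /rpow ln_1 Rmult_0_r exp_0; lra.
  rewrite rsum_S; have := rpow_pos y (INR M.+2); lra.
pose f := fun y => ln (F y) - rsum (fun d => mangoldt_log d * rpow y (INR d)) N.
have Drp : forall n y, is_derive (fun y => rpow y (INR n)) y (- ln (INR n) * rpow y (INR n)).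
  by move=> n y; rewrite /rpow; auto_derive => //; ring.
have Dsum : forall (w : nat -> R) y M, is_derive (fun y => rsum (fun n => w n * rpow y (INR n)) M) y (- rsum (fun n => ln (INR n) * (w n * rpow y (INR n))) M).
  move=> w y; elim=> [|M IH]; first by rewrite /= Ropp_0; exact: is_derive_const.
  have := is_derive_plus _ _ _ _ _ IH (is_derive_scal _ y (w M.+1) _ (Drp M.+1 y)).
  rewrite !rsum_S /plus /=.
  have -> : - rsum (fun n => ln (INR n) * (w n * rpow y (INR n))) M + w M.+1 * (- ln (INR M.+1) * rpow y (INR M.+1)) =
   - (rsum (fun n => ln (INR n) * (w n * rpow y (INR n))) M + ln (INR M.+1) * (w M.+1 * rpow y (INR M.+1))) by ring.
  by [].
have DF : forall y, is_derive F y (- rsum (fun n => ln (INR n) * rpow y (INR n)) N).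
  move=> y; have := Dsum (fun _ => 1) y N.
  rewrite (rsum_ext (fun n => ln (INR n) * (1 * rpow y (INR n))) (fun n => ln (INR n) * rpow y (INR n))); last by move=> n _; rewrite Rmult_1_l.
  by apply: is_derive_ext => z; apply: rsum_ext => n _; rewrite Rmult_1_l.
have Df : forall y, is_derive f y (- rsum (fun n => ln (INR n) * rpow y (INR n)) N / F y + rsum (fun d => mangoldt d * rpow y (INR d)) N).
  move=> y.
  have D1 := is_derive_comp ln F y _ _ (is_derive_ln (F y) ltac:(have := F1 y; lra)) (DF y).
  have := is_derive_minus _ _ _ _ _ D1 (Dsum mangoldt_log y N).
  rewrite (rsum_ext (fun n => ln (INR n) * (mangoldt_log n * rpow y (INR n))) (fun d => mangoldt d * rpow y (INR d))); last by move=> n _; rewrite mangoldt_logE; ring.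
  rewrite /minus /plus /opp /scal /= /mult /= Ropp_involutive.
  by [].
have f' : forall y, 0 <= - rsum (fun n => ln (INR n) * rpow y (INR n)) N / F y + rsum (fun d => mangoldt d * rpow y (INR d)) N.
  move=> y; rewrite rsum_ln_convolution.
  suff : rsum (fun d => mangoldt d * rsum (fun m => rpow y (INR (d * m))) (N %/ d)) N / F y <= rsum (fun d => mangoldt d * rpow y (INR d)) N by rewrite /Rdiv; lra.
  apply/Rle_div_l; first by have := F1 y; lra.
  rewrite Rmult_comm -rsum_scal; apply: rsum_le => d Hd.
  have -> : F y * (mangoldt d * rpow y (INR d)) = mangoldt d * (rpow y (INR d) * F y) by ring.
  apply: Rmult_le_compat_l; first exact: mangoldt_ge0.
  rewrite /F -rsum_scal.
  have mono : forall g a b, (a <= b)%nat -> (forall n, 0 <= g n) -> rsum g a <= rsum g b.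
    move=> g a; elim=> [|b IH]; first by rewrite leqn0 => /eqP -> _; apply: Rle_refl.
    rewrite leq_eqVlt => /orP [/eqP -> _|Hb Hg]; first exact: Rle_refl.
    by rewrite rsum_S; have := IH Hb Hg; have := Hg b.+1; lra.
  apply: Rle_trans (mono _ _ N (leq_div N d) _); last first.
    by move=> n; apply: Rmult_le_pos; apply: Rlt_le; exact: rpow_pos.
  apply: rsum_le => m Hm; rewrite /rpow mult_INR ln_mult; [|apply: lt_0_INR; lia|apply: lt_0_INR; lia].
  by rewrite -exp_plus; apply: Req_le; congr exp; ring.
have key : forall S, s <= S -> f s <= f S.
  by move=> S HS; apply: (deriv_nonneg f _ s S HS (fun y _ => Df y)) => y _; exact: f'.
suff : f s <= 0 by rewrite /f /F; lra.
apply: le_epsilon => e He; rewrite Rplus_0_l.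
have PN : 0 < INR N by apply: lt_0_INR; lia.
have l2 : 0 < ln 2 by rewrite -ln_1; apply: ln_increasing; lra.
(* Large enough for 2^(-S) <= e / N, so that the terms after the first add up to at most e. *)
set S := Rmax s (Rmax 0 (- ln (e / INR N) / ln 2)).
have S1 : s <= S by apply: Rmax_l.
have S2 : 0 <= S by apply: Rle_trans (Rmax_l 0 _) (Rmax_r _ _).
have S3 : - ln (e / INR N) <= S * ln 2.
  apply/Rle_div_l => //; apply: Rle_trans (Rmax_r 0 _) (Rmax_r _ _).
apply: Rle_trans (key S S1) _.
have A : 0 <= rsum (fun d => mangoldt_log d * rpow S (INR d)) N.
  by apply: rsum_ge0 => d _; apply: Rmult_le_pos; [exact: mangoldt_log_ge0 | apply: Rlt_le; exact: rpow_pos].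
have B : ln (F S) <= F S - 1.
  have := exp_ineq1_le (ln (F S)); rewrite exp_ln; [lra | have := F1 S; lra].
have C0 : F S - 1 <= INR N * (e / INR N).
  have T : forall n, (2 <= n)%nat -> rpow S (INR n) <= e / INR N.
    move=> n harmonic.
    rewrite -(exp_ln (e / INR N)); last exact: Rdiv_lt_0_compat.
    apply: exp_mono.
    have : ln 2 <= ln (INR n) by apply: ln_le; [lra | have := le_INR 2 n ltac:(lia); rewrite /=; lra].
    nra.
  have q0 : 0 < e / INR N by exact: Rdiv_lt_0_compat.
  move: T q0; rewrite /F; move: (e / INR N) => q T q0; case: (N) HN => // M _.
  elim: M => [|M IH].
    rewrite /= /rpow ln_1 Rmult_0_r exp_0; lra.
  have -> : INR M.+2 * q = INR M.+1 * q + q by rewrite (S_INR M.+1); ring.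
  rewrite rsum_S; have := T M.+2 erefl; lra.
have -> : e = INR N * (e / INR N) by field; lra.
rewrite /f; lra.
Qed.

(** * Abel summation and partial sums of zeta near 1 *)

Lemma rsum_mono g a b : (a <= b)%nat -> (forall n, 0 <= g n) -> rsum g a <= rsum g b.
Proof.
elim: b => [|b IH]; first by rewrite leqn0 => /eqP -> _; apply: Rle_refl.
rewrite leq_eqVlt => /orP [/eqP -> _|Hb Hg]; first exact: Rle_refl.
by rewrite rsum_S; have := IH Hb Hg; have := Hg b.+1; lra.
Qed.

Lemma rsum_diff_le f g k a b : (a <= b)%nat -> (forall n, (a < n <= b)%nat -> f n <= k * g n) ->
  rsum f b - rsum f a <= k * (rsum g b - rsum g a).
Proof.
elim: b => [|b IH]; first by rewrite leqn0 => /eqP -> _; lra.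
rewrite leq_eqVlt => /orP [/eqP -> _|Hb H]; first by lra.
rewrite !rsum_S; have := H b.+1 ltac:(lia).
have := IH Hb (fun n harmonic => H n ltac:(lia)); lra.
Qed.

Lemma abel_sum (D : nat -> R) r K : D 0%nat = 0 ->
  rsum (fun m => (D m - D m.-1) * r ^ m) K = D K * r ^ K.+1 + (1 - r) * rsum (fun m => D m * r ^ m) K.
Proof.
move=> D0; elim: K => [|K IH]; first by rewrite /= D0; ring.
by rewrite !rsum_S IH /=; ring.
Qed.

(** Only the indices up to m0 may exceed c1, each by at most B; after Abel summation their excess
    carries the factor 1 - r, which vanishes as r tends to 1. *)
Lemma abel_upper (D : nat -> R) (c1 B r : R) m0 K : D 0%nat = 0 -> 0 <= r < 1 -> 0 <= B ->
  (forall m, (m0 <= m)%nat -> D m <= c1) -> (forall m, D m <= c1 + B) -> (m0 <= K)%nat ->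
  rsum (fun m => (D m - D m.-1) * r ^ m) K <= c1 * r + (1 - r) * (B * INR m0).
Proof.
move=> D0 Hr HB H1 H2 HK; rewrite abel_sum //.
have rp : forall m, 0 <= r ^ m <= 1.
  move=> m; split; first by apply: pow_le; lra.
  by rewrite -(pow1 m); apply: pow_incr; lra.
have A : rsum (fun m => D m * r ^ m) K <= rsum (fun m => c1 * r ^ m + B * (if (m <= m0)%nat then 1 else 0)) K.
  apply: rsum_le => m Hm; have [p1 p2] := rp m; case: ifP => Hc.
    have := H2 m; nra.
  have := H1 m ltac:(lia); nra.
rewrite rsum_plus !rsum_scal rsum_leq_count // in A.
have G : (1 - r) * rsum (fun m => r ^ m) K = r - r ^ K.+1.
  by elim: (K) => [|n IH]; [rewrite /=; ring | rewrite rsum_S Rmult_plus_distr_l IH /=; ring].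
have : D K * r ^ K.+1 <= c1 * r ^ K.+1 by apply: Rmult_le_compat_r; [case: (rp K.+1) | apply: H1].
have : (1 - r) * rsum (fun m => D m * r ^ m) K <= (1 - r) * (c1 * rsum (fun m => r ^ m) K + B * INR m0) by apply: Rmult_le_compat_l; [lra | exact: A].
have : (1 - r) * (c1 * rsum (fun m => r ^ m) K + B * INR m0) = c1 * (r - r ^ K.+1) + (1 - r) * (B * INR m0) by rewrite -G; ring.
lra.
Qed.

(** E m is the integer part of exp m. On the block between E (m - 1) and E m, n^(-d) is at most exp
    d * r^m with r = exp (- d). Block sums differ from 1 / m by the increments of D, which
    [abel_upper] handles, and the sums of r^m / m stay below - ln (1 - r). *)
Lemma partial_zeta_upper (c1 B d : R) (E : nat -> nat) m0 N :
  (forall m, INR (E m) <= exp (INR m) < INR (E m) + 1) ->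
  0 < d -> 0 <= B -> (forall m, (m0 <= m)%nat -> mertens_sum (E m) - harmonic m <= c1) -> (forall m, mertens_sum (E m) - harmonic m <= c1 + B) ->
  (0 < N)%nat ->
  ln (rsum (fun n => rpow (1 + d) (INR n)) N) <=
    exp d * (c1 * exp (- d) + (1 - exp (- d)) * (B * INR m0) - ln (1 - exp (- d))).
Proof.
move=> HE Hd HB H1 H2 HN.
set r := exp (- d).
have r0 : 0 < r by exact: exp_pos.
have r1 : r < 1 by rewrite -exp_0; apply: exp_increasing; lra.
set D := fun m => mertens_sum (E m) - harmonic m.
have E0 : E 0%nat = 1%nat.
  have [A B0] := HE 0%nat; rewrite exp_0 in A B0.
  have : (E 0%nat <= 1)%nat by apply/leP; apply: INR_le; rewrite /=; lra.
  case: (E 0%nat) B0 A => [|[|n]] //; rewrite /=; lra.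
have D0 : D 0%nat = 0 by rewrite /D E0 /mertens_sum /harmonic /= mangoldt_log_1; field.
apply: Rle_trans (ln_partial_zeta_le N (1 + d) HN ltac:(lra)) _.
have Ee : forall n, (0 < n)%nat -> mangoldt_log n * rpow (1 + d) (INR n) = mangoldt_log n / INR n * rpow d (INR n).
  move=> n harmonic; have P : 0 < INR n by apply: lt_0_INR; lia.
  rewrite /rpow; have -> : - (1 + d) * ln (INR n) = - ln (INR n) + - d * ln (INR n) by ring.
  rewrite exp_plus exp_Ropp exp_ln //; field; lra.
rewrite (rsum_ext _ (fun n => mangoldt_log n / INR n * rpow d (INR n))); last by move=> n harmonic; apply: Ee; lia.
have Epos : forall n, 0 <= mangoldt_log n / INR n * rpow d (INR n).
  move=> n; apply: Rmult_le_pos; last by apply: Rlt_le; exact: rpow_pos.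
  case: n => [|n]; first by rewrite /mangoldt_log /ppsum /= /Rdiv Rmult_0_l; lra.
  apply: Rmult_le_pos; [exact: mangoldt_log_ge0 | apply: Rlt_le; apply: Rinv_0_lt_compat; apply: lt_0_INR; lia].
set K := maxn N m0.
have NK : (N <= E K)%nat.
  have [_ B0] := HE K; have X := exp_ineq1_le (INR K).
  have : (K <= E K)%nat by apply/leP; apply: INR_le; lra.
  rewrite /K; lia.
apply: Rle_trans (rsum_mono _ _ _ NK Epos) _.
have Em : forall m, (E m <= E m.+1)%nat.
  move=> m; have [A _] := HE m; have [_ B0] := HE m.+1.
  have : exp (INR m) <= exp (INR m.+1) by apply: exp_mono; rewrite S_INR; lra.
  move=> X; have : INR (E m) < INR (E m.+1).+1 by rewrite S_INR; lra.
  move=> /INR_lt; lia.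
have T : forall k, rsum (fun n => mangoldt_log n / INR n * rpow d (INR n)) (E k) <= exp d * rsum (fun m => (mertens_sum (E m) - mertens_sum (E m.-1)) * r ^ m) k.
  elim=> [|k IH]; first by rewrite E0 /= mangoldt_log_1; lra.
  rewrite rsum_S Rmult_plus_distr_l.
  have := rsum_diff_le (fun n => mangoldt_log n / INR n * rpow d (INR n)) (fun n => mangoldt_log n / INR n) (exp d * r ^ k.+1) (E k) (E k.+1) (Em k).
  rewrite -/(mertens_sum (E k)) -/(mertens_sum (E k.+1)) => Q.
  have : rsum (fun n => mangoldt_log n / INR n * rpow d (INR n)) (E k.+1) - rsum (fun n => mangoldt_log n / INR n * rpow d (INR n)) (E k) <= exp d * r ^ k.+1 * (mertens_sum (E k.+1) - mertens_sum (E k)).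
    apply: Q => n harmonic; rewrite Rmult_comm; apply: Rmult_le_compat_r.
      apply: Rmult_le_pos; [exact: mangoldt_log_ge0 | apply: Rlt_le; apply: Rinv_0_lt_compat; apply: lt_0_INR; lia].
    have -> : exp d * r ^ k.+1 = exp (- d * INR k).
      rewrite /r -(exp_ln (exp (- d) ^ k.+1)); last by apply: pow_lt; exact: exp_pos.
      rewrite ln_pow; last exact: exp_pos. rewrite ln_exp -exp_plus S_INR; congr exp; ring.
    apply: exp_mono.
    have [_ L] := HE k.
    have : exp (INR k) <= INR n.
      apply: Rlt_le; apply: Rlt_le_trans L _; rewrite -S_INR; apply: le_INR; lia.
    move=> L2; have : INR k <= ln (INR n) by rewrite -(ln_exp (INR k)); apply: ln_le => //; exact: exp_pos.
    nra.
  rewrite [k.+1.-1]/=; lra.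
apply: Rle_trans (T K) _; apply: Rmult_le_compat_l; first by apply: Rlt_le; exact: exp_pos.
have Sd : rsum (fun m => (mertens_sum (E m) - mertens_sum (E m.-1)) * r ^ m) K = rsum (fun m => (D m - D m.-1) * r ^ m) K + rsum (fun m => r ^ m / INR m) K.
  rewrite -rsum_plus; apply: rsum_ext => m Hm; rewrite /D; case: m Hm => // m _.
  rewrite [m.+1.-1]/=; have -> : harmonic m.+1 = harmonic m + / INR m.+1 by [].
  rewrite /Rdiv; ring.
rewrite Sd.
have A := abel_upper D c1 B r m0 K D0 ltac:(lra) HB H1 H2 ltac:(rewrite /K; lia).
have L := log_series_le r K ltac:(lra); lra.
Qed.

Lemma zeta_real_limit d x : 0 < d -> (forall N, (0 < N)%nat -> rsum (fun n => rpow (1 + d) (INR n)) N <= x) ->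
  Re (Zs ((1 + d)%R, 0%R)) <= d * x.
Proof.
move=> Hd H.
have Hs : 1 < Re ((1 + d)%R, 0%R) by rewrite /=; lra.
have [L _] := proj1 (ccv_re_im _ _) (Fz0_cv _ Hs).
have E : Zs ((1 + d)%R, 0%R) = (RtoC d * (Zs ((1 + d)%R, 0%R) / (((1 + d)%R, 0%R) - 1)))%C.
  have -> : (((1 + d)%R, 0%R) - 1)%C = RtoC d by apply: injective_projections; rewrite /=; ring.
  field; move=> [] ?; lra.
rewrite E Re_scal; apply: Rmult_le_compat_l; first lra.
have : Rbar_le (Re (Zs ((1 + d)%R, 0%R) / (((1 + d)%R, 0%R) - 1))%C) x.
  apply: (is_lim_seq_le_loc _ _ _ _ _ L (is_lim_seq_const x)); exists 1%nat => N /leP HN.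
  apply: Rle_trans (H N HN); apply: Req_le; rewrite /Fz Re_csum; apply: rsum_ext => n _.
  by rewrite Re_scal Re_npow Rmult_0_l cos_0 /=; ring.
by [].
Qed.

(* [mertens_sum] at [exp m] is compared with [harmonic m]; Abel summation against [exp (- d m)] turns this into [ln zeta(1 + d) = - ln d + o(1)]. *)
Lemma mertens_constant c : (forall e, 0 < e -> exists Y0, forall Y, (Y0 <= Y)%nat -> mertens_sum Y <= ln (ln (INR Y)) + c + e) ->
  euler_gamma <= c.
Proof.
move=> H; suff K : forall e, 0 < e -> euler_gamma <= c + 3 * e.
  apply: le_epsilon => e He; have := K (e / 3) ltac:(lra); lra.
move=> e He; have [Y0 HY] := H e He.
pose E := fun m : nat => proj1_sig (nfloor_ex (exp (INR m)) (Rlt_le _ _ (exp_pos _))).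
have HE : forall m, INR (E m) <= exp (INR m) < INR (E m) + 1.
  by move=> m; exact: (proj2_sig (nfloor_ex (exp (INR m)) (Rlt_le _ _ (exp_pos _)))).
set c1 := c - euler_gamma + e.
set m0 := (Y0 + 2)%nat.
have Ege : forall m, (m <= E m)%nat.
  move=> m; have [_ B0] := HE m; have X := exp_ineq1_le (INR m).
  by apply/leP; apply: INR_le; lra.
have H1 : forall m, (m0 <= m)%nat -> mertens_sum (E m) - harmonic m <= c1.
  move=> m Hm.
  have A := HY (E m) ltac:(have := Ege m; rewrite /m0 in Hm; lia).
  have G := euler_gamma_le m ltac:(rewrite /m0 in Hm; lia).
  have E2 : (2 <= E m)%nat by have := Ege m; rewrite /m0 in Hm; lia.
  have [L _] := HE m.
  have P2 : 2 <= INR (E m) by have := le_INR 2 _ (elimT leP E2); rewrite /=; lra.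
  have l1 : ln (INR (E m)) <= INR m by rewrite -(ln_exp (INR m)); apply: ln_le; lra.
  have l0 : 0 < ln (INR (E m)) by rewrite -ln_1; apply: ln_increasing; lra.
  have := ln_le _ _ l0 l1; rewrite /c1; lra.
have aapos : forall n, 0 <= mangoldt_log n / INR n.
  move=> n; case: n => [|n]; first by rewrite /mangoldt_log /ppsum /= /Rdiv Rmult_0_l; lra.
  apply: Rmult_le_pos; [exact: mangoldt_log_ge0 | apply: Rlt_le; apply: Rinv_0_lt_compat; apply: lt_0_INR; lia].
set a0 := mertens_sum (E m0).
have a00 : 0 <= a0 by apply: rsum_ge0 => n _; exact: aapos.
set B := a0 + Rabs c1.
have HB : 0 <= B by rewrite /B; have := Rabs_pos c1; lra.
have H2 : forall m, mertens_sum (E m) - harmonic m <= c1 + B.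
  move=> m; case: (leqP m0 m) => Hm; first by have := H1 m Hm; lra.
  have : mertens_sum (E m) <= a0.
    apply: rsum_mono => //.
    have [A _] := HE m; have [_ B0] := HE m0.
    have : exp (INR m) <= exp (INR m0) by apply: exp_mono; apply: le_INR; lia.
    move=> X; have : INR (E m) < INR (E m0).+1 by rewrite S_INR; lra.
    move=> /INR_lt; lia.
  have : 0 <= harmonic m.
    by apply: rsum_ge0 => j Hj; apply: Rlt_le; apply: Rinv_0_lt_compat; apply: lt_0_INR; lia.
  have := Rle_abs (- c1); rewrite Rabs_Ropp /B; lra.
set e' := 1 - exp (- e).
have e'0 : 0 < e'.
  have : exp (- e) < 1 by rewrite -exp_0; apply: exp_increasing; lra.
  rewrite /e'; lra.
have cZ : ccont Zs 1 by apply: cderiv_ccont (proj1 (hol_Zs 1 _)); rewrite /Dz /=; lra.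
have [d1 [Hd1 HZ]] := cZ e' e'0.
set Q := 10 + 2 * (B * INR m0).
have Q0 : 0 < Q by rewrite /Q; have := pos_INR m0; nra.
have [w [w0 [w1 [w2 w3]]]] : exists w, 0 < w /\ w <= / 2 /\ w < d1 /\ w * Q <= e.
  exists (Rmin (/ 2) (Rmin (d1 / 2) (e / Q))).
  have A1 := Rmin_l (/ 2) (Rmin (d1 / 2) (e / Q)); have A2 := Rmin_r (/ 2) (Rmin (d1 / 2) (e / Q)).
  have A3 := Rmin_l (d1 / 2) (e / Q); have A4 := Rmin_r (d1 / 2) (e / Q).
  split; first by apply: Rmin_glb_lt; [lra | apply: Rmin_glb_lt; [lra | exact: Rdiv_lt_0_compat]].
  split; first lra. split; first lra.
  by apply/Rle_div_r => //; lra.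
(* A square, so that ln (1 / d) = O(1 / w) by the plain inequality for exp; then d ln (1 / d) =
   O(w). *)
set d := w ^ 2.
have d0 : 0 < d by apply: pow_lt.
have dw : d <= w / 2 by rewrite /d; nra.
(* The only fact about zeta near its pole: d zeta (1 + d) is [Zs (1 + d)], continuous with value 1
   at d = 0. *)
have Zd : exp (- e) <= Re (Zs ((1 + d)%R, 0%R)).
  have M : Cmod (((1 + d)%R, 0%R) - 1)%C < d1.
    have -> : (((1 + d)%R, 0%R) - 1)%C = RtoC d by apply: injective_projections; rewrite /=; ring.
    rewrite Cmod_R Rabs_pos_eq; lra.
  have := HZ _ M; rewrite Zs_1.
  have := re_le_Cmod (Zs ((1 + d)%R, 0%R) - 1)%C; rewrite Re_minus => /Rabs_le_between [A _].
  rewrite [Re 1]/= in A; rewrite /e'; lra.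
set r := exp (- d).
set RR := exp d * (c1 * r + (1 - r) * (B * INR m0) - ln (1 - r)).
have up : forall N, (0 < N)%nat -> rsum (fun n => rpow (1 + d) (INR n)) N <= exp RR.
  move=> N HN.
  have A := partial_zeta_upper c1 B d E m0 N HE d0 HB H1 H2 HN.
  have P : 0 < rsum (fun n => rpow (1 + d) (INR n)) N.
    case: (N) HN => // M _; rewrite rsum_S.
    have : 0 <= rsum (fun n => rpow (1 + d) (INR n)) M by apply: rsum_ge0 => n _; apply: Rlt_le; exact: rpow_pos.
    have := rpow_pos (1 + d) (INR M.+1); lra.
  by rewrite -(exp_ln _ P); apply: exp_mono.
have fin := Rle_trans _ _ _ Zd (zeta_real_limit d _ d0 up).
have lfin : - e <= ln d + RR.
  rewrite -(ln_exp (- e)) -(ln_exp RR) -ln_mult //; last exact: exp_pos.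
  by apply: ln_le => //; exact: exp_pos.
have [t1 t2] := exp_taylor1 d ltac:(rewrite Rabs_pos_eq; nra).
have [t3 t4] := exp_taylor1 (- d) ltac:(rewrite Rabs_Ropp Rabs_pos_eq; nra).
have sq : (- d) ^ 2 = d ^ 2 by ring.
rewrite sq -/r in t3 t4.
have r1 : 1 - r <= d by lra.
have r2 : d * (1 - 2 * d) <= 1 - r by nra.
have d14 : d <= / 4 by nra.
have r3 : d / 2 <= 1 - r by nra.
have er : exp d * r = 1 by rewrite /r -exp_plus Rplus_opp_r exp_0.
have L1 : - ln (1 - r) <= 2 / w + 1.
  have : ln (d / 2) <= ln (1 - r) by apply: ln_le; lra.
  have -> : ln (d / 2) = ln w + ln w + - ln 2.
    rewrite /d /Rdiv ln_mult; [|nra|lra]; rewrite ln_Rinv; last lra.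
    by have -> : w ^ 2 = w * w by [ring]; rewrite ln_mult.
  have := exp_ineq1_le (- ln w); rewrite exp_Ropp exp_ln //.
  have l2 : ln 2 <= 1 by have := exp_ineq1_le (ln 2); rewrite exp_ln; lra.
  rewrite /Rdiv; lra.
have L2 : ln d - 4 * d <= ln (1 - r).
  have K1 : ln d + ln (1 - 2 * d) <= ln (1 - r) by rewrite -ln_mult; [apply: ln_le; nra | lra | lra].
  have := exp_ineq1_le (- ln (1 - 2 * d)); rewrite exp_Ropp exp_ln; last lra.
  have : / (1 - 2 * d) <= 1 + 4 * d.
    rewrite -(Rmult_1_l (/ _)); apply/Rle_div_l; [lra | nra].
  lra.
have ed : exp d - 1 <= 2 * d by nra.
have ed0 : 0 <= exp d - 1 by lra.
have S1 : (exp d - 1) * - ln (1 - r) <= 6 * w.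
  apply: (Rle_trans _ ((exp d - 1) * (2 / w + 1))); first exact: Rmult_le_compat_l.
  apply: (Rle_trans _ (2 * d * (2 / w + 1))).
    apply: Rmult_le_compat_r => //; have : 0 < 2 / w by apply: Rdiv_lt_0_compat; lra.
    lra.
  have -> : 2 * d * (2 / w + 1) = 4 * w + 2 * d by rewrite /d; field; lra.
  lra.
have S2 : exp d * ((1 - r) * (B * INR m0)) <= w * (2 * (B * INR m0)).
  have X0 : 0 <= B * INR m0 by apply: Rmult_le_pos => //; exact: pos_INR.
  have : exp d * (1 - r) <= 2 * d by rewrite Rmult_minus_distr_l er; lra.
  move=> X; rewrite -Rmult_assoc.
  have : exp d * (1 - r) * (B * INR m0) <= w * 2 * (B * INR m0) by apply: Rmult_le_compat_r; lra.
  lra.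
have ERR : RR = c1 + exp d * ((1 - r) * (B * INR m0)) + (exp d - 1) * - ln (1 - r) - ln (1 - r).
  rewrite /RR; have -> : exp d * (c1 * r + (1 - r) * (B * INR m0) - ln (1 - r)) = c1 * (exp d * r) + exp d * ((1 - r) * (B * INR m0)) - exp d * ln (1 - r) by ring.
  rewrite er; ring.
have : w * Q = 10 * w + w * (2 * (B * INR m0)) by rewrite /Q; ring.
rewrite /c1 in ERR; lra.
Qed.

(** [mertens_sum_upper] read as Y tends to infinity makes Wn N + Vt N an admissible constant in
    [mertens_constant]. The factor 7/2 is 5/2 from [Vt] plus 1 from the boundary term in [Wn]. *)
Lemma mertens_sum_lower (RH : RiemannHypothesis) N : 40 <= ln (INR N) ->
  ln (ln (INR N)) + euler_gamma - 7 / 2 * psi_error (INR N) / (INR N * ln (INR N)) <= mertens_sum N.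
Proof.
move=> HN; have N1 := ln_ge_gt1 40 _ ltac:(lra) HN.
have G : euler_gamma <= Wn N + Vt (INR N).
  apply: mertens_constant => e He.
  have [Y1 HY1] := rpow_lim (2 / 5) (e / 1400000) ltac:(lra) ltac:(lra).
  exists (maxn N Y1) => Y HY.
  have LY : 40 <= ln (INR Y) by apply: (Rle_trans _ _ _ HN); apply: ln_le; [lra | apply: le_INR; lia].
  have Y0 := ln_ge_gt1 40 _ ltac:(lra) LY.
  have U := mertens_sum_upper RH N Y HN ltac:(lia).
  have R1 := HY1 Y ltac:(lia).
  have E1 : psi_error (INR Y) / (INR Y * ln (INR Y)) = 1400000 * rpow (2 / 5) (INR Y) * / ln (INR Y).
    have E2 : exp (3 / 5 * ln (INR Y)) = INR Y * rpow (2 / 5) (INR Y).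
      rewrite -{2}(exp_ln (INR Y)); last lra. by rewrite /rpow -exp_plus; congr exp; field.
    rewrite /psi_error E2; field; lra.
  have I : / ln (INR Y) <= 1 by rewrite -Rinv_1; apply: Rinv_le_contravar; lra.
  have I0 : 0 < / ln (INR Y) by apply: Rinv_0_lt_compat; lra.
  have Rp := rpow_pos (2 / 5) (INR Y).
  have : 1400000 * rpow (2 / 5) (INR Y) * / ln (INR Y) <= e by nra.
  lra.
have P := psi_bound RH N HN; move: P => /Rabs_le_between [P _].
have I : 0 < / (INR N * ln (INR N)) by apply: Rinv_0_lt_compat; apply: Rmult_lt_0_compat; lra.
have : - psi_error (INR N) * / (INR N * ln (INR N)) <= (psi N - INR N) / (INR N * ln (INR N)).
  by apply: Rmult_le_compat_r; lra.
rewrite /Wn /Vt in G; rewrite /Rdiv in G *; lra.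
Qed.

(** * Primorials *)

Lemma next_primeP m :
  [/\ prime (next_prime m), (m < next_prime m)%nat & forall n, (m < n < next_prime m)%nat -> ~~ prime n].
Proof.
rewrite /next_prime; case: ex_minnP => p /andP [H1 H2] H3; split=> // n /andP [H4 H5].
apply/negP => harmonic; have := H3 n; rewrite H4 harmonic => /(_ isT); lia.
Qed.

Lemma rsum_next_prime g m (G := fun n => if prime n then g n else 0) :
  rsum G (next_prime m) = rsum G m + g (next_prime m).
Proof.
have [P1 P2 P3] := next_primeP m.
case E: (next_prime m) P1 P2 P3 => [//|p] P1 P2 P3.
rewrite rsum_S {2}/G P1; congr (_ + _); apply: rsum_extend; first by lia.
by move=> i Hi; rewrite /G ifN //; apply: P3; lia.
Qed.

Lemma prime_count k : INR k.+1 = rsum (fun n => if prime n then 1 else 0) (nth_prime k).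
Proof.
elim: k => [|k IH].
  by rewrite [nth_prime 0]/= (rsum_next_prime (fun _ => 1)) /= ; ring.
by rewrite [nth_prime k.+1]/= (rsum_next_prime (fun _ => 1)) -IH S_INR.
Qed.

Lemma nth_prime_prime k : prime (nth_prime k).
Proof. by case: k => [|k]; [case: (next_primeP 1) | case: (next_primeP (nth_prime k))]. Qed.

Lemma primorial_coprime k p : prime p -> (nth_prime k < p)%nat -> coprime (primorial k.+1) p.
Proof.
move=> Hp; elim: k => [|k IH] H; rewrite /primorial big_ord_recr /= coprimeMl.
  by rewrite big_ord0 coprime1n /= prime_coprime ?(nth_prime_prime 0) // dvdn_prime2 ?(nth_prime_prime 0) //; move: H => /=; lia.
have [_ A _] := next_primeP (nth_prime k).
rewrite IH; last by move: H => /=; lia.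
have Q := nth_prime_prime k.+1.
rewrite /= prime_coprime // dvdn_prime2 //; move: H => /=; lia.
Qed.

Definition log_euler_factor n := - ln (1 - / INR n).

Lemma prime_ratio p : prime p -> ln (INR p / INR (totient p)) = log_euler_factor p.
Proof.
move=> Hp; have p1 := prime_gt1 Hp.
have P : 2 <= INR p by have := le_INR 2 p (elimT leP p1); rewrite /=; lra.
rewrite totient_prime // -subn1 minus_INR; last by apply/leP; lia.
have I : / INR p <= / 2 by apply: Rinv_le_contravar; lra.
rewrite /log_euler_factor -ln_Rinv; last lra.
congr ln; rewrite [INR 1]/=; field; lra.
Qed.

Lemma ln_primorial_ratio k :
  ln (INR (primorial k.+1) / INR (totient (primorial k.+1))) =
  rsum (fun n => if prime n then log_euler_factor n else 0) (nth_prime k).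
Proof.
have pos : forall j, (0 < primorial j)%nat.
  move=> j; rewrite /primorial; elim: j => [|j IH]; first by rewrite big_ord0.
  by rewrite big_ord_recr /= muln_gt0 IH prime_gt0 // nth_prime_prime.
elim: k => [|k IH].
  rewrite [nth_prime 0]/= (rsum_next_prime log_euler_factor) /= !Rplus_0_l /primorial big_ord1.
  exact: prime_ratio (nth_prime_prime 0).
rewrite [nth_prime k.+1]/= (rsum_next_prime log_euler_factor) -IH.
have Q := nth_prime_prime k.+1.
have -> : primorial k.+2 = (primorial k.+1 * nth_prime k.+1)%nat by rewrite /primorial big_ord_recr.
have [_ A _] := next_primeP (nth_prime k).
rewrite totient_coprime; last exact: primorial_coprime.
have a0 : 0 < INR (primorial k.+1) by apply: lt_0_INR; apply/leP; exact: pos.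
have b0 : 0 < INR (totient (primorial k.+1)) by apply: lt_0_INR; apply/leP; rewrite totient_gt0.
have c0 : 0 < INR (nth_prime k.+1) by apply: lt_0_INR; apply/leP; exact: prime_gt0.
have d0 : 0 < INR (totient (nth_prime k.+1)) by apply: lt_0_INR; apply/leP; rewrite totient_gt0 prime_gt0.
rewrite -(prime_ratio _ Q) -ln_mult; try exact: Rdiv_lt_0_compat.
by rewrite !mult_INR; congr ln; field; lra.
Qed.

Lemma mangoldt_log_prime_ge1 p : prime p -> 1 <= mangoldt_log p.
Proof.
move=> Hp; have p1 := prime_gt1 Hp.
have L : 0 < ln (INR p) by apply: ln_INR_gt0; lia.
have N : forall (q j : nat), (0 < j)%nat -> 0 <= / INR j.
  move=> q j Hj; apply: Rlt_le; apply: Rinv_0_lt_compat; apply: lt_0_INR; lia.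
rewrite /mangoldt_log /ppsum.
rewrite -[X in X <= _](_ : rsum (fun q => if q == p then 1 else 0) p = 1); last by rewrite rsum_delta ifT //; lia.
apply: rsum_le => q Hq; case: eqVneq => [->|_]; last first.
  apply: rsum_ge0 => j Hj; case: ifP => _; [apply: (N 0%nat); lia | lra].
rewrite -[X in X <= _](_ : rsum (fun j => if j == 1%nat then 1 else 0) p = 1); last by rewrite rsum_delta ifT //; lia.
apply: rsum_le => j Hj; case: eqVneq => [->|_]; first by rewrite expn1 Hp eqxx /=; lra.
case: ifP => _; [apply: (N 0%nat); lia | lra].
Qed.

(** Counting prime powers as well overshoots by about the square root of x, far within an error of
    order x^(3/5). *)
Lemma index_le_riemann_pi k : INR k.+1 <= riemann_pi (nth_prime k).
Proof.
rewrite prime_count; apply: rsum_le => n harmonic; case: ifP => Hp; [exact: mangoldt_log_prime_ge1 | exact: mangoldt_log_ge0].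
Qed.

Lemma index_le_nth_prime k : INR k.+1 <= INR (nth_prime k).
Proof.
rewrite prime_count; elim: (nth_prime k) => [|n IH]; first exact: Rle_refl.
rewrite rsum_S S_INR; case: ifP => _; lra.
Qed.

(** Expanding each Euler factor, the right side has 1 / (j p^j) for all powers of the primes p <= N,
    the left side only for those with p^j <= N; the discrepancy has the favourable sign. *)
Lemma mertens_sum_le_euler N : mertens_sum N <= rsum (fun n => if prime n then log_euler_factor n else 0) N.
Proof.
rewrite /mertens_sum.
apply: (Rle_trans _ (rsum (fun n => rsum (fun p => rsum (fun j =>
   if n == expn p j then (if prime p then (/ INR p) ^ j / INR j else 0) else 0) N) N) N)).
  apply: rsum_le => n harmonic; rewrite /mangoldt_log -(ppsum_stable _ N); last lia.
  rewrite /ppsum /Rdiv Rmult_comm -rsum_scal; apply: rsum_le => p Hp.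
  rewrite -rsum_scal; apply: rsum_le => j Hj.
  case: (prime p) => /=; last by case: ifP => _; lra.
  case: eqVneq => [->|_]; last lra.
  by rewrite INR_expn pow_inv; lra.
rewrite rsum_exchange; apply: rsum_le => p Hp; rewrite rsum_exchange.
case: ifP => Pp; last first.
  by rewrite rsum_eq0; [lra | move=> j _; apply: rsum_eq0 => n _; case: ifP].
have p1 := prime_gt1 Pp.
have P : 2 <= INR p by have := le_INR 2 p (elimT leP p1); rewrite /=; lra.
have I : / INR p <= / 2 by apply: Rinv_le_contravar; lra.
have I0 : 0 < / INR p by apply: Rinv_0_lt_compat; lra.
apply: Rle_trans (log_series_le (/ INR p) N ltac:(lra)).
apply: rsum_le => j Hj; rewrite rsum_delta; case: ifP => _; first lra.
apply: Rmult_le_pos; first by apply: pow_le; lra.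
apply: Rlt_le; apply: Rinv_0_lt_compat; apply: lt_0_INR; lia.
Qed.

Lemma primorial_ratio_ge k :
  exp (mertens_sum (nth_prime k)) <= INR (primorial k.+1) / INR (totient (primorial k.+1)).
Proof.
have pos : (0 < primorial k.+1)%nat.
  by rewrite /primorial; apply: prodn_gt0 => i; apply: prime_gt0; exact: nth_prime_prime.
have R0 : 0 < INR (primorial k.+1) / INR (totient (primorial k.+1)).
  by apply: Rdiv_lt_0_compat; apply: lt_0_INR; apply/leP; rewrite ?totient_gt0.
rewrite -(exp_ln _ R0) ln_primorial_ratio; apply: exp_mono; exact: mertens_sum_le_euler.
Qed.

(** * Inverting the estimate *)

Lemma ln_quartic_lower v : 0 <= v -> v - v ^ 2 / 2 + v ^ 3 / 3 - v ^ 4 / 4 <= ln (1 + v).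
Proof.
move=> Hv.
have := deriv_nonneg (fun t => ln (1 + t) - (t - t ^ 2 / 2 + t ^ 3 / 3 - t ^ 4 / 4)) (fun t => t ^ 4 / (1 + t)) 0 v Hv.
rewrite Rplus_0_r ln_1 => K.
suff : 0 - (0 - 0 ^ 2 / 2 + 0 ^ 3 / 3 - 0 ^ 4 / 4) <= ln (1 + v) - (v - v ^ 2 / 2 + v ^ 3 / 3 - v ^ 4 / 4) by lra.
apply: K => t Ht; first by auto_derive; [lra | field; lra].
apply: Rmult_le_pos; first by apply: pow_le; lra.
by apply: Rlt_le; apply: Rinv_0_lt_compat; lra.
Qed.

Lemma ln_cubic_upper v : 0 <= v -> ln (1 + v) <= v - v ^ 2 / 2 + v ^ 3 / 3.
Proof.
move=> Hv.
have := deriv_nonneg (fun t => t - t ^ 2 / 2 + t ^ 3 / 3 - ln (1 + t)) (fun t => t ^ 3 / (1 + t)) 0 v Hv.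
rewrite Rplus_0_r ln_1 => K.
suff : 0 - 0 ^ 2 / 2 + 0 ^ 3 / 3 - 0 <= v - v ^ 2 / 2 + v ^ 3 / 3 - ln (1 + v) by lra.
apply: K => t Ht; first by auto_derive; [lra | field; lra].
apply: Rmult_le_pos; first by apply: pow_le; lra.
by apply: Rlt_le; apply: Rinv_0_lt_compat; lra.
Qed.

(** * Numerical constants *)

Lemma ln_70_bounds : 4.245 <= ln 70 <= 4.265.
Proof.
have E : ln 70 = 18 * ln (5 / 4) + 6 * ln (128 / 125) + ln (35 / 32).
  (* From 2 = (5/4)^3 * 128/125 and 70 = 2^6 * 35/32; all three bases are close enough to 1 for
     short Taylor polynomials. *)
  have -> : 70 = (5 / 4) ^ 18 * (128 / 125) ^ 6 * (35 / 32) by field.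
  have p1 : 0 < (5 / 4) ^ 18 by apply: pow_lt; lra.
  have p2 : 0 < (128 / 125) ^ 6 by apply: pow_lt; lra.
  rewrite ln_mult; [|exact: Rmult_lt_0_compat|lra]; rewrite ln_mult // !ln_pow; try lra.
  by rewrite !INR_IZR_INZ.
have A1 := ln_quartic_lower (1 / 4) ltac:(lra); have A2 := ln_quartic_lower (3 / 125) ltac:(lra); have A3 := ln_quartic_lower (3 / 32) ltac:(lra).
have B1 := ln_cubic_upper (1 / 4) ltac:(lra); have B2 := ln_cubic_upper (3 / 125) ltac:(lra); have B3 := ln_cubic_upper (3 / 32) ltac:(lra).
have E1 : 1 + 1 / 4 = 5 / 4 by field. have E2 : 1 + 3 / 125 = 128 / 125 by field. have E3 : 1 + 3 / 32 = 35 / 32 by field.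
rewrite E1 in A1 B1; rewrite E2 in A2 B2; rewrite E3 in A3 B3; lra.
Qed.

Lemma exp_INR_mult n y : exp (INR n * y) = exp y ^ n.
Proof.
elim: n => [|n IH]; first by rewrite /= Rmult_0_l exp_0.
by rewrite -tech_pow_Rmult -IH -exp_plus S_INR; congr exp; ring.
Qed.

(** The threshold is about exp 70.44, so the crude e <= (128/127)^128 <= 2.73 is precise enough. *)
Lemma ln_threshold x : 3900491 * 10 ^ 24 <= x -> 70 <= ln x.
Proof.
move=> Hx; rewrite -(ln_exp 70); apply: ln_le; first exact: exp_pos.
apply: Rle_trans Hx.
have P := exp_pos (/ 128).
have e1 : exp 1 <= 273 / 100.
  have := exp_ineq1_le (- (/ 128)); rewrite exp_Ropp => A.
  have B : exp (/ 128) <= 128 / 127.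
    apply: (Rmult_le_reg_r (/ exp (/ 128))); first exact: Rinv_0_lt_compat.
    rewrite Rinv_r; lra.
  have -> : 1 = INR 128 * (/ 128) by rewrite INR_IZR_INZ [Z.of_nat _]/=; field.
  rewrite exp_INR_mult; apply: (Rle_trans _ ((128 / 127) ^ 128)); first by apply: pow_incr; lra.
  lra.
have -> : 70 = INR 70 * 1 by rewrite INR_IZR_INZ [Z.of_nat _]/=; field.
rewrite exp_INR_mult.
apply: (Rle_trans _ ((273 / 100) ^ 70)); first by apply: pow_incr; have := exp_pos 1; lra.
lra.
Qed.

(** 28 and 29.6 are 2/5 of 70 and of 74, the two lower bounds for X = ln p that occur in
    [ln_index_le]. *)
Lemma exp_lower : 10 ^ 12 <= exp 28 /\ 6700000000000 <= exp (296 / 10).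
Proof.
have B : 2222 / 1000 <= exp (8 / 10).
  have := pow_le_exp 512 (1 / 640) ltac:(lra).
  have -> : INR 512 * (1 / 640) = 8 / 10 by rewrite INR_IZR_INZ [Z.of_nat _]/=; field.
  apply: Rle_trans; lra.
split.
  have -> : 28 = INR 35 * (8 / 10) by rewrite INR_IZR_INZ [Z.of_nat _]/=; field.
  rewrite exp_INR_mult; apply: (Rle_trans _ ((2222 / 1000) ^ 35)); [lra | apply: pow_incr; lra].
have -> : 296 / 10 = INR 37 * (8 / 10) by rewrite INR_IZR_INZ [Z.of_nat _]/=; field.
rewrite exp_INR_mult; apply: (Rle_trans _ ((2222 / 1000) ^ 37)); [lra | apply: pow_incr; lra].
Qed.

(** The constant fits two uses: 2900000 / 181500 < 16 raises the coefficient 28 to 44 in the index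
    estimate, and 4900000 / 181500 < 28 gives the allowance 28 / X^4 in the ratio. Beyond X = 74
    each of the four factors X / 74 is dominated by exp ((X - 74) / 10). *)
Lemma exp_beats_quartic X : 74 <= X -> 181500 * X ^ 4 <= exp (2 / 5 * X).
Proof.
move=> HX.
have [_ E] := exp_lower.
have -> : 2 / 5 * X = 296 / 10 + INR 4 * ((X - 74) / 10) by rewrite [INR 4]/=; field.
rewrite exp_plus exp_INR_mult.
have A : X / 74 <= exp ((X - 74) / 10) by have := exp_ineq1_le ((X - 74) / 10); lra.
have B : (X / 74) ^ 4 <= exp ((X - 74) / 10) ^ 4 by apply: pow_incr; lra.
have C : 0 < (X / 74) ^ 4 by apply: pow_lt; lra.
have -> : 181500 * X ^ 4 = 181500 * 74 ^ 4 * (X / 74) ^ 4 by field.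
apply: Rmult_le_compat; lra.
Qed.

(** The coefficients up to w^3 are those of the Taylor expansion; at w^4 the value 44 - 8 + 21/10
    and all later terms are rounded up to 40. *)
Lemma ln_P_upper w : 0 <= w <= 1 / 70 ->
  ln (1 + w + 2 * w ^ 2 + 6 * w ^ 3 + 44 * w ^ 4) <= w + 3 / 2 * w ^ 2 + 13 / 3 * w ^ 3 + 40 * w ^ 4.
Proof.
move=> Hw; set y := w + 2 * w ^ 2 + 6 * w ^ 3 + 44 * w ^ 4.
have w2 : 0 <= w ^ 2 by apply: pow_le; lra. have w3 : 0 <= w ^ 3 by apply: pow_le; lra.
have w4 : 0 <= w ^ 4 by apply: pow_le; lra. have w5 : 0 <= w ^ 5 by apply: pow_le; lra.
have w6 : 0 <= w ^ 6 by apply: pow_le; lra.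
have st : forall n, 0 <= w ^ n.+1 <= w ^ n / 70.
  move=> n; have := pow_le w n ltac:(lra); rewrite -tech_pow_Rmult; nra.
have s2 := st 2%nat; have s3 := st 3%nat; have s4 := st 4%nat; have s5 := st 5%nat.
have y1 : w + 2 * w ^ 2 + 6 * w ^ 3 <= y by rewrite /y; lra.
have y2 : y <= w + 21 / 10 * w ^ 2 by rewrite /y; lra.
have Y2 : (w + 2 * w ^ 2 + 6 * w ^ 3) ^ 2 <= y ^ 2 by apply: pow_incr; lra.
have Y3 : y ^ 3 <= (w + 21 / 10 * w ^ 2) ^ 3 by apply: pow_incr; lra.
have -> : 1 + w + 2 * w ^ 2 + 6 * w ^ 3 + 44 * w ^ 4 = 1 + y by rewrite /y; ring.
apply: Rle_trans (ln_cubic_upper y ltac:(lra)) _.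
have E2 : (w + 2 * w ^ 2 + 6 * w ^ 3) ^ 2 = w ^ 2 + 4 * w ^ 3 + 16 * w ^ 4 + 24 * w ^ 5 + 36 * w ^ 6 by ring.
have E3 : (w + 21 / 10 * w ^ 2) ^ 3 = w ^ 3 + 63 / 10 * w ^ 4 + 1323 / 100 * w ^ 5 + 9261 / 1000 * w ^ 6 by field.
rewrite E2 in Y2; rewrite E3 in Y3; have Ey : y = w + 2 * w ^ 2 + 6 * w ^ 3 + 44 * w ^ 4 by []. lra.
Qed.

(* Bounds [ln (exp X * (w + w^2 + 2 w^3 + 6 w^4 + 44 w^5))], [w = / X], from above. *)
Definition index_majorant (X : R) : R := X - ln X + (/ X + 3 / 2 * / X ^ 2 + 13 / 3 * / X ^ 3 + 40 * / X ^ 4).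

Lemma index_majorant_increasing a b : 70 <= a <= b -> index_majorant a <= index_majorant b.
Proof.
move=> H.
apply: (deriv_nonneg index_majorant (fun X => 1 - / X - / X ^ 2 - 3 * / X ^ 3 - 13 * / X ^ 4 - 160 * / X ^ 5)); first lra.
  move=> x Hx; rewrite /index_majorant; auto_derive; first by repeat split; try lra; apply: Rgt_not_eq; repeat apply: Rmult_lt_0_compat; lra.
  by field; lra.
move=> x Hx; rewrite -!pow_inv.
have I : / x <= 1 / 70 by rewrite -(Rinv_inv (1 / 70)); apply: Rinv_le_contravar; lra.
have I0 : 0 < / x by apply: Rinv_0_lt_compat; lra.
have st : forall n, 0 <= (/ x) ^ n.+1 <= (/ x) ^ n / 70.
  move=> n; have := pow_le (/ x) n ltac:(lra); rewrite -tech_pow_Rmult; nra.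
have s0 := st 0%nat; have s1 := st 1%nat; have s2 := st 2%nat; have s3 := st 3%nat; have s4 := st 4%nat.
rewrite [_ ^ 0]/= in s0; rewrite pow_1 in s0 s1; lra.
Qed.

(** This expression times z^3 is the lower bound for the gap in [key_ineq] once every power is
    replaced by its estimate. Its terms in z^2 are at most 0.104 because l z <= 0.061. Multiplied by
    l, the rest is affine in l z, so it is enough to check l z = 0 and l z = 0.061. *)
Lemma key_polynomial_pos l z : 4245 / 1000 <= l -> 0 < z -> l * z <= 61 / 1000 ->
  0 < l ^ 3 / 3 - 5 / 2 * l ^ 2 + 7 * l - 47 / 6 - (l - 1) ^ 2 * z ^ 2 - 26.78 * l ^ 2 * z ^ 2
    + z * (29 / 30 * l ^ 2 * (l - 1) - (l - 1) ^ 2 / 2 - 0.265 * l ^ 4 - (l ^ 2 - 4 * l + 5) / 2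
           - 2 * l * (l - 1) + 0.93 * l ^ 3 - 4.635 * l ^ 2 + 13 * l - 68).
Proof.
move=> Hl Hz Hu.
have uu : (l * z) ^ 2 <= (61 / 1000) ^ 2 by apply: pow_incr; nra.
have u1 : (l - 1) ^ 2 * z ^ 2 <= (l * z) ^ 2 by rewrite -Rpow_mult_distr; apply: pow_incr; nra.
have u2 : 26.78 * l ^ 2 * z ^ 2 = 26.78 * (l * z) ^ 2 by ring.
set C := (_ - 68).
set P := l ^ 3 / 3 - 5 / 2 * l ^ 2 + 7 * l - 47 / 6 - 0.104.
suff : 0 < P + z * C by rewrite /P; lra.
(* Expanded about 4.245, a lower bound for ln 70, both end values are polynomials in m with positive
   coefficients. *)
have [m [Hm El]] : exists m, 0 <= m /\ l = 4245 / 1000 + m by exists (l - 4245 / 1000); lra.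
have m2 : 0 <= m ^ 2 by apply: pow_le. have m3 : 0 <= m ^ 3 by apply: pow_le. have m4 : 0 <= m ^ 4 by apply: pow_le.
have P0 : 0 < P by rewrite /P El; lra.
have Q0 : 0 < l * P + 61 / 1000 * C by rewrite /P /C El; lra.
suff : 0 < l * (P + z * C) by nra.
have -> : l * (P + z * C) = l * P + l * z * C by ring.
case: (Rle_dec 0 C) => HC.
  have : 0 <= l * z * C by apply: Rmult_le_pos => //; nra.
  have : 0 < l * P by apply: Rmult_lt_0_compat; lra.
  lra.
have : 61 / 1000 * C <= l * z * C by nra.
lra.
Qed.

(* With [z = / L] and [l = ln L], [L * (1 + v)] is the claimed bound plus the error allowance [28 z^4], and [w] is its inverse. *)
Lemma key_ineq l z (q := l ^ 2 - 4 * l + 5) (v := l * z + (l - 1) * z ^ 2 - q * z ^ 3 / 2 + 28 * z ^ 5) (w := z / (1 + v)) :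
  4245 / 1000 <= l -> 0 < z <= 1 / 70 -> l * z <= 61 / 1000 ->
  0 <= v /\ (l - 1) * z - q * z ^ 2 / 2 + 28 * z ^ 4 + (w + 3 / 2 * w ^ 2 + 13 / 3 * w ^ 3 + 40 * w ^ 4) < ln (1 + v).
Proof.
move=> Hl Hz Hu.
have K := key_polynomial_pos l z Hl (proj1 Hz) Hu.
(* u is the main part of v and c its second-order part, at most u / 70; the remainder of v is
   negative and at most 0.0305 c in size. *)
set u := l * z in Hu; set c := (l - 1) * z ^ 2.
have z2 : 0 < z ^ 2 by apply: pow_lt; lra.
have z3 : 0 < z ^ 3 by apply: pow_lt; lra.
have z4 : 0 < z ^ 4 by apply: pow_lt; lra.
have u0 : 0 < u by rewrite /u; nra.
have c0 : 0 < c by rewrite /c; nra.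
have cu : c <= u / 70.
  have : (l - 1) * z * z <= u * (1 / 70) by rewrite /u; apply: Rmult_le_compat; nra.
  rewrite /c; lra.
have q1 : 5 <= q by rewrite /q; nra.
have d1 : 28 * z ^ 5 <= q * z ^ 3 / 2.
  have : z ^ 2 <= (1 / 70) ^ 2 by apply: pow_incr; lra.
  move=> A; have -> : z ^ 5 = z ^ 2 * z ^ 3 by ring.
  nra.
have d2 : q * z ^ 3 / 2 <= 0.0305 * c.
  have : q * z <= 0.061 * (l - 1).
    have : q * z <= (l - 1) * u by rewrite /q /u; nra.
    nra.
  rewrite /c; have -> : z ^ 3 = z * z ^ 2 by ring.
  nra.
have v1 : v <= u + c by rewrite /v -/u -/c; lra.
have v2 : u + c - q * z ^ 3 / 2 <= v by rewrite /v -/u -/c; have : 0 < z ^ 5 by [apply: pow_lt; lra]; lra.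
have v3 : u + 0.9695 * c <= v by lra.
have v0 : 0 < v by lra.
have vs : v <= 0.062 by lra.
split; first lra.
have T2 : v ^ 2 <= u ^ 2 + 2 * u * c + c ^ 2.
  by have -> : u ^ 2 + 2 * u * c + c ^ 2 = (u + c) ^ 2 by [ring]; apply: pow_incr; lra.
(* From v <= u + c <= 71/70 u; the fourth power of 71/70 below gives 1.06. *)
have T2' : v ^ 2 <= 1.03 * u ^ 2.
  apply: (Rle_trans _ ((71 / 70 * u) ^ 2)); first by apply: pow_incr; lra.
  rewrite Rpow_mult_distr; apply: Rmult_le_compat_r; nra.
have T3 : u ^ 3 + 2.9 * u ^ 2 * c <= v ^ 3.
  apply: (Rle_trans _ ((u + 0.9695 * c) ^ 3)); last by apply: pow_incr; lra.
  have -> : (u + 0.9695 * c) ^ 3 = u ^ 3 + 3 * 0.9695 * u ^ 2 * c + (3 * 0.9695 ^ 2 * u * c ^ 2 + 0.9695 ^ 3 * c ^ 3) by ring.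
  have : 0 <= u * c ^ 2 by apply: Rmult_le_pos; [lra | apply: pow_le; lra].
  have : 0 <= c ^ 3 by apply: pow_le; lra.
  have : 0 <= u ^ 2 * c by apply: Rmult_le_pos; [apply: pow_le; lra | lra].
  lra.
have T4 : v ^ 4 <= 1.06 * u ^ 4.
  apply: (Rle_trans _ ((71 / 70 * u) ^ 4)); first by apply: pow_incr; lra.
  rewrite Rpow_mult_distr; apply: Rmult_le_compat_r; [apply: pow_le; lra | lra].
have u3 : u ^ 3 <= v ^ 3 by apply: pow_incr; lra.
have u30 : 0 < u ^ 3 by apply: pow_lt.
have L := ln_quartic_lower v ltac:(lra).
set r := / (1 + v).
have r0 : 0 < r by apply: Rinv_0_lt_compat; lra.
have rv : r * (1 + v) = 1 by rewrite /r; field; lra.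
(* Truncated expansions of the powers of 1 / (1 + v). As v <= 0.062, v^3 - v^4 is at least 0.93 v^3,
   and v^3 >= u^3. *)
have R1 : r <= 1 - v + v ^ 2 - 0.93 * u ^ 3.
  apply: (Rle_trans _ (1 - v + v ^ 2 - v ^ 3 + v ^ 4)).
    apply: (Rmult_le_reg_r (1 + v)); first lra. rewrite rv.
    have -> : (1 - v + v ^ 2 - v ^ 3 + v ^ 4) * (1 + v) = 1 + v ^ 5 by ring.
    have : 0 < v ^ 5 by apply: pow_lt. lra.
  have -> : v ^ 4 = v * v ^ 3 by ring.
  nra.
have p2 : 0 < v ^ 2 by apply: pow_lt. have p3 : 0 < v ^ 3 by apply: pow_lt.
have p4 : 0 < v ^ 4 by apply: pow_lt. have p5 : 0 < v ^ 5 by apply: pow_lt.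
have R2 : r ^ 2 <= 1 - 2 * v + 3 * v ^ 2.
  apply: (Rmult_le_reg_r ((1 + v) ^ 2)); first by apply: pow_lt; lra.
  rewrite -Rpow_mult_distr rv.
  have -> : (1 - 2 * v + 3 * v ^ 2) * (1 + v) ^ 2 = 1 + 4 * v ^ 3 + 3 * v ^ 4 by ring.
  lra.
have R3 : r ^ 3 <= 1 - 3 * v + 6 * v ^ 2.
  apply: (Rmult_le_reg_r ((1 + v) ^ 3)); first by apply: pow_lt; lra.
  rewrite -Rpow_mult_distr rv.
  have -> : (1 - 3 * v + 6 * v ^ 2) * (1 + v) ^ 3 = 1 + 10 * v ^ 3 + 15 * v ^ 4 + 6 * v ^ 5 by ring.
  lra.
have R4 : r ^ 4 <= 1.
  rewrite -(pow1 4); apply: pow_incr; split; first lra. rewrite /r -Rinv_1; apply: Rinv_le_contravar; lra.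
have W1 : w <= z * (1 - (u + c - q * z ^ 3 / 2) + (u ^ 2 + 2 * u * c + c ^ 2) - 0.93 * u ^ 3).
  by rewrite /w [z / _]/Rdiv -/r; apply: Rmult_le_compat_l; lra.
have W2 : w ^ 2 <= z ^ 2 * (1 - 2 * u + 3.09 * u ^ 2).
  by rewrite /w [z / _]/Rdiv -/r Rpow_mult_distr; apply: Rmult_le_compat_l; lra.
have W3 : w ^ 3 <= z ^ 3 * (1 - 3 * u + 6.18 * u ^ 2).
  by rewrite /w [z / _]/Rdiv -/r Rpow_mult_distr; apply: Rmult_le_compat_l; lra.
have W4 : w ^ 4 <= z ^ 4 * 1.
  by rewrite /w [z / _]/Rdiv -/r Rpow_mult_distr; apply: Rmult_le_compat_l; lra.
have KK := Rmult_lt_0_compat _ _ z3 K.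
set F := _ * _ in KK.
(* After expansion the terms of order z and z^2 cancel identically: to this order the claimed bound
   is the inverse of the index estimate. *)
have E : F = (u + c - q * z ^ 3 / 2) - (u ^ 2 + 2 * u * c + c ^ 2) / 2 + (u ^ 3 + 2.9 * u ^ 2 * c) / 3 - 1.06 * u ^ 4 / 4
   - z * (1 - (u + c - q * z ^ 3 / 2) + (u ^ 2 + 2 * u * c + c ^ 2) - 0.93 * u ^ 3)
   - 3 / 2 * (z ^ 2 * (1 - 2 * u + 3.09 * u ^ 2)) - 13 / 3 * (z ^ 3 * (1 - 3 * u + 6.18 * u ^ 2)) - 40 * (z ^ 4 * 1)
   - ((l - 1) * z - q * z ^ 2 / 2 + 28 * z ^ 4).
  by rewrite /F /u /c /q; lra.
lra.
Qed.

Lemma exists_cutoff : exists n0, 40 <= ln (INR n0) /\ INR n0 <= exp 41.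
Proof.
have [m [M1 M2]] := nfloor_ex (exp 40) (Rlt_le _ _ (exp_pos _)).
exists m.+1; rewrite S_INR; split.
  by rewrite -(ln_exp 40); apply: ln_le; [exact: exp_pos | lra].
have -> : 41 = 40 + 1 by ring.
have := exp_ineq1_le 1; have := exp_ineq1_le 40; rewrite exp_plus; nra.
Qed.

(** All errors of order x^(3/5) are gathered in 2900000: 2 * 1400000 from [psi_error], and 100000
    for the cutoff n0 <= exp 41, which is below 100000 w exp (3 X / 5) since X >= 70. *)
Lemma riemann_pi_explicit (RH : RiemannHypothesis) N (X := ln (INR N)) (w := / X) : 70 <= X ->
  riemann_pi N <= exp X * w * (1 + w + 2 * w ^ 2 + 6 * w ^ 3 + 28 * w ^ 4 + 2900000 * / exp (2 / 5 * X)).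
Proof.
move=> HX; have N1 := ln_ge_gt1 70 _ ltac:(lra) HX.
have Ex : INR N = exp X by rewrite /X exp_ln; lra.
have [n0 [H0 H1]] := exists_cutoff.
have e41 : exp 41 <= exp X by apply: exp_mono; lra.
have H2 : (n0 <= N)%nat by apply/leP; apply: INR_le; lra.
have := riemann_pi_le RH n0 N H0 H2; rewrite /li_majorant /psi_error -/X Ex.
have w0 : 0 < w by apply: Rinv_0_lt_compat; lra.
have Pe := exp_pos (3 / 5 * X).
have E1 : exp X * / exp (2 / 5 * X) = exp (3 / 5 * X).
  by rewrite -exp_Ropp -exp_plus; congr exp; field.
have n0b : INR n0 <= 100000 * (w * exp (3 / 5 * X)).
  have A := exp_ineq1_le (3 / 5 * X - 41).
  have -> : 3 / 5 * X = 41 + (3 / 5 * X - 41) by ring.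
  rewrite exp_plus; apply: (Rle_trans _ _ _ H1).
  have P41 := exp_pos 41.
  have : 1 <= 100000 * (w * exp (3 / 5 * X - 41)).
    have : w * X = 1 by rewrite /w; field; lra.
    have : w * (3 / 5 * X - 40) <= w * exp (3 / 5 * X - 41) by apply: Rmult_le_compat_l; lra.
    have : w <= / 70 by apply: Rinv_le_contravar; lra.
    lra.
  nra.
have -> : exp X * (/ X + / X ^ 2 + 2 / X ^ 3 + 6 / X ^ 4 + 28 / X ^ 5) = exp X * w * (1 + w + 2 * w ^ 2 + 6 * w ^ 3 + 28 * w ^ 4).
  by rewrite /w; field; lra.
have -> : 2 * (1400000 * exp (3 / 5 * X)) / X = 2800000 * (w * exp (3 / 5 * X)) by rewrite /w; field; lra.
rewrite -E1 in n0b *; lra.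
Qed.

(** The bound of [exp_beats_quartic] fails at X = 70, so a crude form of the index estimate is used
    to reach X >= 74 before the sharp one. *)
Lemma ln_index_le (RH : RiemannHypothesis) k (X := ln (INR (nth_prime k))) : 70 <= ln (INR k.+1) ->
  74 <= X /\ ln (INR k.+1) <= index_majorant X.
Proof.
move=> HL; have k1 := ln_ge_gt1 70 _ ltac:(lra) HL.
have LX : ln (INR k.+1) <= X by apply: ln_le; [lra | exact: index_le_nth_prime].
have X70 : 70 <= X by lra.
have A := Rle_trans _ _ _ (index_le_riemann_pi k) (riemann_pi_explicit RH (nth_prime k) X70).
rewrite -/X in A; set w := / X in A.
have w0 : 0 < w by apply: Rinv_0_lt_compat; lra.
have w1 : w <= / 70 by apply: Rinv_le_contravar; lra.
have ew : 0 < exp X * w by apply: Rmult_lt_0_compat => //; exact: exp_pos.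
have lnw : ln (exp X * w) = X - ln X by rewrite ln_mult //; [rewrite ln_exp ln_Rinv; lra | exact: exp_pos].
have step : forall P, 0 < P -> INR k.+1 <= exp X * w * P -> ln (INR k.+1) <= X - ln X + ln P.
  by move=> P HP H; rewrite -lnw -ln_mult //; apply: ln_le => //; lra.
have w2 : 0 <= w ^ 2 <= / 70 * / 70 by nra.
have w3 : 0 <= w ^ 3 <= / 70 * / 70 by rewrite -tech_pow_Rmult; nra.
have w4 : 0 <= w ^ 4 <= / 70 * / 70 by rewrite -tech_pow_Rmult; nra.
have lX : 4.245 <= ln X by have [B _] := ln_70_bounds; apply: Rle_trans B _; apply: ln_le; lra.
(* The whole correction factor is below 1.03, so X exceeds ln (k + 1) by at least ln 70 - 0.03. *)
have X74 : 74 <= X.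
  have e28 : / exp (2 / 5 * X) <= / 10 ^ 12.
    apply: Rinv_le_contravar; first lra.
    by have [B _] := exp_lower; apply: Rle_trans B _; apply: exp_mono; lra.
  have : ln (INR k.+1) <= X - ln X + ln (1 + 0.03).
    apply: step; first lra. apply: Rle_trans A _; apply: Rmult_le_compat_l; lra.
  have := exp_ineq1_le (ln (1 + 0.03)); rewrite exp_ln; last lra. lra.
split=> //.
have e4 : / exp (2 / 5 * X) <= w ^ 4 / 181500.
  have -> : w ^ 4 / 181500 = / (181500 * X ^ 4) by rewrite /w; field; lra.
  by apply: Rinv_le_contravar; [apply: Rmult_lt_0_compat; [lra | apply: pow_lt; lra] | exact: exp_beats_quartic].
have : ln (INR k.+1) <= X - ln X + ln (1 + w + 2 * w ^ 2 + 6 * w ^ 3 + 44 * w ^ 4).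
  apply: step; first lra. apply: Rle_trans A _; apply: Rmult_le_compat_l; lra.
have := ln_P_upper w ltac:(lra); rewrite /index_majorant -!pow_inv -/w; lra.
Qed.

(** The exponential of [mertens_sum_lower], with exp (- d) >= 1 - d. The error X d is 7/2 * 1400000
    exp (- 2/5 X). *)
Lemma primorial_ratio_lower (RH : RiemannHypothesis) k (X := ln (INR (nth_prime k))) : 74 <= X ->
  exp euler_gamma * (X - 28 * / X ^ 4) <= INR (primorial k.+1) / INR (totient (primorial k.+1)).
Proof.
move=> HX; have N1 := ln_ge_gt1 74 _ ltac:(lra) HX.
apply: Rle_trans (primorial_ratio_ge k).
have Ex : INR (nth_prime k) = exp X by rewrite /X exp_ln; lra.
have S := mertens_sum_lower RH (nth_prime k) ltac:(rewrite -/X; lra).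
set d := 7 / 2 * _ / _ in S; rewrite -/X in S.
have X4 : 0 < / X ^ 4 by apply: Rinv_0_lt_compat; apply: pow_lt; lra.
have Hd : X * d <= 28 * / X ^ 4.
  have -> : X * d = 4900000 * / exp (2 / 5 * X).
    rewrite /d /psi_error -/X Ex.
    have -> : exp (3 / 5 * X) = exp X * / exp (2 / 5 * X) by rewrite -exp_Ropp -exp_plus; congr exp; field.
    have := exp_pos X; have := exp_pos (2 / 5 * X); move=> *; field; lra.
  have : / exp (2 / 5 * X) <= / (181500 * X ^ 4).
    by apply: Rinv_le_contravar; [apply: Rmult_lt_0_compat; [lra | apply: pow_lt; lra] | exact: exp_beats_quartic].
  rewrite Rinv_mult; lra.
apply: Rle_trans (exp_mono _ _ S).
have -> : ln X + euler_gamma - d = euler_gamma + (ln X + - d) by ring.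
rewrite !exp_plus exp_ln; last lra.
apply: Rmult_le_compat_l; first by apply: Rlt_le; exact: exp_pos.
have := exp_ineq1_le (- d); nra.
Qed.

Theorem theorem1p3 :
  RiemannHypothesis ->
  forall k : nat, 3900491 * 10 ^ 24 <= INR k ->
    let L := ln (INR k) in
    let LL := ln L in
    INR (primorial k) / INR (totient (primorial k)) >
      exp euler_gamma *
        (L + LL + (LL - 1) / L - (LL ^ 2 - 4 * LL + 5) / (2 * L ^ 2)).
Proof.
move=> RH k Hk L l.
have HL : 70 <= L := ln_threshold _ Hk.
(* The primes of primorial k.+1 are nth_prime 0 to nth_prime k, so X below belongs to the largest of
   them. *)
case: k Hk => [|k] Hk in L l HL *; first by move: Hk => /=; lra.
have [X74 LG] := ln_index_le RH k HL; set X := ln _ in X74 LG; rewrite -/L in LG.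
apply: Rlt_le_trans (primorial_ratio_lower RH k X74); rewrite -/X.
apply: Rmult_lt_compat_l; first exact: exp_pos.
(* If the claimed bound were at least X - 28 / X^4, then X <= L (1 + v), and monotonicity of
   [index_majorant] would bound L by its value at L (1 + v), which [key_ineq] puts below L. *)
apply: Rnot_le_lt => HX.
set z := / L.
have z0 : 0 < z by apply: Rinv_0_lt_compat; lra.
have z1 : z <= 1 / 70 by have : z <= / 70 by [apply: Rinv_le_contravar; lra]; lra.
have Lz : L * z = 1 by rewrite /z; field; lra.
have [l70 l70'] := ln_70_bounds.
have l0 : 4245 / 1000 <= l by have : ln 70 <= l by [apply: ln_le; lra]; lra.
have lz : l * z <= 61 / 1000.
  (* The tangent to ln at 70 shows that ln L / L is at most ln 70 / 70, which is below 0.061. *)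
  have : l <= ln 70 + (L / 70 - 1).
    have E : L = 70 * (L / 70) by field.
    rewrite /l {1}E ln_mult; try lra.
    have := exp_ineq1_le (ln (L / 70)); rewrite exp_ln; lra.
  move=> A; apply: (Rle_trans _ ((ln 70 + (L / 70 - 1)) * z)); first by apply: Rmult_le_compat_r; lra.
  have -> : (ln 70 + (L / 70 - 1)) * z = (ln 70 - 1) * z + L * z / 70 by field.
  rewrite Lz; have : (ln 70 - 1) * z <= 3.265 * (1 / 70) by apply: Rmult_le_compat; lra.
  lra.
have [v0 K] := key_ineq l z l0 (conj z0 z1) lz.
set v := l * z + _ - _ + _ in v0 K.
have LX : L <= X by apply: ln_le; [have := ln_ge_gt1 70 _ ltac:(lra) HL; lra | exact: index_le_nth_prime].
have XX : X <= L * (1 + v).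
  have : / X ^ 4 <= z ^ 4.
    by rewrite /z pow_inv; apply: Rinv_le_contravar; [apply: pow_lt; lra | apply: pow_incr; lra].
  have -> : L * (1 + v) = L + l + (l - 1) / L - (l ^ 2 - 4 * l + 5) / (2 * L ^ 2) + 28 * z ^ 4.
    by rewrite /v /z; field; lra.
  lra.
(* In the variables z and l, ln (L (1 + v)) is l + ln (1 + v), and the inverse of L (1 + v) is the w
   of [key_ineq]. *)
have := Rle_trans _ _ _ LG (index_majorant_increasing X (L * (1 + v)) ltac:(lra)).
rewrite /index_majorant ln_mult; try lra. rewrite -!pow_inv Rinv_mult -/(z / (1 + v)) -/z -/l.
have -> : L * (1 + v) = L + (l + (l - 1) * z - (l ^ 2 - 4 * l + 5) * z ^ 2 / 2 + 28 * z ^ 4).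
  by rewrite /v /z; field; lra.
rewrite /Rdiv -/z in K *; lra.
Qed.
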